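(* Let $d\in\{2,3,\dots\}$, $\nu,\eta\in(0,+\infty)$ and $\mu:=\min(\nu,\eta)$. Assume $\mathbf{v}_0=(v_0,c_0)$ is a generalized Beltrami pair on $\mathbb{T}^d$, and consider the MHD Cauchy problem with initial datum $\mathbf{v}_0$. Let $\kappa,\lambda\in[1,+\infty)$ be such that $\Delta v_0=-\kappa^2v_0$ and $\Delta c_0=-\lambda^2c_0$. Then the following holds. (i) The maximal solution $\mathbf{v}=(v,c)$ of the Cauchy problem is global, and given by $$v(t)=e^{-\kappa^2\nu t}v_0,\qquad c(t)=e^{-\lambda^2\eta t}c_0\qquad\text{for all }t\in[0,+\infty).$$ (ii) For all $p\in\mathbb{R}$ and $t\in[0,+\infty)$, $$\|\mathbf{v}(t)\|_p=\sqrt{e^{-2\kappa^2\nu t}\kappa^{2p}\|v_0\|_{L^2}^2+e^{-2\lambda^2\eta t}\lambda^{2p}\|c_0\|_{L^2}^2}\ \le\ e^{-\kappa^2\nu t}\kappa^p\|v_0\|_{L^2}+e^{-\lambda^2\eta t}\lambda^p\|c_0\|_{L^2}\ \le\ e^{-\min(\kappa^2,\lambda^2)\mu t}\sqrt{\kappa^{2p}+\lambda^{2p}}\,\|\mathbf{v}_0\|_{L^2};$$ so, besides being global, $\mathbf{v}$ is decaying, and $\mathbf{v}_0\in\mathbf{E}^\infty$. (iii) For all $p\in\mathbb{R}$, $$\int_0^{+\infty}\|\mathbf{v}(t)\|_p\,dt\le J_p,\qquad J_p:=\frac{\kappa^{p-2}}{\nu}\|v_0\|_{L^2}+\frac{\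lambda^{p-2}}{\eta}\|c_0\|_{L^2}.$$
   Context: Function spaces. Let $\mathbb{T}^d:=(\mathbb{R}/2\pi\mathbb{Z})^d$. Let $\mathbb{D}'$ be the space of $\mathbb{R}^d$-valued distributions on $\mathbb{T}^d$; each $v\in\mathbb{D}'$ has a Fourier expansion $v=\sum_{k\in\mathbb{Z}^d}v_ke_k$, $e_k(x):=(2\pi)^{-d/2}e^{ik\cdot x}$, $v_k=\overline{v_{-k}}\in\mathbb{C}^d$, where $a\cdot b:=\sum_{r=1}^d a_rb_r$ for $a,b\in\mathbb{C}^d$. (For the vector field named $v_0$ in the claim, the subscript $0$ denotes an initial datum, not a Fourier coefficient.) For $p\in\mathbb{R}$, $$H^p:=\{v\in\mathbb{D}' : \operatorname{div}v=0,\ v \text{ has mean zero},\ \sum_{k\ne0}|k|^{2p}|v_k|^2<+\infty\},$$ with inner product $\langle v|w\rangle_p:=\sum_{k\neq0}|k|^{2p}\,\overline{v_k}\cdot w_k$ and norm $\|v\|_p:=\sqrt{\langle v|v\rangle_p}$. Set $H^\infty:=\bigcap_{p\in\mathbb{R}}H^p$, which equals the space of $C^\infty$ divergence-free, mean-zero vector fields $\mathbb{T}^d\to\mathbb{R}^d$; it is a Fréchet space with the norms $\|\cdot\|_p$, $p\in\mathbb{R}$. The $L^2$ norm is $\|v\|_{L^2}^2=\int_{\mathbb{T}^d}|v|^2dx=\sum_k|v_k|^2$. Pairs. For $p\in\mathbb{R}$, $\mathbf{H}^p:=H^p\times H^p$ with $\langle\mathbf{v}|\mathbf{w}\rangle_p:=\langle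 v|w\rangle_p+\langle c|g\rangle_p$ and $\|\mathbf{v}\|_p:=\sqrt{\|v\|_p^2+\|c\|_p^2}$, and $\|\mathbf{v}\|_{L^2}:=\sqrt{\|v\|_{L^2}^2+\|c\|_{L^2}^2}$, for $\mathbf{v}=(v,c)$, $\mathbf{w}=(w,g)$. $\mathbf{H}^\infty:=\bigcap_{p\in\mathbb{R}}\mathbf{H}^p=H^\infty\times H^\infty$, a Fréchet space with the norms $\|\cdot\|_p$, $p\in\mathbb{R}$. Operators. The Leray projection $\mathfrak{L}$ acts on $\mathbb{D}'$ by $(\mathfrak{L}v)_k=\mathfrak{L}_kv_k$, where $\mathfrak{L}_k$ is the orthogonal projection of $\mathbb{C}^d$ onto $\{a\in\mathbb{C}^d:k\cdot a=0\}$. Put $\mathscr{P}(v,w):=-\mathfrak{L}((v\cdot\nabla)w)$, where $(v\cdot\nabla)w=\sum_{s=1}^d v_s\partial_sw$. For pairs $\mathbf{v}=(v,c)$, $\mathbf{w}=(w,g)$ put $\mathbf{P}(\mathbf{v},\mathbf{w}):=(\mathscr{P}(v,w)-\mathscr{P}(c,g),\ \mathscr{P}(v,g)-\mathscr{P}(c,w))$. MHD solutions. A solution of the MHD equations is a pair $\mathbf{u}=(u,b)\in C^\infty([0,T),\mathbf{H}^\infty)$, $T\in(0,+\infty]$, with $$\frac{du}{dt}=\nu\Delta u+\mathscr{P}(u,u)-\mathscr{P}(b,b),\qquad \frac{db}{dt}=\eta\Delta b+\mathscr{P}(u,b)-\mathscr{P}(b,u)$$ on $[0,T)$; it is a solution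 of the MHD Cauchy problem with initial datum $(u_0,b_0)\in\mathbf{H}^\infty$ if moreover $u(0)=u_0$, $b(0)=b_0$. For each initial datum in $\mathbf{H}^\infty$ the Cauchy problem is known to have a unique maximal (not extendable) solution. A solution is global if $T=+\infty$. Decaying solutions. For real $n>d/2+1$, $\hat G_n\in(0,+\infty)$ is a fixed constant (known to exist) such that $|\langle\mathbf{P}(\mathbf{v},\mathbf{w})|\mathbf{w}\rangle_n|\le\hat G_n\|\mathbf{v}\|_n\|\mathbf{w}\|_n^2$ for $\mathbf{v}\in\mathbf{H}^n$, $\mathbf{w}\in\mathbf{H}^{n+1}$. A global solution $\mathbf{v}$ is called decaying if it has the following properties, which are known to be equivalent to each other: (a) $\|\mathbf{v}(t_0)\|_n<\mu/\hat G_n$ for some real $n>d/2+1$ and some $t_0\ge0$; (b) for some real $n>d/2+1$, $\|\mathbf{v}(t)\|_n\to0$ as $t\to+\infty$; (c) for all $p\in\mathbb{R}$, $\|\mathbf{v}(t)\|_p\to0$ as $t\to+\infty$; (d) for some real $n>d/2+1$ and some $\gamma>0$, $\int_0^{+\infty}\|\mathbf{v}(t)\|_n^\gamma dt<+\infty$; (e) for all $p\in\mathbb{R}$ and $\gamma>0$, $\int_0^{+\infty}\|\mathbf{v}(t)\|_p^\gamma dt<+\infty$; (f) for some real $n>d/2+1$ there is $C_n\in[0,+\infty)$ with $\|\mathbf{v}(t)\|_n\le C_ne^{-\mu t}$ for all $t\ge0$; (g) for each $p\in\mathbb{R}$ there is $C_p\in[0,+\infty)$ with $\|\mathbf{v}(t)\|_p\le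 C_pe^{-\mu t}$ for all $t\ge0$. $\mathbf{E}^\infty\subset\mathbf{H}^\infty$ (depending on $\nu,\eta$) is the set of all initial data in $\mathbf{H}^\infty$ whose maximal MHD solution is global and decaying. Generalized Beltrami flows and pairs. A generalized Beltrami flow on $\mathbb{T}^d$ is a vector field $w_0\in H^\infty$ such that $\Delta w_0=-\kappa^2w_0$ for some $\kappa\in[1,+\infty)$ and $\mathscr{P}(w_0,w_0)=0$. A generalized Beltrami pair is a pair $\mathbf{v}_0=(v_0,c_0)$ of vector fields on $\mathbb{T}^d$ such that both $v_0$ and $c_0$ are generalized Beltrami flows (with $\Delta v_0=-\kappa^2v_0$ and $\Delta c_0=-\lambda^2c_0$ for some $\kappa,\lambda\in[1,+\infty)$, possibly different) and, in addition, $(v_0\cdot\nabla)c_0=(c_0\cdot\nabla)v_0$. *)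

(* Defs.v *)
From HB Require Import structures.
From mathcomp Require Import all_boot all_order all_algebra.
From mathcomp Require Import complex.
From mathcomp Require Import all_classical all_reals all_analysis.

Set Implicit Arguments.
Unset Strict Implicit.
Unset Printing Implicit Defensive.

Import Order.TTheory GRing.Theory Num.Theory.
Import numFieldNormedType.Exports.
Import complex.

Local Open Scope classical_set_scope.
Local Open Scope complex_scope.
Local Open Scope ring_scope.

(* A vector field on (R/2 pi Z)^d is a map R^d -> R^d that is 2 pi-periodic
   in each coordinate; periodicity is part of the predicates [in_H] and
   [in_Hinf] below.  Wave vectors are the elements k of 'rV[int]_d. *)
Notation vfield R d := ('rV[R]_d -> 'rV[R]_d).
Notation vpair R d := (vfield R d * vfield R d)%type.

Section Torus.
Context {R : realType} {d : nat}.
Implicit Types (v w : vfield R d) (k : 'rV[int]_d) (x : 'rV[R]_d).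

Definition basis_vec (s : 'I_d) : 'rV[R]_d := delta_mx ord0 s.

Definition partial (s : 'I_d) v : vfield R d :=
  fun x => 'D_(basis_vec s) v x.

Definition iter_partial (l : seq 'I_d) v : vfield R d :=
  foldr partial v l.

Definition C1_field v : Prop :=
  continuous v /\
  forall s : 'I_d,
    (forall x, derivable v x (basis_vec s)) /\ continuous (partial s v).

Definition smooth_field v : Prop :=
  forall l : seq 'I_d, C1_field (iter_partial l v).

Definition periodic v : Prop :=
  forall (s : 'I_d) x, v (x + (2 * pi) *: basis_vec s) = v x.

Definition divergence v : 'rV[R]_d -> R :=
  fun x => \sum_(s < d) partial s v x ord0 s.

Definition laplacian v : vfield R d :=
  fun x => \sum_(s < d) partial s (partial s v) x.

Definition advect v w : vfield R d :=
  fun x => \sum_(s < d) v x ord0 s *: partial s w x.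

(* Integral over the cube [0, 2 pi]^d as an iterated integral, one coordinate
   after the other; it is only applied to continuous integrands, for which the
   order is irrelevant. *)
Definition torus_int (f : 'rV[R]_d -> R) : R :=
  foldr (fun (s : 'I_d) (g : 'rV[R]_d -> R) (x : 'rV[R]_d) =>
           \int[lebesgue_measure]_(t in `[0, 2 * pi]) g (x + t *: basis_vec s))
        f (enum 'I_d) 0.

Definition torus_cint (f : 'rV[R]_d -> R[i]) : R[i] :=
  torus_int (fun x => Re (f x)) +i* torus_int (fun x => Im (f x)).

Definition mean_zero v : Prop :=
  forall r : 'I_d, torus_int (fun x => v x ord0 r) = 0.

Definition l2norm v : R :=
  Num.sqrt (torus_int (fun x => \sum_(r < d) v x ord0 r ^+ 2)).

(* e_k (x) = (2 pi)^(-d/2) exp (i k.x) *)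
Definition fourier_mode k x : R[i] :=
  let theta : R := \sum_(s < d) (k ord0 s)%:~R * x ord0 s in
  ((2 * pi) `^ (- (d%:R / 2)))%:C * (cos theta +i* sin theta).

Definition fourier_coef v k : 'rV[R[i]]_d :=
  \row_(r < d) torus_cint (fun x => (v x ord0 r)%:C * (fourier_mode k x)^*).

Definition knorm k : R := Num.sqrt (\sum_(s < d) ((k ord0 s)%:~R) ^+ 2).

(* bilinear, as in the usual convention a . b = sum_r a_r b_r on C^d *)
Definition cdot (a b : 'rV[R[i]]_d) : R[i] :=
  \sum_(r < d) a ord0 r * b ord0 r.

Definition cconj (a : 'rV[R[i]]_d) : 'rV[R[i]]_d := map_mx (@conjc R) a.

(* Meaningful for absolutely summable families only. *)
Definition ksum (D : set 'rV[int]_d) (f : 'rV[int]_d -> R) : R :=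
  fine (\esum_(k in D) ((EFin \o f)^\+)%E k) - fine (\esum_(k in D) ((EFin \o f)^\-)%E k).

Definition kcsum (D : set 'rV[int]_d) (f : 'rV[int]_d -> R[i]) : R[i] :=
  ksum D (fun k => Re (f k)) +i* ksum D (fun k => Im (f k)).

Definition nonzero_modes : set 'rV[int]_d := [set k | k != 0].

Definition ip (p : R) v w : R[i] :=
  kcsum nonzero_modes (fun k =>
    (knorm k `^ (2 * p))%:C * cdot (cconj (fourier_coef v k)) (fourier_coef w k)).

Definition hnorm (p : R) v : R := Num.sqrt (Re (ip p v v)).

Definition sobolev_finite (p : R) v : Prop :=
  (\esum_(k in nonzero_modes)
     (knorm k `^ (2 * p) *
      Re (cdot (cconj (fourier_coef v k)) (fourier_coef v k)))%:E < +oo)%E.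

(* For p > d/2 + 1 this is exactly the Sobolev space H^p: every mean zero
   distribution with the stated summability is then a C^1 field.  For smaller p
   it is the set of C^1 fields in H^p; such p only occur in the intersection
   over all p, where regularity is automatic. *)
Definition in_H (p : R) v : Prop :=
  [/\ C1_field v, periodic v, (forall x, divergence v x = 0), mean_zero v
    & sobolev_finite p v].

Definition in_Hinf v : Prop := smooth_field v /\ forall p : R, in_H p v.

(* Orthogonal projection of C^d onto { a | k . a = 0 }; since x / 0 = 0, it is
   the identity for k = 0. *)
Definition leray_mode k (a : 'rV[R[i]]_d) : 'rV[R[i]]_d :=
  let kc : 'rV[R[i]]_d := map_mx intr k in
  a - (cdot kc a / cdot kc kc) *: kc.

(* The Fourier series with coefficients L_k v_k; its sum is real because
   v_(-k) is the conjugate of v_k. *)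
Definition leray v : vfield R d :=
  fun x => \row_(r < d)
    Re (kcsum setT (fun k =>
          leray_mode k (fourier_coef v k) ord0 r * fourier_mode k x)).

Definition bilP v w : vfield R d := - leray (advect v w).

End Torus.

Section Pairs.
Context {R : realType} {d : nat}.
Implicit Types (v w : vpair R d) (T : \bar R) (u : R -> vpair R d).

Definition pair_ip (p : R) v w : R[i] := ip p v.1 w.1 + ip p v.2 w.2.

Definition pair_norm (p : R) v : R :=
  Num.sqrt (hnorm p v.1 ^+ 2 + hnorm p v.2 ^+ 2).

Definition pair_l2norm v : R := Num.sqrt (l2norm v.1 ^+ 2 + l2norm v.2 ^+ 2).

Definition pair_in_H (p : R) v : Prop := in_H p v.1 /\ in_H p v.2.

Definition pair_in_Hinf v : Prop := in_Hinf v.1 /\ in_Hinf v.2.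

Definition pairP v w : vpair R d :=
  (bilP v.1 w.1 - bilP v.2 w.2, bilP v.1 w.2 - bilP v.2 w.1).

Definition mhd_rhs (nu eta : R) v : vpair R d :=
  (nu *: laplacian v.1 + bilP v.1 v.1 - bilP v.2 v.2,
   eta *: laplacian v.2 + bilP v.1 v.2 - bilP v.2 v.1).

Definition time_dom T : set R := [set t | 0 <= t /\ (t%:E < T)%E].

(* w is the derivative at t of the curve u : [0, T) -> H^oo, for the Frechet
   topology given by all the norms of index p (one-sided derivative at t = 0). *)
Definition has_deriv T u (t : R) w : Prop :=
  pair_in_Hinf w /\ forall p : R,
    (fun s : R => pair_norm p ((s - t)^-1 *: (u s - u t) - w))
      @ within (time_dom T) t^' --> (0 : R).

(* u belongs to C^oo([0, T), H^oo) *)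
Definition smooth_curve T u : Prop :=
  exists D : nat -> R -> vpair R d,
    (forall t, time_dom T t -> D 0%N t = u t) /\
    (forall (j : nat) t, time_dom T t ->
       pair_in_Hinf (D j t) /\ has_deriv T (D j) t (D j.+1 t)).

Definition mhd_solution (nu eta : R) T u : Prop :=
  [/\ (0 < T)%E, smooth_curve T u
    & forall t, time_dom T t -> has_deriv T u t (mhd_rhs nu eta (u t))].

Definition mhd_cauchy_solution (nu eta : R) (u0 : vpair R d) T u : Prop :=
  mhd_solution nu eta T u /\ u 0 = u0.

Definition maximal_solution (nu eta : R) (u0 : vpair R d) T u : Prop :=
  mhd_cauchy_solution nu eta u0 T u /\
  forall T' (u' : R -> vpair R d),
    (T < T')%E -> mhd_cauchy_solution nu eta u0 T' u' ->
    ~ (forall t, time_dom T t -> u' t = u t).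

(* Existence and uniqueness of the maximal solution are part of the claim. *)
Definition the_maximal_solution (nu eta : R) (u0 : vpair R d) T u : Prop :=
  maximal_solution nu eta u0 T u /\
  forall T' (u' : R -> vpair R d), maximal_solution nu eta u0 T' u' ->
    T' = T /\ (forall t, time_dom T t -> u' t = u t).

Definition above_critical (n : R) : Prop := d%:R / 2 + 1 < n.

(* Ghat n, for n > d/2 + 1, is a positive constant such that
   | <P(v,w) | w>_n | <= Ghat n * |v|_n * |w|_n^2 *)
Definition is_Ghat (Ghat : R -> R) : Prop :=
  forall n : R, above_critical n ->
    0 < Ghat n /\
    forall v w, pair_in_H n v -> pair_in_H (n + 1) w ->
      `| pair_ip n (pairP v w) w | <=
        (Ghat n * pair_norm n v * pair_norm n w ^+ 2)%:C.

Definition power_integral (n gamma : R) u : \bar R :=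
  (\int[lebesgue_measure]_(t in `[0%R, +oo[)
     ((pair_norm n (u t)) `^ gamma)%:E)%E.

(* The seven properties are known to be equivalent; all are required. *)
Record decaying (nu eta : R) (Ghat : R -> R) u : Prop := Decaying {
  decaying_global : mhd_solution nu eta +oo%E u;
  decaying_a : exists n t0 : R, [/\ above_critical n, 0 <= t0
    & pair_norm n (u t0) < Num.min nu eta / Ghat n];
  decaying_b : exists n : R, above_critical n /\
    pair_norm n (u t) @[t --> +oo] --> (0 : R);
  decaying_c : forall p : R, pair_norm p (u t) @[t --> +oo] --> (0 : R);
  decaying_d : exists n gamma : R, [/\ above_critical n, 0 < gamma
    & (power_integral n gamma u < +oo)%E];
  decaying_e : forall p gamma : R, 0 < gamma ->
    (power_integral p gamma u < +oo)%E;
  decaying_f : exists n C : R, [/\ above_critical n, 0 <= C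
    & forall t, 0 <= t ->
        pair_norm n (u t) <= C * expR (- (Num.min nu eta * t))];
  decaying_g : forall p : R, exists C : R, 0 <= C /\
    forall t, 0 <= t ->
      pair_norm p (u t) <= C * expR (- (Num.min nu eta * t)) }.

Definition in_Einf (nu eta : R) (Ghat : R -> R) (u0 : vpair R d) : Prop :=
  pair_in_Hinf u0 /\
  exists u, the_maximal_solution nu eta u0 +oo%E u /\ decaying nu eta Ghat u.

End Pairs.

Section Beltrami.
Context {R : realType} {d : nat}.

Definition gen_beltrami_flow (w : vfield R d) : Prop :=
  [/\ in_Hinf w, exists2 kappa : R, 1 <= kappa & laplacian w = - kappa ^+ 2 *: w
    & bilP w w = 0].

Definition gen_beltrami_pair (v : vpair R d) : Prop :=
  [/\ gen_beltrami_flow v.1, gen_beltrami_flow v.2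
    & advect v.1 v.2 = advect v.2 v.1].

End Beltrami.

(* Main.v *)
Require Import Defs.
From mathcomp Require Import all_boot all_order all_algebra.
From mathcomp Require Import complex.
From mathcomp Require Import all_classical all_reals all_analysis.
From mathcomp Require Import measurable_realfun.
From mathcomp Require Import ring lra zify.
Import Order.TTheory GRing.Theory Num.Theory.
Import numFieldNormedType.Exports.
Set Implicit Arguments.
Unset Strict Implicit.
Unset Printing Implicit Defensive.
Local Open Scope classical_set_scope.
Local Open Scope ring_scope.

(** The vector fields e^(- kappa^2 nu t) v0 and e^(- lambda^2 eta t) c0 solve
    the MHD system because every nonlinear term cancels: P(v0, v0) and
    P(c0, c0) vanish by hypothesis, and in the second equation the two mixed
    terms P(v0, c0) and P(c0, v0) coincide, since v0 and c0 have equal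
    advections of one another.  What is left are two decoupled heat equations
    on eigenfields of the Laplacian.  As the wave vectors of an eigenfield lie
    on one sphere |k| = kappa, its norm of index p is kappa^p times its L^2
    norm, and all the estimates of (ii) and (iii), as well as the seven forms
    of decay, are then elementary facts on real exponentials
    ([decay_pair_bounds], [decay_pair_integral],
    [exponential_decay_decaying]).

    The substance of the proof is uniqueness: every solution with the same
    initial datum agrees with the explicit one ([mhd_unique]), and a
    non-extendable one is therefore global ([global_unique_maximal]).  Let
    u = (y, z) be a solution, v = e^(- kappa^2 nu t) v0 and
    c = e^(- lambda^2 eta t) c0, and w = (y - v, z - c).  The right-hand side
    of the equation for w consists of a dissipative part, of the flow part
    P(u, w), which the constant G_n controls by |u|_n |w|_n^2, and of terms in
    which the difference w advects v0 or c0.  The last ones lose no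
    derivative: v0 and c0 are trigonometric polynomials, and multiplying by
    one only shifts the Fourier coefficients by finitely many wave vectors,
    which distorts the Sobolev weight by a bounded factor
    ([advect_trig_bound]).  Hence d/dt |w|_n^2 <= K |w|_n^2 on every compact
    time interval ([energy_inequality]), and Gronwall's lemma gives w = 0.

    All of this is carried out on Fourier coefficients, so the bulk of the
    text is the Fourier analysis of smooth periodic functions relative to the
    iterated integral [torus_int]: vanishing of the integral of a partial
    derivative ([torus_int_pd]), completeness of the trigonometric system
    ([fourier_unique]), absolute summability of the coefficients of a smooth
    function ([fourier_absum]), and recovery of the coefficients of a
    trigonometric series ([fourier_series_coef]).  The last fact shows that
    the Leray projection, although defined through a series, acts on
    coefficients as expected, whence the identity
    <w, P(y, z)>_k = - <w, (y . grad) z>_k for divergence-free w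
    ([mode_ip_bilP]), through which the projection disappears from the energy
    estimate.

    Complex coefficients are handled by their real and imaginary parts [fcos]
    and [fsin], and the inner product of index p by its real part [rip]. *)

(** * Iterated integrals over the period cube *)

Section Slices.
Context {R : realType} {d : nat}.
Implicit Types (f g : 'rV[R]_d -> R).

Lemma continuous_slice f x e :
  continuous f -> continuous (fun t : R => f (x + t *: e)).
Proof.
move=> cf t; apply: (@continuous_comp _ _ _ (fun t : R => x + t *: e) f); last exact: cf.
apply: cvgD; first exact: cvg_cst.
by apply: cvgZr_tmp; exact: cvg_id.
Qed.

Lemma twopi_gt0 : 0 < 2 * pi :> R.
Proof. by rewrite mulr_gt0// pi_gt0. Qed.

Lemma continuous_integrable (g : R -> R) (a b : R) : continuous g ->
  (@lebesgue_measure R).-integrable `[a, b] (EFin \o g).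
Proof.
move=> cg; apply: continuous_compact_integrable; first exact: segment_compact.
exact: continuous_subspaceT.
Qed.

Lemma slice_integrable f x e : continuous f ->
  (@lebesgue_measure R).-integrable `[0, 2 * pi] (EFin \o (fun t => f (x + t *: e))).
Proof. by move=> cf; apply: continuous_integrable; exact: continuous_slice. Qed.

Definition slice_int (s : 'I_d) f x : R :=
  \int[lebesgue_measure]_(t in `[0, 2 * pi]) f (x + t *: basis_vec s).

Definition iter_int (l : seq 'I_d) f : 'rV[R]_d -> R := foldr slice_int f l.

Lemma torus_intE f : torus_int f = iter_int (enum 'I_d) f 0.
Proof. by []. Qed.

Lemma slice_intD s f g x : continuous f -> continuous g ->
  slice_int s (f \+ g) x = slice_int s f x + slice_int s g x.
Proof.
by move=> cf cg; apply: RintegralD => //; exact: slice_integrable.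
Qed.

Lemma slice_intZ s a f x : continuous f ->
  slice_int s (fun y => a * f y) x = a * slice_int s f x.
Proof.
by move=> cf; apply: RintegralZl => //; exact: slice_integrable.
Qed.

Lemma le_slice_int s f g x : continuous f -> continuous g ->
  (forall y, f y <= g y) -> slice_int s f x <= slice_int s g x.
Proof.
move=> cf cg fg; apply: le_Rintegral => //; exact: slice_integrable.
Qed.

Lemma slice_int_cst s a x : slice_int s (fun=> a) x = a * (2 * pi).
Proof.
rewrite /slice_int Rintegral_cst//=.
rewrite lebesgue_measure_itv/= lte_fin twopi_gt0/=.
by rewrite subr0.
Qed.

(** A jointly continuous family is equicontinuous in the parameter along a
    compact set; this replaces every appeal to uniform continuity below. *)
Lemma uniform_near_compact {T U : topologicalType} (K : set T) (G : U -> T -> R) u (eps : R) :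
  compact K ->
  (forall t, K t -> {for (u, t), continuous (fun p : U * T => G p.1 p.2)}) ->
  0 < eps ->
  \forall v \near u, forall t, K t -> `|G v t - G u t| < eps.
Proof.
move=> cK cG e0.
have H := (iffLR (compact_near_coveringP K) cK) U (nbhs u)
  (fun v t => `|G v t - G u t| < eps) (nbhs_filter u).
apply: H => t Kt.
have /cvgrPdist_lt/(_ (eps / 2)) := cG t Kt.
rewrite divr_gt0// => /(_ isT)[/= [P Q] /= [Pu Qt] PQ].
exists (Q, P) => //= -[t' v] /= [Qt' Pv].
have h1 := PQ (v, t') (conj Pv Qt').
have h2 := PQ (u, t') (conj (nbhs_singleton Pu) Qt').
rewrite /= in h1 h2.
rewrite (_ : _ - _ = (G u t - G u t') - (G u t - G v t')); last by ring.
by rewrite (le_lt_trans (ler_normB _ _))// (splitr eps) ltrD.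
Qed.

Lemma slice_joint_continuous f e (y : 'rV[R]_d) (t : R) : continuous f ->
  {for (y, t), continuous (fun p : 'rV[R]_d * R => f (p.1 + p.2 *: e))}.
Proof.
move=> cf; apply: (@continuous_comp _ _ _ (fun p : 'rV[R]_d * R => p.1 + p.2 *: e) f); last exact: cf.
apply: cvgD; first exact: cvg_fst.
by apply: cvgZr_tmp; exact: cvg_snd.
Qed.

Lemma slice_joint_continuous2 f e (y : 'rV[R]_d) (t : R) : continuous f ->
  {for (t, y), continuous (fun p : R * 'rV[R]_d => f (p.2 + p.1 *: e))}.
Proof.
move=> cf; apply: (@continuous_comp _ _ _ (fun p : R * 'rV[R]_d => p.2 + p.1 *: e) f); last exact: cf.
apply: cvgD; first exact: cvg_snd.
by apply: cvgZr_tmp; exact: cvg_fst.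
Qed.

Lemma continuous_distP {U : topologicalType} (g : U -> R) :
  (forall (x : U) (e : R), 0 < e -> \forall y \near x, `|g x - g y| <= e) -> continuous g.
Proof. by move=> H x; apply/cvgrPdist_le => e e0; exact: H. Qed.

Lemma continuous_slice_int s f : continuous f -> continuous (slice_int s f).
Proof.
move=> cf; apply: continuous_distP => x e e0.
have e1 : 0 < e / (2 * pi) by rewrite divr_gt0// twopi_gt0.
have H := @uniform_near_compact R 'rV[R]_d [set` `[0, 2 * pi]]
  (fun y t => f (y + t *: basis_vec s)) x _ (@segment_compact _ _ _)
  (fun t _ => @slice_joint_continuous f _ x t cf) e1.
apply: filterS H => y H.
rewrite /slice_int -RintegralB//; [|exact: slice_integrable..].
apply: (le_trans (le_normr_Rintegral _ _)) => //.
  by apply: continuous_integrable => t; apply: continuousB; exact: continuous_slice.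
rewrite -[leRHS](divfK (lt0r_neq0 twopi_gt0)) -(slice_int_cst s _ x).
apply: le_Rintegral => //.
- apply: continuous_integrable => t; apply: cvg_norm.
  by apply: continuousB; exact: continuous_slice.
- by apply: continuous_integrable => t; exact: cvg_cst.
- by move=> t /H; rewrite distrC => /ltW.
Qed.

(** The interval of integration starts at - M, well to the left of the points
    of interest, so that one-sided derivatives at an end point never have to be
    discussed. *)
Lemma antiderivative (phi : R -> R) (M : R) : continuous phi ->
  exists Phi : R -> R, forall x : R, - M < x < M -> is_derive x 1 Phi (phi x).
Proof.
move=> cphi.
exists (fun x => \int[lebesgue_measure]_(t in `[- M, x]) phi t) => x /andP[Mx xM].
have [h1 h2] := @continuous_FTC1_closed R phi (- M) x M xM
  (continuous_integrable _ _ cphi) Mx (cphi x).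
by apply: DeriveDef; [exact: h1|rewrite -derive1E; exact: h2].
Qed.

Lemma is_derive_continuous (F : R -> R) (x l : R) : is_derive x 1 F l -> {for x, continuous F}.
Proof. by move=> H; apply/differentiable_continuous/derivable1_diffP. Qed.

Lemma Rintegral_FTC (phi Phi : R -> R) (a b : R) : a < b -> continuous phi ->
  (forall x : R, a <= x <= b -> is_derive x 1 Phi (phi x)) ->
  \int[lebesgue_measure]_(t in `[a, b]) phi t = Phi b - Phi a.
Proof.
move=> ab cphi H; rewrite /Rintegral (@continuous_FTC2 _ _ Phi)//.
- exact: continuous_subspaceT.
- split.
  + move=> x; rewrite in_itv/= => /andP[ax xb].
    by have [] := H x; rewrite ?(ltW ax) ?(ltW xb).
  + apply: cvg_at_right_filter; apply: (@is_derive_continuous _ _ (phi a)); apply: H.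
    by rewrite lexx ltW.
  + apply: cvg_at_left_filter; apply: (@is_derive_continuous _ _ (phi b)); apply: H.
    by rewrite lexx ltW.
- move=> x; rewrite in_itv/= => /andP[ax xb].
  rewrite derive1E; have h : is_derive x 1 Phi (phi x) by apply: H; rewrite !ltW.
  exact: derive_val.
Qed.

(** With an antiderivative Phi, the integral over a period starting at h is Phi
    (2 pi + h) - Phi h, whose derivative in h vanishes by periodicity. *)
Lemma Rintegral_shift (phi : R -> R) (h : R) : continuous phi ->
  (forall t, phi (t + 2 * pi) = phi t) -> 
  \int[lebesgue_measure]_(t in `[0, 2 * pi]) phi (h + t) =
  \int[lebesgue_measure]_(t in `[0, 2 * pi]) phi t.
Proof.
move=> cphi per; have p0 := twopi_gt0.
pose M := `|h| + 2 * pi + 1.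
have [hM1 hM2] : h <= M - 2 * pi - 1 /\ - (M - 2 * pi - 1) <= h.
  have -> : M - 2 * pi - 1 = `|h| by rewrite /M; ring.
  by rewrite ler_norm; split => //; rewrite lerNl (le_trans (ler_norm _)) ?normrN.
have h0 := normr_ge0 h.
have [Phi HPhi] := antiderivative M cphi.
have csh : continuous (fun t => phi (h + t)).
  move=> t; apply: (@continuous_comp _ _ _ (fun t => h + t) phi); last exact: cphi.
  by apply: cvgD; [exact: cvg_cst|exact: cvg_id].
have dsh (k x : R) : - M < x + k < M -> is_derive x 1 (fun y => Phi (k + y)) (phi (k + x)).
  move=> xk.
  rewrite (_ : (fun y => Phi (k + y)) = (Phi \o shift k)); last first.
    by apply/funext => y /=; rewrite addrC.
  rewrite [k + x]addrC; rewrite -[phi _]mulr1; apply: (@is_derive1_comp R Phi (shift k)); [exact: HPhi|exact: is_derive_shift].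
have -> : \int[lebesgue_measure]_(t in `[0, 2 * pi]) phi (h + t) =
    Phi (h + 2 * pi) - Phi (h + 0).
  apply: (@Rintegral_FTC (fun t => phi (h + t)) (fun t => Phi (h + t))) => // x /andP[x0 x1].
  by apply: dsh; rewrite /M in hM1 hM2 *; lra.
have -> : \int[lebesgue_measure]_(t in `[0, 2 * pi]) phi t = Phi (2 * pi) - Phi 0.
  apply: (@Rintegral_FTC phi Phi) => // x /andP[x0 x1].
  by apply: HPhi; rewrite /M in hM1 hM2 *; lra.
(* Psi k is the integral of phi over the period that starts at k. *)
pose Psi (k : R) := Phi (2 * pi + k) - Phi k.
suff: Psi h = Psi 0 by rewrite /Psi !addr0 [2 * pi + h]addrC.
have dPsi (k : R) : (`|k| <= `|h|) -> is_derive k 1 Psi 0.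
  rewrite ler_norml => /andP[k1 k2].
  have -> : 0 = phi (2 * pi + k) - phi k by rewrite [2 * pi + k]addrC per subrr.
  apply: is_deriveB.
    by apply: dsh; rewrite /M; lra.
  by apply: HPhi; rewrite /M; lra.
have cPsi (a b : R) : `|a| <= `|h| -> `|b| <= `|h| -> {within `[a, b], continuous Psi}.
  move=> ah bh; apply: continuous_in_subspaceT => x /set_mem; rewrite /= in_itv/= => /andP[ax xb].
  apply: (@is_derive_continuous _ _ 0); apply: dPsi.
  by move: ah bh; rewrite !ler_norml; lra.
have [hh|hh] := leP 0 h.
- have [||c _] := @MVT_segment R Psi (fun=> 0) 0 h hh.
  + move=> x; rewrite in_itv/= => /andP[x0 xh]; apply: dPsi; rewrite !ger0_norm; lra.
  + by apply: cPsi; rewrite ?normr0.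
  + by rewrite mul0r => /eqP; rewrite subr_eq0 => /eqP.
- have [||c _] := @MVT_segment R Psi (fun=> 0) h 0 (ltW hh).
  + move=> x; rewrite in_itv/= => /andP[x0 xh]; apply: dPsi; rewrite !ltr0_norm; lra.
  + by apply: cPsi; rewrite ?normr0.
  + by rewrite mul0r => /eqP; rewrite subr_eq0 => /eqP.
Qed.

Definition periodic_in s f := forall x, f (x + (2 * pi) *: basis_vec s) = f x.

Lemma slice_int_shift s f x h : continuous f -> periodic_in s f ->
  slice_int s f (x + h *: basis_vec s) = slice_int s f x.
Proof.
move=> cf pf; rewrite /slice_int.
rewrite -(@Rintegral_shift (fun t => f (x + t *: basis_vec s)) h).
- by apply: eq_Rintegral => t _; rewrite -addrA -scalerDl.
- exact: continuous_slice.
- by move=> t; rewrite scalerDl addrA pf.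
Qed.

Lemma continuous_iter_int l f : continuous f -> continuous (iter_int l f).
Proof. by move=> cf; elim: l => //= s l IH; exact: continuous_slice_int. Qed.

Lemma iter_intD l f g x : continuous f -> continuous g ->
  iter_int l (f \+ g) x = iter_int l f x + iter_int l g x.
Proof.
move=> cf cg; elim: l x => //= s l IH x.
rewrite -slice_intD; [|exact: continuous_iter_int..].
by congr (slice_int s _ x); apply/funext.
Qed.

Lemma iter_intZ l a f x : continuous f ->
  iter_int l (fun y => a * f y) x = a * iter_int l f x.
Proof.
move=> cf; elim: l x => //= s l IH x.
rewrite -slice_intZ; last exact: continuous_iter_int.
by congr (slice_int s _ x); apply/funext.
Qed.

Lemma le_iter_int l f g x : continuous f -> continuous g ->
  (forall y, f y <= g y) -> iter_int l f x <= iter_int l g x.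
Proof.
move=> cf cg fg; elim: l x => //= s l IH x.
by apply: le_slice_int => //; exact: continuous_iter_int.
Qed.

Lemma iter_int_cst l a x : iter_int l (fun=> a) x = a * (2 * pi) ^+ size l.
Proof.
elim: l x => [|s l IH] x /=; first by rewrite expr0 mulr1.
rewrite (_ : iter_int l (fun=> a) = fun=> a * (2 * pi) ^+ size l); last exact/funext.
by rewrite slice_int_cst -mulrA -exprSr.
Qed.

(** Translation commutes with the partial integrals in any direction, hence
    periodicity in one coordinate survives the integrations in the others. *)
Lemma iter_int_comp_shift l f v x :
  iter_int l (fun y => f (y + v)) x = iter_int l f (x + v).
Proof.
elim: l x => //= s l IH x.
by apply: eq_Rintegral => t _; rewrite IH addrAC.
Qed.

Lemma iter_int_shift l s f x h : continuous f -> periodic_in s f -> s \in l ->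
  iter_int l f (x + h *: basis_vec s) = iter_int l f x.
Proof.
move=> cf pf; elim: l x => //= s' l IH x.
rewrite in_cons; have [<- _|ss' /= sl] := eqVneq s s'.
  apply: slice_int_shift; first exact: continuous_iter_int.
  by move=> y; rewrite -iter_int_comp_shift; congr (iter_int l _ y); apply/funext.
by apply: eq_Rintegral => t _; rewrite addrAC IH.
Qed.

(** If the integral of a nonnegative continuous function were 0, its
    antiderivative, being monotone with equal end values, would be constant;
    but it increases strictly near a point where the function is positive. *)
Lemma slice_int_gt0 s f x t : continuous f -> (forall y, 0 <= f y) ->
  0 <= t <= 2 * pi -> 0 < f (x + t *: basis_vec s) -> 0 < slice_int s f x.
Proof.
move=> cf f0 t0 ft.
have i0 : 0 <= slice_int s f x by apply: Rintegral_ge0.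
rewrite lt_neqAle i0 andbT; apply/negP => /eqP i0'.
pose phi u := f (x + u *: basis_vec s).
have cphi : continuous phi by exact: continuous_slice.
have [Phi HPhi] := antiderivative (2 * pi + 1) cphi.
have p0 := twopi_gt0.
have dPhi (y : R) : 0 <= y <= 2 * pi -> is_derive y 1 Phi (phi y).
  by move=> y0; apply: HPhi; lra.
have E : Phi (2 * pi) = Phi 0.
  by apply/eqP; rewrite -subr_eq0 -(@Rintegral_FTC phi)//; apply/eqP; rewrite /phi -[LHS]/(slice_int s f x) -i0'.
have cw (a b : R) : 0 <= a -> b <= 2 * pi -> {within `[a, b], continuous Phi}.
  move=> a0 b2; apply: continuous_in_subspaceT => y /set_mem; rewrite /= in_itv/= => /andP[ay yb].
  by apply: (@is_derive_continuous _ _ (phi y)); apply: dPhi; lra.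
have mvt (y z : R) : 0 <= y -> y <= z -> z <= 2 * pi ->
    exists2 c, y <= c <= z & Phi z - Phi y = phi c * (z - y).
  move=> y0 yz z2.
  have [||c] := @MVT_segment R Phi phi y z yz.
  + by move=> u; rewrite in_itv/= => ui; apply: dPhi; lra.
  + exact: cw.
  + by rewrite in_itv/= => ci ->; exists c.
have mono (y z : R) : 0 <= y -> y <= z -> z <= 2 * pi -> Phi y <= Phi z.
  move=> y0 yz z2; rewrite -subr_ge0; have [c _ ->] := mvt y z y0 yz z2.
  by rewrite mulr_ge0// ?f0// subr_ge0.
have : \forall u \near t, `|phi t - phi u| < phi t.
  by have /cvgrPdist_lt := cphi t; apply.
move=> /nbhs_ballP[del /= del0 Hdel].
pose a := Num.max 0 (t - del / 2); pose b := Num.min (2 * pi) (t + del / 2).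
have [ab a0 b2 ta tb] : [/\ a < b, 0 <= a, b <= 2 * pi, t - del / 2 <= a & b <= t + del / 2].
  by rewrite /a /b lt_min !gt_max !le_max !ge_min !lexx /= !orbT; split => //; lra.
have [c ci Ec] := mvt a b a0 (ltW ab) b2.
have : 0 < phi c.
  have h' : `|t - c| < del by rewrite ltr_norml; lra.
  have := Hdel c h'; rewrite /= ltr_norml; lra.
have h1 : 0 <= Phi a - Phi 0 by rewrite subr_ge0 mono// (le_trans (ltW ab)).
have h2 : 0 <= Phi (2 * pi) - Phi b by rewrite subr_ge0 mono// (le_trans _ (ltW ab)).
move=> pc; have : 0 < phi c * (b - a) by rewrite mulr_gt0// subr_gt0.
by rewrite -Ec; lra.
Qed.

(** The integral is positive as soon as f is positive at one point y of the
    cube based at x: moving the coordinates of x to those of y one after the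
    other stays in the range of the partial integrals. *)
Lemma iter_int_gt0 l f (x y : 'rV[R]_d) : uniq l -> continuous f -> (forall z, 0 <= f z) ->
  (forall s, s \in l -> 0 <= y ord0 s - x ord0 s <= 2 * pi) ->
  (forall s, s \notin l -> y ord0 s = x ord0 s) -> 0 < f y ->
  0 < iter_int l f x.
Proof.
move=> ul cf f0; elim: l x ul => [|s l IH] x /= ul H1 H2 fy.
  by rewrite (_ : x = y)//; apply/rowP => i; rewrite H2.
case/andP: ul => sl ul.
apply: (@slice_int_gt0 s _ x (y ord0 s - x ord0 s)).
- exact: continuous_iter_int.
- move=> z; rewrite -[leLHS](mul0r ((2 * pi) ^+ size l)) -(iter_int_cst l 0 z).
  by apply: le_iter_int => //; exact: cst_continuous.
- by apply: H1; rewrite inE eqxx.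
have E r : (x + (y ord0 s - x ord0 s) *: basis_vec s) ord0 r = if r == s then y ord0 s else x ord0 r.
  by rewrite !mxE eqxx/=; case: eqP => [->|_]; rewrite ?mulr1 ?mulr0 ?addr0 // addrC subrK.
apply: IH => // r rl; rewrite E.
  by case: eqP => [rs|_]; [rewrite rs (negbTE sl) in rl|apply: H1; rewrite inE rl orbT].
by case: eqVneq => [->//|rs]; apply: H2; rewrite inE negb_or rs.
Qed.

End Slices.

(** * Continuous periodic functions and partial derivatives *)

Section TorusIntegral.
Context {R : realType} {d : nat}.
Implicit Types (f g : 'rV[R]_d -> R).
Let twopi0 : 0 < 2 * pi :> R := twopi_gt0.

Definition cper f := continuous f /\ forall s, periodic_in s f.

Lemma cper_cst a : cper (fun=> a).
Proof. by split => //; exact: cst_continuous. Qed.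

Lemma cperD f g : cper f -> cper g -> cper (fun x => f x + g x).
Proof.
move=> [cf pf] [cg pg]; split => [x|s x]; last by rewrite pf pg.
by apply: continuousD; [exact: cf|exact: cg].
Qed.

Lemma cperM f g : cper f -> cper g -> cper (fun x => f x * g x).
Proof.
move=> [cf pf] [cg pg]; split => [x|s x]; last by rewrite pf pg.
by apply: continuousM; [exact: cf|exact: cg].
Qed.

Lemma cperZ a f : cper f -> cper (fun x => a * f x).
Proof. exact: (cperM (cper_cst a)). Qed.

Lemma cperN f : cper f -> cper (fun x => - f x).
Proof.
by move=> /(cperZ (-1)); congr cper; apply/funext => x; rewrite mulN1r.
Qed.

Lemma cperB f g : cper f -> cper g -> cper (fun x => f x - g x).
Proof. by move=> cf cg; apply: cperD => //; exact: cperN. Qed.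

Lemma cper_sum (T : Type) (r : seq T) (P : pred T) (F : T -> 'rV[R]_d -> R) :
  (forall i, P i -> cper (F i)) -> cper (fun x => \sum_(i <- r | P i) F i x).
Proof.
move=> H; elim: r => [|i r IH].
  rewrite (_ : (fun x => _) = fun=> 0); first exact: cper_cst.
  by apply/funext => x; rewrite big_nil.
have [Pi|nPi] := boolP (P i).
  rewrite (_ : (fun x => _) = fun x => F i x + \sum_(i <- r | P i) F i x).
    by apply: cperD => //; exact: H.
  by apply/funext => x; rewrite big_cons Pi.
rewrite (_ : (fun x => _) = fun x => \sum_(i <- r | P i) F i x)//.
by apply/funext => x; rewrite big_cons (negbTE nPi).
Qed.

Lemma cperX n f : cper f -> cper (fun x => f x ^+ n).
Proof.
move=> cf; elim: n => [|n IH].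
  rewrite (_ : (fun x => _) = fun=> 1); first exact: cper_cst.
  by apply/funext => x; rewrite expr0.
rewrite (_ : (fun x => _) = fun x => f x * f x ^+ n); first exact: cperM.
by apply/funext => x; rewrite exprS.
Qed.

Lemma cper_shift v f : cper f -> cper (fun x => f (x + v)).
Proof.
move=> [cf pf]; split => [x|s x]; last by rewrite addrAC pf.
apply: (@continuous_comp _ _ _ (fun x : 'rV[R]_d => x + v) f); last exact: cf.
by apply: (@cvgD _ _ _ (nbhs x) _ id (fun=> v)); [exact: cvg_id|exact: cvg_cst].
Qed.

Lemma cper_comp (h : R -> R) f : continuous h -> cper f -> cper (h \o f).
Proof.
move=> ch [cf pf]; split => [x|s x] /=; last by rewrite pf.
by apply: continuous_comp; [exact: cf|exact: ch].
Qed.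

Notation I := (@torus_int R d).

Lemma torus_intD f g : cper f -> cper g -> I (fun x => f x + g x) = I f + I g.
Proof. by move=> [cf _] [cg _]; exact: iter_intD. Qed.

Lemma torus_intZ a f : cper f -> I (fun x => a * f x) = a * I f.
Proof. by move=> [cf _]; exact: iter_intZ. Qed.

Lemma torus_intN f : cper f -> I (fun x => - f x) = - I f.
Proof.
by move=> cf; rewrite -mulN1r -torus_intZ//; congr I; apply/funext => x; rewrite mulN1r.
Qed.

Lemma torus_intB f g : cper f -> cper g -> I (fun x => f x - g x) = I f - I g.
Proof. by move=> cf cg; rewrite torus_intD ?torus_intN//; exact: cperN. Qed.

Lemma torus_int_lin a b f g : cper f -> cper g ->
  I (fun x => a * f x + b * g x) = a * I f + b * I g.
Proof. by move=> cf cg; rewrite torus_intD ?torus_intZ//; exact: cperZ. Qed.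

Lemma le_torus_int f g : cper f -> cper g -> (forall x, f x <= g x) -> I f <= I g.
Proof. by move=> [cf _] [cg _] fg; exact: le_iter_int. Qed.

Lemma torus_int_cst a : I (fun=> a) = a * (2 * pi) ^+ d.
Proof. by rewrite torus_intE iter_int_cst size_enum_ord. Qed.

Lemma torus_int_shift f s h : cper f -> I (fun x => f (x + h *: basis_vec s)) = I f.
Proof.
move=> [cf pf]; rewrite !torus_intE iter_int_comp_shift.
by apply: iter_int_shift => //; rewrite mem_enum.
Qed.

Lemma torus_int_sum (T : Type) (r : seq T) (P : pred T) (F : T -> 'rV[R]_d -> R) :
  (forall i, P i -> cper (F i)) ->
  I (fun x => \sum_(i <- r | P i) F i x) = \sum_(i <- r | P i) I (F i).
Proof.
move=> H; elim: r => [|i r IH].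
  rewrite big_nil -[RHS](mul0r ((2 * pi) ^+ d)) -torus_int_cst; congr I.
  by apply/funext => x; rewrite big_nil.
rewrite big_cons; case: ifPn => Pi.
  rewrite -IH -torus_intD//; [|exact: H|exact: cper_sum].
  by congr I; apply/funext => x; rewrite big_cons Pi.
by rewrite -IH; congr I; apply/funext => x; rewrite big_cons (negbTE Pi).
Qed.

Lemma torus_int_norm_le f M : cper f -> (forall x, `|f x| <= M) ->
  `|I f| <= M * (2 * pi) ^+ d.
Proof.
move=> cf fM; rewrite ler_norml -mulNr -!torus_int_cst; apply/andP; split.
  apply: le_torus_int => //; first exact: cper_cst.
  by move=> x; have := fM x; rewrite ler_norml => /andP[].
apply: le_torus_int => //; first exact: cper_cst.
by move=> x; have := fM x; rewrite ler_norml => /andP[].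
Qed.

Lemma periodic_int s f (x : 'rV[R]_d) (m : int) : periodic_in s f ->
  f (x + (m%:~R * (2 * pi)) *: basis_vec s) = f x.
Proof.
move=> pf.
have P (n : nat) (y : 'rV[R]_d) : f (y + (n%:R * (2 * pi)) *: basis_vec s) = f y.
  elim: n y => [|n IH] y; first by rewrite mul0r scale0r addr0.
  by rewrite -natr1 mulrDl mul1r scalerDl addrA pf.
case: m => n; first exact: P.
by rewrite NegzE mulrNz mulNr scaleNr -[LHS](P n.+1) subrK.
Qed.

(** Every point is equivalent modulo the period lattice to one of the cube of
    half-width pi centred at x0, obtained by subtracting a rounded multiple of
    2 pi in each coordinate. *)
Lemma period_representative (x0 x : 'rV[R]_d) : exists y : 'rV[R]_d,
  (forall s, - pi <= y ord0 s - x0 ord0 s <= pi) /\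
  forall f, (forall s, periodic_in s f) -> f y = f x.
Proof.
pose m s : int := - Num.floor ((x ord0 s - x0 ord0 s + pi) / (2 * pi)).
exists (x + \sum_(s < d) ((m s)%:~R * (2 * pi)) *: basis_vec s); split.
  move=> s; rewrite mxE summxE (bigD1 s)//= big1 ?addr0; last first.
    by move=> i /negPf si; rewrite !mxE eqxx /= eq_sym si mulr0.
  rewrite !mxE !eqxx mulr1 /m.
  set q := (x ord0 s - x0 ord0 s + pi) / (2 * pi).
  have q1 : (Num.floor q)%:~R <= q := floor_le q.
  have q2 : q < (Num.floor q)%:~R + 1 by rewrite -intrD1; exact: floorD1_gt.
  have qE : q * (2 * pi) = x ord0 s - x0 ord0 s + pi by rewrite /q divfK// gt_eqF.
  set z := (Num.floor q)%:~R in q1 q2 *.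
  have e1 : z * (2 * pi) <= x ord0 s - x0 ord0 s + pi by rewrite -qE ler_pM2r.
  have e2 : x ord0 s - x0 ord0 s + pi <= (z + 1) * (2 * pi) by rewrite -qE ler_pM2r// ltW.
  rewrite mulrNz -/z; lra.
move=> f pf.
elim/big_rec: _ => [|s y _ IH]; first by rewrite addr0.
by rewrite [_ *: _ + y]addrC addrA periodic_int.
Qed.

Lemma torus_int_gt0 f (x : 'rV[R]_d) : cper f -> (forall y, 0 <= f y) -> 0 < f x -> 0 < I f.
Proof.
move=> [cf pf] f0 fx; have [y [yi /(_ _ pf) fy]] := period_representative (const_mx pi) x.
rewrite torus_intE; apply: (@iter_int_gt0 _ _ _ _ _ y) => //.
- exact: enum_uniq.
- by move=> s _; have := yi s; rewrite !mxE; lra.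
- by move=> s; rewrite mem_enum.
- by rewrite fy.
Qed.

Lemma compact_period_box (x0 : 'rV[R]_d) :
  compact [set y : 'rV[R]_d | forall s, - pi <= y ord0 s - x0 ord0 s <= pi].
Proof.
have := @rV_compact R d (fun s => [set` `[x0 ord0 s - pi, x0 ord0 s + pi]]) (fun s => @segment_compact _ _ _).
congr compact; apply/seteqP; split => y /= H s; have := H s; rewrite /= ?in_itv/=; lra.
Qed.

Lemma cper_bounded f : cper f -> exists M, 0 <= M /\ forall x, `|f x| <= M.
Proof.
move=> [cf pf].
have [M [_ HM]] : bounded_set (f @` [set y : 'rV[R]_d | forall s, - pi <= y ord0 s - (0 : 'rV[R]_d) ord0 s <= pi]).
  apply: compact_bounded; apply: continuous_compact; last exact: compact_period_box.
  exact: continuous_subspaceT.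
exists (`|M| + 1); split => [|x]; first by rewrite addr_ge0.
have [y [yi /(_ _ pf) <-]] := period_representative 0 x.
by apply: HM; [rewrite (le_lt_trans (ler_norm M))// ltrDl|exists y].
Qed.

Definition pd (s : 'I_d) f : 'rV[R]_d -> R := fun x => 'D_(basis_vec s) f x.

Lemma derive_comp_period (W : normedModType R) (F : 'rV[R]_d -> W) (e u x : 'rV[R]_d) :
  (forall y, F (y + e) = F y) -> 'D_u F (x + e) = 'D_u F x.
Proof.
move=> HF; rewrite /derive.
rewrite (_ : (fun h : R => h^-1 *: ((F \o shift (x + e)) (h *: u) - F (x + e))) =
  (fun h : R => h^-1 *: ((F \o shift x) (h *: u) - F x)))//.
by apply/funext => h /=; rewrite addrA !HF.
Qed.

Lemma pd_periodic s r f : periodic_in r f -> periodic_in r (pd s f).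
Proof. by move=> pf x; apply: derive_comp_period. Qed.

Lemma is_derive_slice s f (x : 'rV[R]_d) (t : R) : derivable f (x + t *: basis_vec s) (basis_vec s) ->
  is_derive t 1 (fun u : R => f (x + u *: basis_vec s)) (pd s f (x + t *: basis_vec s)).
Proof.
move=> df.
have E : (fun h : R => h^-1 *: (((fun u : R => f (x + u *: basis_vec s)) \o shift t) (h *: 1) - f (x + t *: basis_vec s)))
   = (fun h => h^-1 *: ((f \o shift (x + t *: basis_vec s)) (h *: basis_vec s) - f (x + t *: basis_vec s))).
  apply/funext => h /=; congr (_ *: (f _ - _)).
  by rewrite (_ : h%:A = h); [rewrite scalerDl addrCA|exact: mulr1].
by apply: DeriveDef; rewrite ?/derivable ?/pd ?/derive E.
Qed.

(** A partial derivative is the uniform limit of difference quotients, and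
    these have integral zero by translation invariance. Uniformity comes from
    the mean value theorem and from the uniform continuity of the derivative on
    the period cube. *)
Lemma torus_int_pd s f : cper f -> (forall x, derivable f x (basis_vec s)) ->
  continuous (pd s f) -> I (pd s f) = 0.
Proof.
move=> [cf pf] df cG; set G := pd s f.
have cpG : cper G by split => // r; apply: pd_periodic.
apply/eqP; rewrite -normr_eq0; apply/eqP/le_anti; rewrite normr_ge0 andbT.
apply/ler_addgt0Pr => eps eps0; rewrite add0r.
have c0 : 0 < (2 * pi) ^+ d :> R by rewrite exprn_gt0.
rewrite -[leRHS](divfK (lt0r_neq0 c0)).
set e := eps / _; have e0 : 0 < e by rewrite divr_gt0.
have := @uniform_near_compact R 'rV[R]_d R _ (fun t y => G (y + t *: basis_vec s)) 0 e (@compact_period_box 0)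
  (fun y _ => @slice_joint_continuous2 _ _ G _ y 0 cG) e0.
move=> /nbhs_ballP[del /= del0 Hdel].
pose h := del / 2.
have h0 : 0 < h by rewrite divr_gt0.
(* The difference quotient with an increment within the modulus of continuity
   of the derivative. *)
pose q := fun x => h^-1 * (f (x + h *: basis_vec s) - f x).
have cfs : cper (fun x => f (x + h *: basis_vec s)) by apply: cper_shift; split.
have cq : cper q by apply: cperZ; apply: cperB => //; split.
have Iq : I q = 0.
  have cpf : cper f by split.
  by rewrite /q torus_intZ; [rewrite torus_intB// torus_int_shift// subrr mulr0|exact: cperB].
have -> : I G = I (fun x => G x - q x) by rewrite torus_intB// Iq subr0.
apply: torus_int_norm_le; first exact: cperB.
move=> x; have [y [yi yx]] := period_representative 0 x.
rewrite -(yx (fun x => `|G x - q x|)); last first.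
  by move=> r z; rewrite (cpG.2 r) (cq.2 r).
have [||c] := @MVT R (fun u => f (y + u *: basis_vec s)) (fun u => G (y + u *: basis_vec s)) 0 h h0.
- by move=> u _; apply: is_derive_slice.
- by apply: continuous_subspaceT; exact: continuous_slice.
rewrite in_itv/= => /andP[c0' ch]; rewrite scale0r addr0 subr0 => E.
rewrite /q E [_ * h]mulrC mulKf ?gt_eqF// distrC.
have := Hdel c; rewrite /ball/= sub0r normrN gtr0_norm// => /(_ _ y yi).
rewrite scale0r addr0 => H; apply: ltW; apply: H.
by rewrite (lt_trans ch)// /h; lra.
Qed.

End TorusIntegral.

(** * Trigonometric functions of integer wave vectors *)

Section Fourier.
Context {R : realType} {d : nat}.
Implicit Types (f g : 'rV[R]_d -> R) (k h : 'rV[int]_d).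
Notation I := (@torus_int R d).

Lemma trig_periodic_int (x : R) (m : int) :
  cos (x + m%:~R * (2 * pi)) = cos x /\ sin (x + m%:~R * (2 * pi)) = sin x.
Proof.
have P (n : nat) (y : R) : cos (y + n%:R * (2 * pi)) = cos y /\ sin (y + n%:R * (2 * pi)) = sin y.
  rewrite (_ : n%:R * (2 * pi) = (pi *+ 2) *+ n); last first.
    by rewrite -[RHS]mulr_natr -[pi *+ 2]mulr_natr mulrC (mulrC pi).
  by rewrite (periodicn (@cosD2pi R)) (periodicn (@sinD2pi R)).
case: m => n; first exact: P.
by rewrite NegzE mulrNz mulNr; have [<- <-] := P n.+1 (x - n.+1%:R * (2 * pi)); rewrite subrK.
Qed.

Definition phase k (x : 'rV[R]_d) : R := \sum_(s < d) (k ord0 s)%:~R * x ord0 s.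

Lemma phaseD k h x : phase (k + h) x = phase k x + phase h x.
Proof. by rewrite -big_split; apply: eq_bigr => s _; rewrite mxE rmorphD mulrDl. Qed.

Lemma phaseN k x : phase (- k) x = - phase k x.
Proof. by rewrite -sumrN; apply: eq_bigr => s _; rewrite mxE rmorphN mulNr. Qed.

Lemma phaseB k h x : phase (k - h) x = phase k x - phase h x.
Proof. by rewrite phaseD phaseN. Qed.

Lemma phase_shift k (x : 'rV[R]_d) (t : R) s :
  phase k (x + t *: basis_vec s) = phase k x + (k ord0 s)%:~R * t.
Proof.
rewrite /phase (bigD1 s)//= [in RHS](bigD1 s)//= !mxE !eqxx mulr1 mulrDr.
rewrite -!addrA; congr (_ + _); rewrite addrC; congr (_ + _).
by apply: eq_bigr => r /negPf rs; rewrite !mxE rs andbF mulr0 addr0.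
Qed.

Lemma continuous_phase k : continuous (phase k).
Proof.
rewrite /phase; elim: (index_enum _) => [|s r IH].
  rewrite (_ : (fun x => _) = fun=> 0); first exact: cst_continuous.
  by apply/funext => x; rewrite big_nil.
rewrite (_ : (fun x => _) = fun x : 'rV[R]_d => (k ord0 s)%:~R * x ord0 s + \sum_(i <- r) (k ord0 i)%:~R * x ord0 i).
  move=> x; apply: (@continuousD _ _ _ (fun x : 'rV[R]_d => (k ord0 s)%:~R * x ord0 s)); last exact: IH.
  by apply: continuousM; [exact: cst_continuous|exact: coord_continuous].
by apply/funext => x; rewrite big_cons.
Qed.

Lemma cper_cos_phase k : cper (fun x => cos (phase k x)).
Proof.
split => [x|s x]; first by apply: continuous_comp; [exact: continuous_phase|exact: continuous_cos].
by rewrite phase_shift (trig_periodic_int _ _).1.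
Qed.

Lemma cper_sin_phase k : cper (fun x => sin (phase k x)).
Proof.
split => [x|s x]; first by apply: continuous_comp; [exact: continuous_phase|exact: continuous_sin].
by rewrite phase_shift (trig_periodic_int _ _).2.
Qed.

Lemma derive_of_slice s f (x : 'rV[R]_d) (l : R) :
  is_derive (0 : R) (1 : R) (fun u : R => f (x + u *: basis_vec s)) l ->
  derivable f x (basis_vec s) /\ pd s f x = l.
Proof.
move=> H.
have E : (fun h : R => h^-1 *: (((fun u : R => f (x + u *: basis_vec s)) \o shift 0) (h *: 1) - f (x + 0 *: basis_vec s)))
   = (fun h : R => h^-1 *: ((f \o shift x) (h *: basis_vec s) - f x)).
  apply/funext => h /=; congr (_ *: (f _ - f _)); last by rewrite scale0r addr0.
  by rewrite addr0 (_ : h%:A = h); [rewrite addrC|exact: mulr1].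
case: H => H1 H2; split; first by rewrite /derivable -E.
by rewrite -H2 /pd /derive -E.
Qed.

Lemma is_derive_affine (a b u : R) : is_derive u 1 (fun u => a + b * u) b.
Proof.
by apply: DeriveDef; [|rewrite deriveD// derive_cst add0r deriveZ// derive_id]; 
   rewrite ?[b *: 1]mulr1.
Qed.

Lemma pd_cos_phase s k x : derivable (fun x => cos (phase k x)) x (basis_vec s) /\
  pd s (fun x => cos (phase k x)) x = - (k ord0 s)%:~R * sin (phase k x).
Proof.
apply: derive_of_slice.
rewrite (_ : (fun u => _) = cos \o (fun u => phase k x + (k ord0 s)%:~R * u)); last first.
  by apply/funext => u /=; rewrite phase_shift.
rewrite mulNr -mulrN mulrC; apply: is_derive1_comp; last exact: is_derive_affine.
by rewrite mulr0 addr0; exact: is_derive_cos.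
Qed.

Lemma pd_sin_phase s k x : derivable (fun x => sin (phase k x)) x (basis_vec s) /\
  pd s (fun x => sin (phase k x)) x = (k ord0 s)%:~R * cos (phase k x).
Proof.
apply: derive_of_slice.
rewrite (_ : (fun u => _) = sin \o (fun u => phase k x + (k ord0 s)%:~R * u)); last first.
  by apply/funext => u /=; rewrite phase_shift.
rewrite mulrC; apply: is_derive1_comp; last exact: is_derive_affine.
by rewrite mulr0 addr0; exact: is_derive_sin.
Qed.

Lemma cos_sum_half (a b : R) : cos a * cos b = 2^-1 * cos (b + a) + 2^-1 * cos (b - a).
Proof. by rewrite cosD cosB; field. Qed.
Lemma cos_sin_half (a b : R) : cos a * sin b = 2^-1 * sin (b + a) + 2^-1 * sin (b - a).
Proof. by rewrite sinD sinB; field. Qed.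
Lemma sin_cos_half (a b : R) : sin a * cos b = 2^-1 * sin (b + a) - 2^-1 * sin (b - a).
Proof. by rewrite sinD sinB; field. Qed.
Lemma sin_sin_half (a b : R) : sin a * sin b = 2^-1 * cos (b - a) - 2^-1 * cos (b + a).
Proof. by rewrite cosB cosD; field. Qed.

End Fourier.

(** Closes goals asserting that an expression built from periodic functions by
    ring operations is continuous and periodic. *)
Ltac solve_cper := repeat (lazymatch goal with
  | |- cper (fun x => _ + _) => refine (cperD _ _)
  | |- cper (fun x => - _) => refine (cperN _)
  | |- cper (fun x => _ * _) => refine (cperM _ _)
  | |- cper (fun x => _ ^+ _) => refine (cperX _ _)
  | |- cper (fun x => cos (phase _ _)) => exact: cper_cos_phase
  | |- cper (fun x => sin (phase _ _)) => exact: cper_sin_phase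
  | |- cper (fun=> _) => first [eassumption | exact: cper_cst]
  | |- cper _ => eassumption
  end).

(** * Completeness of the trigonometric system *)

Section FourierUniqueness.
Context {R : realType} {d : nat}.
Implicit Types (f g : 'rV[R]_d -> R) (k h : 'rV[int]_d).
Notation I := (@torus_int R d).

Lemma self_opp (a : R) : a = - a -> a = 0.
Proof. lra. Qed.

(** Translating by pi / k_s in a direction with k_s <> 0 changes the sign of
    the mode and preserves the integral. *)
Lemma torus_int_cos k : I (fun x => cos (phase k x)) = (k == 0)%:R * (2 * pi) ^+ d.
Proof.
have [->|k0] := eqVneq.
  rewrite -torus_int_cst; congr I; apply/funext => x.
  by rewrite /phase big1 ?cos0// => s _; rewrite mxE mul0r.
have [s ks] : exists s, k ord0 s != 0.
  apply/existsP; apply: contraT; rewrite negb_exists => /forallP H.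
  by case/eqP: k0; apply/rowP => s; rewrite mxE; apply/eqP; have := H s; rewrite negbK.
rewrite mul0r; apply: self_opp.
rewrite -[LHS](torus_int_shift s (pi / (k ord0 s)%:~R) (cper_cos_phase k)).
rewrite -torus_intN; last exact: cper_cos_phase.
by congr I; apply/funext => x; rewrite phase_shift [_ * (_ / _)]mulrC divfK ?intr_eq0// cosDpi.
Qed.

Lemma torus_int_sin k : I (fun x => sin (phase k x)) = 0.
Proof.
have [->|k0] := eqVneq k 0.
  rewrite -(mul0r ((2 * pi) ^+ d)) -torus_int_cst; congr I; apply/funext => x.
  by rewrite /phase big1 ?sin0// => s _; rewrite mxE mul0r.
have [s ks] : exists s, k ord0 s != 0.
  apply/existsP; apply: contraT; rewrite negb_exists => /forallP H.
  by case/eqP: k0; apply/rowP => s; rewrite mxE; apply/eqP; have := H s; rewrite negbK.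
apply: self_opp.
rewrite -[LHS](torus_int_shift s (pi / (k ord0 s)%:~R) (cper_sin_phase k)).
rewrite -torus_intN; last exact: cper_sin_phase.
by congr I; apply/funext => x; rewrite phase_shift [_ * (_ / _)]mulrC divfK ?intr_eq0// sinDpi.
Qed.

(** The set of g such that every trigonometric moment of f g vanishes. It is a
    module over trigonometric polynomials because the product of two modes is a
    combination of modes. *)
Definition annihilates f g := cper g /\ forall k,
  I (fun x => f x * g x * cos (phase k x)) = 0 /\
  I (fun x => f x * g x * sin (phase k x)) = 0.

Lemma annihilates_lin f g1 g2 a b : cper f -> annihilates f g1 -> annihilates f g2 ->
  annihilates f (fun x => a * g1 x + b * g2 x).
Proof.
move=> cf [c1 H1] [c2 H2]; split; first by solve_cper.
move=> k; have [a1 b1] := H1 k; have [a2 b2] := H2 k; split.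
  rewrite (_ : (fun x => _) = (fun x => a * (f x * g1 x * cos (phase k x)) + b * (f x * g2 x * cos (phase k x)))).
    by rewrite torus_int_lin; [rewrite a1 a2 !mulr0 addr0|solve_cper..].
  by apply/funext => x; ring.
rewrite (_ : (fun x => _) = (fun x => a * (f x * g1 x * sin (phase k x)) + b * (f x * g2 x * sin (phase k x)))).
  by rewrite torus_int_lin; [rewrite b1 b2 !mulr0 addr0|solve_cper..].
by apply/funext => x; ring.
Qed.

Lemma annihilatesD f g1 g2 : cper f -> annihilates f g1 -> annihilates f g2 ->
  annihilates f (fun x => g1 x + g2 x).
Proof.
move=> cf H1 H2; have := annihilates_lin 1 1 cf H1 H2.
by congr annihilates; apply/funext => x; rewrite !mul1r.
Qed.

Lemma annihilatesZ f g a : cper f -> annihilates f g ->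
  annihilates f (fun x => a * g x).
Proof.
move=> cf H1; have := annihilates_lin a 0 cf H1 H1.
by congr annihilates; apply/funext => x; rewrite mul0r addr0.
Qed.

Lemma annihilates_cos f g h : cper f -> annihilates f g ->
  annihilates f (fun x => g x * cos (phase h x)).
Proof.
move=> cf [cg H].
split; first by apply: cperM => //; exact: cper_cos_phase.
move=> k.
have [[a1 b1] [a2 b2]] := (H (k + h), H (k - h)).
split.
  rewrite (_ : (fun x => _) = (fun x => 2^-1 * (f x * g x * cos (phase (k + h) x)) + 2^-1 * (f x * g x * cos (phase (k - h) x)))).
    by rewrite torus_int_lin; [rewrite a1 a2 !mulr0 addr0|solve_cper..].
  by apply/funext => x; rewrite phaseD phaseB -mulrA -mulrA cos_sum_half; ring.
rewrite (_ : (fun x => _) = (fun x => 2^-1 * (f x * g x * sin (phase (k + h) x)) + 2^-1 * (f x * g x * sin (phase (k - h) x)))).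
  by rewrite torus_int_lin; [rewrite b1 b2 !mulr0 addr0|solve_cper..].
by apply/funext => x; rewrite phaseD phaseB -mulrA -mulrA cos_sin_half; ring.
Qed.

Lemma annihilates_sin f g h : cper f -> annihilates f g ->
  annihilates f (fun x => g x * sin (phase h x)).
Proof.
move=> cf [cg H].
split; first by apply: cperM => //; exact: cper_sin_phase.
move=> k.
have [[a1 b1] [a2 b2]] := (H (k + h), H (k - h)).
split.
  rewrite (_ : (fun x => _) = (fun x => 2^-1 * (f x * g x * sin (phase (k + h) x)) + - 2^-1 * (f x * g x * sin (phase (k - h) x)))).
    by rewrite torus_int_lin; [rewrite b1 b2 !mulr0 addr0|solve_cper..].
  by apply/funext => x; rewrite phaseD phaseB -mulrA -mulrA sin_cos_half; ring.
rewrite (_ : (fun x => _) = (fun x => 2^-1 * (f x * g x * cos (phase (k - h) x)) + - 2^-1 * (f x * g x * cos (phase (k + h) x)))).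
  by rewrite torus_int_lin; [rewrite a1 a2 !mulr0 addr0|solve_cper..].
by apply/funext => x; rewrite phaseB phaseD -mulrA -mulrA sin_sin_half; ring.
Qed.

Definition coord_mode (s : 'I_d) : 'rV[int]_d := delta_mx ord0 s.

Lemma phase_coord s (x : 'rV[R]_d) : phase (coord_mode s) x = x ord0 s.
Proof.
rewrite /phase (bigD1 s)//= big1 ?addr0 ?mxE ?eqxx ?mul1r// => r /negPf rs.
by rewrite mxE rs andbF mul0r.
Qed.

(** A trigonometric polynomial which attains its maximum 1 + e exactly at x0
    modulo periods. For e small enough it is at most 1 - e in absolute value
    away from x0, so its powers concentrate at x0 and replace a Fejer
    kernel. *)
Definition peak (x0 : 'rV[R]_d) (e : R) (x : 'rV[R]_d) : R :=
  e + d%:R^-1 * \sum_(s < d) cos (x ord0 s - x0 ord0 s).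

Lemma cper_peak x0 e : cper (peak x0 e).
Proof.
apply: cperD; first exact: cper_cst.
apply: cperZ; apply: cper_sum => s _.
rewrite (_ : (fun x => _) = (fun x => cos (x0 ord0 s) * cos (phase (coord_mode s) x) + sin (x0 ord0 s) * sin (phase (coord_mode s) x))).
  by apply: cperD; apply: cperZ; [exact: cper_cos_phase|exact: cper_sin_phase].
by apply/funext => x; rewrite phase_coord cosB; ring.
Qed.

Lemma annihilates_peak f g x0 e : cper f -> annihilates f g ->
  annihilates f (fun x => g x * peak x0 e x).
Proof.
move=> cf Hg.
rewrite (_ : (fun x => _) = (fun x => e * g x + d%:R^-1 *
   \sum_(s < d) (cos (x0 ord0 s) * (g x * cos (phase (coord_mode s) x)) + sin (x0 ord0 s) * (g x * sin (phase (coord_mode s) x))))); last first.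
  apply/funext => x; rewrite /peak mulrDr [g x * e]mulrC mulrCA mulr_sumr; congr (_ + _ * _).
  by apply: eq_bigr => s _; rewrite phase_coord cosB; ring.
apply: annihilatesD => //; first exact: annihilatesZ.
apply: annihilatesZ => //.
elim: (index_enum _) => [|s r IH].
  rewrite (_ : (fun x => _) = (fun x => 0 * g x)); first exact: annihilatesZ.
  by apply/funext => x; rewrite big_nil mul0r.
rewrite (_ : (fun x => _) = (fun x =>
   (cos (x0 ord0 s) * (g x * cos (phase (coord_mode s) x)) + sin (x0 ord0 s) * (g x * sin (phase (coord_mode s) x)))
   + \sum_(s <- r) (cos (x0 ord0 s) * (g x * cos (phase (coord_mode s) x)) + sin (x0 ord0 s) * (g x * sin (phase (coord_mode s) x))))).
  apply: annihilatesD => //; apply: annihilatesD => //; apply: annihilatesZ => //.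
    exact: annihilates_cos.
  exact: annihilates_sin.
by apply/funext => x; rewrite big_cons.
Qed.

Lemma annihilates_peakX f x0 e n : cper f -> annihilates f (fun=> 1) ->
  I (fun x => f x * peak x0 e x ^+ n) = 0.
Proof.
move=> cf H1.
have [_ /(_ 0) [+ _]] : annihilates f (fun x => peak x0 e x ^+ n).
  elim: n => [|n IH].
    by move: H1; congr annihilates; apply/funext => x; rewrite expr0.
  have := annihilates_peak x0 e cf IH.
  by congr annihilates; apply/funext => x; rewrite exprSr.
move=> <-; congr I; apply/funext => x.
by rewrite /phase big1 ?cos0 ?mulr1// => s _; rewrite mxE mul0r.
Qed.

Lemma peak_le x0 e (x : 'rV[R]_d) : (0 < d)%N -> 0 <= e -> e - 1 <= peak x0 e x <= 1 + e.
Proof.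
move=> d0 e0; have dR : 0 < d%:R :> R by rewrite ltr0n.
have H (F : 'I_d -> R) c : (forall s, F s <= c) -> d%:R^-1 * \sum_(s < d) F s <= c.
  move=> Fc; rewrite ler_pdivrMl//; apply: (le_trans (ler_sum _ (fun s _ => Fc s))).
  by rewrite sumr_const card_ord mulr_natl.
have h1 := H (fun s => cos (x ord0 s - x0 ord0 s)) 1 (fun s => cos_le1 _).
have : d%:R^-1 * \sum_(s < d) - cos (x ord0 s - x0 ord0 s) <= 1.
  by apply: H => s; rewrite lerNl cos_geN1.
rewrite sumrN mulrN /peak; lra.
Qed.

Lemma peak_center x0 e : (0 < d)%N -> peak x0 e x0 = 1 + e.
Proof.
move=> d0; rewrite /peak (eq_bigr (fun=> 1)); last by move=> s _; rewrite subrr cos0.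
by rewrite sumr_const card_ord mulVf ?pnatr_eq0 -?lt0n// addrC.
Qed.

(** As soon as one coordinate is at distance at least del from that of x0, the
    mean of the cosines drops by (1 - cos del) / d = 2 e below 1. *)
Lemma peak_away (x0 x : 'rV[R]_d) e (del : R) s : (0 < d)%N -> 0 < del <= pi ->
  e = (1 - cos del) / (2 * d%:R) ->
  del <= `|x ord0 s - x0 ord0 s| <= pi -> peak x0 e x <= 1 - e.
Proof.
move=> d0 /andP[del0 del_le] eE /andP[xs1 xs2].
have dR : 0 < d%:R :> R by rewrite ltr0n.
have h1 : cos (x ord0 s - x0 ord0 s) <= cos del.
  rewrite -cos_norm; move: xs1; rewrite le_eqVlt => /predU1P[->//|xs1].
  by apply: ltW; rewrite ltr_cos// in_itv/= ?normr_ge0 ?xs2 ?(ltW del0).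
have h2 : \sum_(r < d) cos (x ord0 r - x0 ord0 r) <= cos del + (d%:R - 1).
  rewrite (bigD1 s)//= lerD//.
  apply: (@le_trans _ _ (\sum_(r < d | r != s) 1)).
    by apply: ler_sum => r _; exact: cos_le1.
  by rewrite sumr_const cardC1 card_ord -subn1 natrB.
have : peak x0 e x <= e + d%:R^-1 * (cos del + (d%:R - 1)).
  by rewrite /peak lerD2l ler_pM2l ?invr_gt0.
move=> h; apply: (le_trans h); rewrite le_eqVlt; apply/orP; left; apply/eqP; rewrite eE.
by field; rewrite gt_eqF.
Qed.

Lemma geometric_small (a c : R) : 0 <= a < 1 -> 0 < c -> exists n, (a ^+ 2) ^+ n < c.
Proof.
move=> /andP[a0 a1] c0.
have a2 : `|a ^+ 2| < 1 by rewrite ger0_norm ?exprn_ge0// expr_lt1.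
have /cvgrPdist_lt/(_ c c0) [N _ /(_ N (leqnn N))] := cvg_expr a2.
by rewrite /= sub0r normrN ger0_norm ?exprn_ge0// => h; exists N.
Qed.

(** If f were positive at x0, integrate f against the even powers of the peak
    at x0. Near x0 the integrand is nonnegative and at least a fixed multiple
    of the excess of the peak over 1; elsewhere its absolute value is at most M
    (1 - e)^(2n), which tends to zero. So the integral is positive for large n,
    although it vanishes by orthogonality. *)
Lemma annihilates_le0 f : (0 < d)%N -> cper f -> annihilates f (fun=> 1) -> forall x, f x <= 0.
Proof.
move=> d0 cf Hf x0; rewrite leNgt; apply/negP => fx0.
have [M [M0 HM]] := cper_bounded cf.
set c := f x0 / 2; have c0 : 0 < c by rewrite divr_gt0.
have /nbhs_ballP[del1 /= del10 Hdel1] : \forall y \near x0, c < f y.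
  have /cvgrPdist_lt/(_ c c0) := cf.1 x0; apply: filterS => y.
  by rewrite ltr_norml /c; lra.
pose del := Num.min del1 pi.
have del0 : 0 < del <= pi by rewrite /del lt_min del10 pi_gt0 ge_min lexx orbT.
have dR : 0 < d%:R :> R by rewrite ltr0n.
set e := (1 - cos del) / (2 * d%:R).
have e0 : 0 < e.
  rewrite divr_gt0 ?mulr_gt0// subr_gt0 -[ltRHS]cos0 ltr_cos ?in_itv/= ?lexx ?pi_ge0//.
    by case/andP: del0.
  by case/andP: del0 => /ltW -> ->.
have e1 : e <= 1.
  rewrite ler_pdivrMr ?mulr_gt0// mul1r.
  have := cos_geN1 del; have : 1 <= d%:R :> R by rewrite ler1n.
  lra.
pose q := peak x0 e; have cq : cper q by exact: cper_peak.
(* On the set where the peak exceeds 1 its powers dominate psi / e, because psi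
   <= e there. *)
pose psi x := Num.max 0 (q x - 1).
have cpsi : cper psi.
  have := cper_comp (h := fun y => Num.max 0 (y - 1)) _ cq; apply => y.
  apply: (@continuous_max _ _ (fun=> 0) (fun y : R => y - 1)); first exact: cst_continuous.
  by apply: cvgB; [exact: cvg_id|exact: cvg_cst].
have Ipsi : 0 < I psi.
  apply: (torus_int_gt0 (x := x0) cpsi) => [y|]; first by rewrite le_max lexx.
  by rewrite lt_max /q peak_center// orbC addrC addKr e0.
set K := (c + M) * (2 * pi) ^+ d.
have K0 : 0 < K by rewrite mulr_gt0 ?exprn_gt0 ?twopi_gt0// ltr_pwDl.
have [|| n Hn] := @geometric_small (1 - e) (c * (e^-1 * I psi) / K).
- by rewrite subr_ge0 e1 gtrBl.
- by rewrite divr_gt0// mulr_gt0// mulr_gt0// invr_gt0.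
have : I (fun x => c * e^-1 * psi x + (- (c + M)) * (((1 - e) ^+ 2) ^+ n * 1))
    <= I (fun x => f x * q x ^+ (2 * n)).
  apply: le_torus_int; [by solve_cper|by solve_cper|] => x.
  have [y [yi yx]] := period_representative x0 x.
  rewrite -(yx f cf.2) -(yx q cq.2) -(yx psi cpsi.2) mulr1 exprM mulNr.
  (* Both sides are periodic, so it is enough to compare them on the cube centred
     at x0, where the distance to x0 can be read off coordinatewise. *)
  have r0 : 0 <= ((1 - e) ^+ 2) ^+ n by rewrite !exprn_ge0// subr_ge0.
  have [/forallP near|] := boolP [forall s, `|y ord0 s - x0 ord0 s| < del].
    have fy : c < f y.
      apply: Hdel1; split => // i s; rewrite /ball/= (ord1 i) distrC.
      by apply: (lt_le_trans (near s)); rewrite /del ge_min lexx.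
    have q0 : 0 <= (q y ^+ 2) ^+ n by apply: exprn_ge0; exact: sqr_ge0.
    have qy : e^-1 * psi y <= (q y ^+ 2) ^+ n.
      have [q1|q1] := leP (q y) 1.
        rewrite /psi (_ : Num.max _ _ = 0) ?mulr0; first by rewrite exprn_ge0 ?sqr_ge0.
        by apply/max_idPl; rewrite subr_le0.
      rewrite /psi (_ : Num.max _ _ = q y - 1); last by apply/max_idPr; rewrite subr_ge0 ltW.
      apply: (@le_trans _ _ 1); last by rewrite exprn_ege1// expr_ge1// ltW// (lt_trans ltr01).
      rewrite ler_pdivrMl// mulr1; have := @peak_le x0 e y d0 (ltW e0).
      by rewrite -/q => /andP[_]; lra.
    have h1 : c * (e^-1 * psi y) <= c * (q y ^+ 2) ^+ n by rewrite ler_pM2l.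
    have h2 : c * (q y ^+ 2) ^+ n <= f y * (q y ^+ 2) ^+ n.
      exact: ler_wpM2r q0 _ _ (ltW fy).
    have h3 : 0 <= (c + M) * ((1 - e) ^+ 2) ^+ n by rewrite mulr_ge0// addr_ge0// ltW.
    rewrite -mulrA; lra.
  rewrite negb_forall => /existsP[s]; rewrite -leNgt => far.
  have q1 : q y <= 1 - e.
    apply: (@peak_away x0 y e del s) => //.
    by rewrite far ler_norml; exact: yi.
  have q2 : e - 1 <= q y by have /andP[] := @peak_le x0 e y d0 (ltW e0).
  have -> : psi y = 0 by apply/max_idPl; lra.
  have qr : (q y ^+ 2) ^+ n <= ((1 - e) ^+ 2) ^+ n.
    apply: lerXn2r; rewrite ?nnegrE ?sqr_ge0//.
    by rewrite -subr_ge0 subr_sqr mulr_ge0//; lra.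
  have q0 : 0 <= (q y ^+ 2) ^+ n by apply: exprn_ge0; exact: sqr_ge0.
  have fM : - M <= f y by have := HM y; rewrite ler_norml => /andP[].
  have h1 : - M * (q y ^+ 2) ^+ n <= f y * (q y ^+ 2) ^+ n by rewrite ler_wpM2r.
  have h2 : M * (q y ^+ 2) ^+ n <= M * ((1 - e) ^+ 2) ^+ n by rewrite ler_wpM2l.
  have h3 : 0 <= c * ((1 - e) ^+ 2) ^+ n by rewrite mulr_ge0// ltW.
  rewrite mulr0 mulrDl; lra.
rewrite annihilates_peakX// torus_int_lin; [|by solve_cper..].
rewrite torus_intZ; last exact: cper_cst.
rewrite torus_int_cst mul1r.
have h : K * ((1 - e) ^+ 2) ^+ n < c * (e^-1 * I psi) by rewrite mulrC -ltr_pdivlMr.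
apply/negP; rewrite -ltNge mulNr; move: h; rewrite /K; lra.
Qed.

(** [fcos f k] and [fsin f k] are the real and the imaginary part of the k-th
    Fourier coefficient of f; whence the sign in [fsin]. *)
Definition fcos f k : R :=
  I (fun x => f x * ((2 * pi) `^ (- (d%:R / 2)) * cos (phase k x))).
Definition fsin f k : R :=
  - I (fun x => f x * ((2 * pi) `^ (- (d%:R / 2)) * sin (phase k x))).

Let N : R := (2 * pi) `^ (- (d%:R / 2)).

Lemma mode_norm_gt0 : 0 < N.
Proof. by rewrite powR_gt0// twopi_gt0. Qed.

(** The normalisation of the modes makes them orthonormal in L^2. *)
Lemma mode_normE : N ^+ 2 * (2 * pi) ^+ d = 1.
Proof.
have p0 := @twopi_gt0 R.
rewrite /N powRN exprVn -(powR_mulrn 2 (powR_ge0 _ _)) -powRrM divfK ?pnatr_eq0//.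
by rewrite powR_mulrn ?ltW// mulVf// gt_eqF// exprn_gt0.
Qed.

Lemma fourier_unique f : (0 < d)%N -> cper f -> (forall k, fcos f k = 0) ->
  (forall k, fsin f k = 0) -> forall x, f x = 0.
Proof.
move=> d0 cf fc fs.
have N0 := mode_norm_gt0.
have H : annihilates f (fun=> 1).
  split; first exact: cper_cst.
  move=> k; split; apply/eqP; rewrite -(mulrI_eq0 _ (mulfI (lt0r_neq0 N0))) -torus_intZ;
    [|by solve_cper| |by solve_cper].
    by rewrite -(fc k); apply/eqP; congr I; apply/funext => x; rewrite -/N; ring.
  by rewrite -oppr_eq0 -(fs k); apply/eqP; congr (- I _); apply/funext => x; rewrite -/N; ring.
move=> x; apply/le_anti; rewrite annihilates_le0//= -oppr_le0.
apply: (@annihilates_le0 (fun x => - f x)) => //; first exact: cperN.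
split; first exact: cper_cst.
move=> k; have [h1 h2] := H.2 k; split; apply/eqP; rewrite -oppr_eq0 -torus_intN; [|by solve_cper| |by solve_cper].
  by rewrite -h1; apply/eqP; congr I; apply/funext => y; ring.
by rewrite -h2; apply/eqP; congr I; apply/funext => y; ring.
Qed.
End FourierUniqueness.

(** * Absolutely summable families over wave vectors *)

Section Ksum.
Context {R : realType} {d : nat}.
Notation K := 'rV[int]_d.
Implicit Types (f g : K -> R) (D : set K) (k : K).

Lemma funeposE' f k : ((EFin \o f)^\+ k = (Num.max (f k) 0)%:E)%E.
Proof. by rewrite funeposE /= EFin_max. Qed.

Lemma funenegE' f k : ((EFin \o f)^\- k = (Num.max (- f k) 0)%:E)%E.
Proof. by rewrite funenegE /= EFin_max. Qed.

Definition absum D f := (\esum_(k in D) (`|f k|)%:E < +oo)%E.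

Lemma le_absum D f g : (forall k, D k -> `|f k| <= `|g k|) -> absum D g -> absum D f.
Proof.
by move=> fg; apply: le_lt_trans; apply: le_esum => k Dk; rewrite lee_fin fg.
Qed.

Lemma absumD D f g : absum D f -> absum D g -> absum D (fun k => f k + g k).
Proof.
move=> sf sg; apply: (@le_lt_trans _ _ (\esum_(k in D) ((`|f k|)%:E + (`|g k|)%:E))%E).
  by apply: le_esum => k _; rewrite -EFinD lee_fin ler_normD.
rewrite esumD; [|by move=> k _; rewrite lee_fin..].
by rewrite lte_add_pinfty.
Qed.

Lemma absum_norm D f : absum D f -> absum D (fun k => `|f k|).
Proof. by apply: le_absum => k _; rewrite normr_id. Qed.

Lemma esumZl D (a : R) f : 0 <= a -> (forall k, D k -> 0 <= f k) ->
  (\esum_(k in D) (a * f k)%:E = a%:E * (\esum_(k in D) (f k)%:E))%E.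
Proof.
rewrite le_eqVlt => /predU1P[<- _|a0 f0].
  by rewrite mul0e esum1// => k _; rewrite mul0r.
have le (b : R) (g : K -> R) : 0 < b -> (forall k, D k -> 0 <= g k) ->
    (b%:E * (\esum_(k in D) (g k)%:E) <= \esum_(k in D) (b * g k)%:E)%E.
  move=> b0 g0; rewrite -lee_pdivlMl//; apply: ge_ereal_sup => /= _ [X [finX XD] <-].
  rewrite lee_pdivlMl//; apply: esum_ge; exists X => //.
  by rewrite !fsbig_finite//= !sumEFin -EFinM mulr_sumr.
apply/eqP; rewrite eq_le le// andbT -lee_pdivrMl//.
apply: le_trans (le _ (fun k => a * f k) _ _) _.
- by rewrite invr_gt0.
- by move=> k Dk; rewrite mulr_ge0 ?f0// ltW.
- by apply: le_esum => k _; rewrite mulKf ?gt_eqF.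
Qed.

Lemma absumZ D a f : absum D f -> absum D (fun k => a * f k).
Proof.
move=> sf; rewrite /absum; under eq_esum do rewrite normrM.
by rewrite esumZl// lte_mul_pinfty// lee_fin.
Qed.

(** The sum of a signed family may be computed from any decomposition into
    nonnegative summable families, in place of the positive and negative parts;
    linearity follows. *)
Lemma ksum_dec D f (p q : K -> R) : (forall k, D k -> 0 <= p k) -> (forall k, D k -> 0 <= q k) ->
  (forall k, D k -> f k = p k - q k) ->
  (\esum_(k in D) (p k)%:E < +oo)%E -> (\esum_(k in D) (q k)%:E < +oo)%E ->
  ksum D f = fine (\esum_(k in D) (p k)%:E) - fine (\esum_(k in D) (q k)%:E).
Proof.
move=> p0 q0 fE sp sq; rewrite /ksum.
set P := (\esum_(k in D) ((EFin \o f)^\+)%E k)%E.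
set Q := (\esum_(k in D) ((EFin \o f)^\-)%E k)%E.
have Pp : (forall k, D k -> 0 <= (EFin \o f)^\+ k)%E by move=> k _; exact: funepos_ge0.
have Qp : (forall k, D k -> 0 <= (EFin \o f)^\- k)%E by move=> k _; exact: funeneg_ge0.
have hP : (P < +oo)%E.
  apply: le_lt_trans sp; apply: le_esum => k Dk; rewrite funeposE' fE//.
  by rewrite lee_fin ge_max p0// andbT lerBlDr lerDl q0.
have hQ : (Q < +oo)%E.
  apply: le_lt_trans sq; apply: le_esum => k Dk; rewrite funenegE' fE//.
  by rewrite lee_fin ge_max q0// andbT opprB lerBlDr lerDl p0.
have E : (P + \esum_(k in D) (q k)%:E = \esum_(k in D) (p k)%:E + Q)%E.
  rewrite -!esumD//; apply: eq_esum => k Dk; rewrite funeposE' funenegE' fE// -!EFinD; congr EFin.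
  by case: (leP (p k - q k) 0) => h; case: (leP (- (p k - q k)) 0) => h'; lra.
have fin (x : \bar R) : (0 <= x)%E -> (x < +oo)%E -> x \is a fin_num.
  by move=> x0 xoo; rewrite ge0_fin_numE.
have P0 : (0 <= P)%E by exact: esum_ge0.
have Q0 : (0 <= Q)%E by exact: esum_ge0.
have p0' : (0 <= \esum_(k in D) (p k)%:E)%E by apply: esum_ge0 => k /p0; rewrite lee_fin.
have q0' : (0 <= \esum_(k in D) (q k)%:E)%E by apply: esum_ge0 => k /q0; rewrite lee_fin.
have /(congr1 fine) := E; rewrite !fineD ?fin//.
lra.
Qed.

Lemma funeposneg_absum D f : absum D f ->
  [/\ (forall k, D k -> 0 <= Num.max (f k) 0), (forall k, D k -> 0 <= Num.max (- f k) 0),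
   (forall k, D k -> f k = Num.max (f k) 0 - Num.max (- f k) 0),
   (\esum_(k in D) (Num.max (f k) 0)%:E < +oo)%E &
   (\esum_(k in D) (Num.max (- f k) 0)%:E < +oo)%E].
Proof.
move=> sf; split => [k _|k _|k _||].
- by rewrite le_max lexx orbT.
- by rewrite le_max lexx orbT.
- by case: (leP (f k) 0) => h; case: (leP (- f k) 0) => h'; lra.
- apply: le_lt_trans sf; apply: le_esum => k _; rewrite lee_fin ge_max normr_ge0 andbT.
  exact: ler_norm.
- apply: le_lt_trans sf; apply: le_esum => k _; rewrite lee_fin ge_max normr_ge0 andbT.
  by rewrite -normrN ler_norm.
Qed.

Lemma fine_esumD D (p q : K -> R) : (forall k, D k -> 0 <= p k) -> (forall k, D k -> 0 <= q k) ->
  (\esum_(k in D) (p k)%:E < +oo)%E -> (\esum_(k in D) (q k)%:E < +oo)%E ->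
  fine (\esum_(k in D) (p k + q k)%:E) =
  fine (\esum_(k in D) (p k)%:E) + fine (\esum_(k in D) (q k)%:E) /\
  (\esum_(k in D) (p k + q k)%:E < +oo)%E.
Proof.
move=> p0 q0 sp sq.
have -> : (\esum_(k in D) (p k + q k)%:E = \esum_(k in D) (p k)%:E + \esum_(k in D) (q k)%:E)%E.
  by under eq_esum do rewrite EFinD; rewrite esumD.
split; last by rewrite lte_add_pinfty.
by rewrite fineD// ge0_fin_numE//; apply: esum_ge0 => k Dk; rewrite lee_fin; auto.
Qed.

Lemma ksumD D f g : absum D f -> absum D g ->
  ksum D (fun k => f k + g k) = ksum D f + ksum D g.
Proof.
move=> sf sg.
have [p0 q0 E sp sq] := funeposneg_absum sf.
have [p0' q0' E' sp' sq'] := funeposneg_absum sg.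
rewrite (ksum_dec p0 q0 E sp sq) (ksum_dec p0' q0' E' sp' sq').
have [h1 h2] := fine_esumD p0 p0' sp sp'; have [h3 h4] := fine_esumD q0 q0' sq sq'.
rewrite (@ksum_dec D _ (fun k => Num.max (f k) 0 + Num.max (g k) 0)
  (fun k => Num.max (- f k) 0 + Num.max (- g k) 0))//.
- by rewrite h1 h3; ring.
- by move=> k Dk; rewrite addr_ge0 ?p0 ?p0'.
- by move=> k Dk; rewrite addr_ge0 ?q0 ?q0'.
- by move=> k Dk; rewrite {1}E// {1}E'//; ring.
Qed.

Lemma eq_ksum D f g : (forall k, D k -> f k = g k) -> ksum D f = ksum D g.
Proof.
by move=> fg; rewrite /ksum; congr (fine _ - fine _); apply: eq_esum => k Dk;
  rewrite ?funeposE' ?funenegE' fg.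
Qed.

Lemma ksumN D f : ksum D (fun k => - f k) = - ksum D f.
Proof.
rewrite /ksum opprB; congr (fine _ - fine _); apply: eq_esum => k Dk;
  by rewrite ?(funeposE' (fun k => - f k)) ?(funenegE' (fun k => - f k)) ?funeposE' ?funenegE' ?opprK.
Qed.

Lemma ksumZ D a f : ksum D (fun k => a * f k) = a * ksum D f.
Proof.
wlog a0 : a / 0 <= a => [H|].
  have [a0|a0] := leP 0 a; first exact: H.
  rewrite -[a in RHS]opprK mulNr -H ?oppr_ge0 ?ltW// -ksumN.
  by apply: eq_ksum => k _; rewrite mulNr opprK.
pose g k : R := a * f k.
rewrite -/g.
have E s : ((EFin \o g)^\+ s = (a * fine ((EFin \o f)^\+ s)%E)%:E)%E.
  by rewrite !funeposE' /= maxr_pMr// mulr0.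
have E' s : ((EFin \o g)^\- s = (a * fine ((EFin \o f)^\- s)%E)%:E)%E.
  by rewrite !funenegE' /= maxr_pMr// mulr0 mulrN.
have h (x : \bar R) : fine (a%:E * x) = a * fine x.
  case: x => //=; move: a0; rewrite le_eqVlt => /predU1P[<-|a0]; rewrite ?mul0e ?mul0r//.
    by rewrite gt0_muley ?lte_fin//= mulr0.
  by rewrite gt0_muleNy ?lte_fin//= mulr0.
rewrite /ksum mulrBr -!h; congr (fine _ - fine _).
  rewrite (eq_esum (fun s _ => E s)) esumZl//; last first.
    by move=> k _; rewrite funeposE' /= le_max lexx orbT.
  by congr (_ * _)%E; apply: eq_esum => k _; rewrite funeposE'.
rewrite (eq_esum (fun s _ => E' s)) esumZl//; last first.
  by move=> k _; rewrite funenegE' /= le_max lexx orbT.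
by congr (_ * _)%E; apply: eq_esum => k _; rewrite funenegE'.
Qed.

Lemma ksumB D f g : absum D f -> absum D g ->
  ksum D (fun k => f k - g k) = ksum D f - ksum D g.
Proof.
move=> sf sg; rewrite ksumD// ?ksumN//.
by apply: le_absum sg => k _; rewrite normrN.
Qed.

Lemma ksum_nneg D f : (forall k, D k -> 0 <= f k) -> ksum D f = fine (\esum_(k in D) (f k)%:E).
Proof.
move=> f0; rewrite /ksum [X in _ - fine X]esum1 ?subr0.
  by congr fine; apply: eq_esum => k Dk; rewrite funeposE' max_l// f0.
by move=> k Dk; rewrite funenegE' max_r// oppr_le0 f0.
Qed.

Lemma ksum_ge0 D f : (forall k, D k -> 0 <= f k) -> 0 <= ksum D f.
Proof.
by move=> f0; rewrite ksum_nneg// fine_ge0// esum_ge0// => k Dk; rewrite lee_fin f0.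
Qed.

Lemma le_ksum D f g : absum D f -> absum D g -> (forall k, D k -> f k <= g k) ->
  ksum D f <= ksum D g.
Proof.
move=> sf sg fg; rewrite -subr_ge0 -ksumB//; apply: ksum_ge0 => k Dk.
by rewrite subr_ge0 fg.
Qed.

Lemma norm_ksum_le D f g : absum D g -> (forall k, D k -> `|f k| <= g k) ->
  `|ksum D f| <= ksum D g.
Proof.
move=> sg fg; have sf : absum D f.
  by apply: le_absum sg => k Dk; rewrite (le_trans (fg k Dk))// ler_norm.
rewrite ler_norml -ksumN !le_ksum//.
- by move=> k Dk; have := fg k Dk; rewrite ler_norml => /andP[].
- by apply: le_absum sg => k _; rewrite normrN.
- by move=> k Dk; have := fg k Dk; rewrite ler_norml => /andP[].
Qed.

Lemma absum_finite D f (r : seq K) : uniq r -> (forall k, k \in r -> D k) ->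
  (forall k, D k -> k \notin r -> f k = 0) ->
  absum D f /\ ksum D f = \sum_(k <- r) f k.
Proof.
move=> ur rD f0.
have H (g : K -> R) : (forall k, 0 <= g k) -> (forall k, D k -> k \notin r -> g k = 0) ->
    (\esum_(k in D) (g k)%:E = (\sum_(k <- r) g k)%:E)%E.
  move=> g0 gr.
  rewrite (esumID [set` r])//; last by move=> k _; rewrite lee_fin.
  rewrite [X in (_ + X)%E]esum1 ?adde0; last first.
    by move=> k [Dk /= /negP kr]; rewrite gr.
  rewrite setIidr; last by move=> k /rD.
  have fr : finite_set [set` r] by exact: finite_seq.
  by rewrite esum_fset//; [rewrite -fsbig_seq// sumEFin|move=> k _; rewrite lee_fin].
have h1 := H (fun k => Num.max (f k) 0); have h2 := H (fun k => Num.max (- f k) 0).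
have sf : absum D f.
  by rewrite /absum H ?ltry// => k Dk kr; rewrite f0// normr0.
split => //.
have [p0 q0 E sp sq] := funeposneg_absum sf.
rewrite (ksum_dec p0 q0 E sp sq) h1 ?h2 /=.
- rewrite -sumrB; apply: eq_bigr => k _.
  by case: (leP (f k) 0) => h; case: (leP (- f k) 0) => h'; lra.
- by move=> k; rewrite le_max lexx orbT.
- by move=> k Dk kr; rewrite f0// oppr0 maxxx.
- by move=> k; rewrite le_max lexx orbT.
- by move=> k Dk kr; rewrite f0// maxxx.
Qed.

(** One finite set of indices approximates the sums of all the families
    dominated by g; this uniformity is what makes trigonometric series converge
    uniformly. *)
Lemma ksum_tail D g (eps : R) : absum D g -> 0 < eps -> exists r : seq K,
  [/\ uniq r, (forall k, k \in r -> D k) &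
   forall f, (forall k, D k -> `|f k| <= `|g k|) -> `|ksum D f - \sum_(k <- r) f k| <= eps].
Proof.
move=> sg e0.
have fing : (\esum_(k in D) `|g k|%:E)%E \is a fin_num.
  by rewrite ge0_fin_numE// esum_ge0// => k _; rewrite lee_fin.
have : (\esum_(k in D) `|g k|%:E - eps%:E < \esum_(k in D) `|g k|%:E)%E.
  by rewrite lteBlDr// lteDl// lte_fin.
move=> /ereal_sup_gt[_ [A [finA AD] <-]] HA.
pose r : seq K := finmap.enum_fset (fset_set A).
have rA k : (k \in r) = (k \in A) by rewrite -in_fset_set.
have rD k : k \in r -> D k by rewrite rA inE => /AD.
have ur : uniq r by exact: finmap.fset_uniq.
exists r; split => // f fg.
have sf : absum D f by exact: le_absum sg.
pose fr k := if k \in r then f k else 0.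
have [sfr Er] : absum D fr /\ ksum D fr = \sum_(k <- r) fr k.
  by apply: absum_finite => // k _ kr; rewrite /fr (negbTE kr).
rewrite (_ : \sum_(k <- r) f k = ksum D fr); last first.
  by rewrite Er; apply: eq_big_seq => k kr; rewrite /fr kr.
rewrite -ksumB//.
pose gr k := if k \in r then `|g k| else 0.
have [sgr Egr] : absum D gr /\ ksum D gr = \sum_(k <- r) gr k.
  by apply: absum_finite => // k _ kr; rewrite /gr (negbTE kr).
have sg' := absum_norm sg.
apply: (@le_trans _ _ (ksum D (fun k => `|g k| - gr k))).
  apply: norm_ksum_le.
    by apply: absumD => //; apply: le_absum sgr => k _; rewrite normrN.
  by move=> k Dk; rewrite /fr /gr; case: ifP => _; rewrite ?subrr ?normr0// !subr0 fg.
rewrite ksumB// Egr ksum_nneg// lerBlDl -lee_fin EFinD fineK//.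
have -> : \sum_(k <- r) gr k = fine (\sum_(i \in A) `|g i|%:E)%E.
  rewrite fsbig_finite//= sumEFin/=; apply: eq_big_seq => k kr; by rewrite /gr kr.
rewrite fineK; last by rewrite fsbig_finite//= sumEFin.
by rewrite -leeBlDr// ltW.
Qed.

Lemma absum_bound D f (C : R) : (forall r : seq K, uniq r -> (forall k, k \in r -> D k) ->
   \sum_(k <- r) `|f k| <= C) -> absum D f /\ fine (\esum_(k in D) `|f k|%:E) <= C.
Proof.
move=> H.
have h : (\esum_(k in D) `|f k|%:E <= C%:E)%E.
  apply: ge_ereal_sup => /= _ [A [finA AD] <-].
  rewrite fsbig_finite//= sumEFin lee_fin; apply: H; first exact: finmap.fset_uniq.
  by move=> k; rewrite in_fset_set// inE => /AD.
have s : absum D f by apply: le_lt_trans h _; rewrite ltry.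
split => //; rewrite -lee_fin fineK// ge0_fin_numE// esum_ge0// => k _.
Qed.

(** The wave vectors with entries of absolute value at most M. Every finite set
    lies in some box, and sums of products over a box factor. *)
Definition box (M : nat) : seq K :=
  [seq \row_s ((f s : nat)%:Z - M%:Z) | f : {ffun 'I_d -> 'I_(2 * M).+1}].

Lemma box_uniq M : uniq (box M).
Proof.
rewrite map_inj_uniq ?enum_uniq// => f g /rowP fg; apply/ffunP => s; apply/val_inj => /=.
by have := fg s; rewrite !mxE => /addIr [].
Qed.

Lemma mem_box M k : (forall s, `|k ord0 s| <= M%:Z) -> k \in box M.
Proof.
move=> kM.
have lt s : (`|(k ord0 s + M%:Z)%R|%N < (2 * M).+1)%N.
  by have := kM s; lia.
apply/mapP; exists [ffun s => Ordinal (lt s)]; first by rewrite mem_enum.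
apply/rowP => s; rewrite !mxE ffunE /=.
have := kM s; rewrite !ord1; move: (k 0 s) => z; lia.
Qed.

Lemma sub_box (r : seq K) : exists M, {subset r <= box M}.
Proof.
elim: r => [|k r [M HM]]; first by exists 0%N.
pose m := \max_(s < d) `|k ord0 s|%N.
have mono (M1 M2 : nat) (j : K) : (forall s, `|j ord0 s| <= M1%:Z) -> (M1 <= M2)%N -> j \in box M2.
  by move=> H M12; apply: mem_box => s; apply: le_trans (H s) _; rewrite lez_nat.
have box_le M1 (j : K) : j \in box M1 -> forall s, `|j ord0 s| <= M1%:Z.
  move=> /mapP[f _ ->] s; rewrite mxE.
  by have := ltn_ord (f s); move: (nat_of_ord (f s)) => z; lia.
exists (maxn m M) => j; rewrite in_cons => /predU1P[->|/HM/box_le jM].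
  apply: (mono m); last exact: leq_maxl.
  by move=> s; rewrite -abszE lez_nat (leq_bigmax s).
by apply: (mono M) => //; exact: leq_maxr.
Qed.

(** The product of one-dimensional weights, instead of a power of the length of
    k, because its sum over a box is a power of a one-dimensional sum. *)
Definition decay_weight k : R := \prod_(s < d) (1 + (k ord0 s)%:~R ^+ 2)^-1.

Lemma decay_weight_ge0 k : 0 <= decay_weight k.
Proof. by apply: prodr_ge0 => s _; rewrite invr_ge0 addr_ge0// sqr_ge0. Qed.

(** Comparison with the telescoping series of 4 / ((j + 1) (j + 2)). *)
Lemma sum_inv_sqr_le n : \sum_(0 <= j < n) (1 + j%:R ^+ 2 : R)^-1 <= 4.
Proof.
(* The bound is strengthened so that it can be proved by induction on n. *)
have H : \sum_(0 <= j < n) (1 + j%:R ^+ 2 : R)^-1 <= 4 - 4 / n.+1%:R.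
  elim: n => [|n IH]; first by rewrite big_nil divr1 subrr.
  rewrite big_nat_recr//=; apply: (le_trans (lerD IH (lexx _))).
  have n0 : 0 <= n%:R :> R by [].
  rewrite -[n.+2%:R]natr1 -[n.+1%:R]natr1; move: (n%:R : R) n0 => x x0.
  have h : (1 + x ^+ 2)^-1 <= 4 * ((x + 1) * (x + 1 + 1))^-1.
    rewrite ler_pdivlMr; last by rewrite mulr_gt0; lra.
    by rewrite mulrC ler_pdivrMr; nra.
  have E : 4 - 4 / (x + 1 + 1) - (4 - 4 / (x + 1)) = 4 * ((x + 1) * (x + 1 + 1))^-1.
    by field; rewrite !gt_eqF//; lra.
  lra.
apply: (le_trans H); rewrite gerBl divr_ge0//.
Qed.

Lemma sum_inv_sqr_sym_le (M : nat) :
  \sum_(j < (2 * M).+1) (1 + ((j : nat)%:Z - M%:Z)%:~R ^+ 2 : R)^-1 <= 8.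
Proof.
rewrite -(big_mkord xpredT (fun j : nat => (1 + (j%:Z - M%:Z)%:~R ^+ 2 : R)^-1)).
rewrite (@big_cat_nat _ _ _ M)//=; last by rewrite mul2n -addnn -addnS leq_addr.
rewrite (_ : 8 = 4 + 4 :> R); last by ring.
apply: lerD.
  rewrite big_nat_rev add0n/=; apply: le_trans (sum_inv_sqr_le M).
  rewrite !big_nat; apply: ler_sum => j /andP[_ jM].
  rewrite (_ : ((M - j.+1)%:Z - M%:Z)%:~R = - j.+1%:R); last first.
    by rewrite -subzn// addrAC subrr sub0r mulrNz.
  rewrite sqrrN lef_pV2 ?posrE ?ltr_pwDl ?exprn_ge0//.
  by rewrite lerD2l lerXn2r ?nnegrE ?ler_nat.
rewrite -{1}(add0n M) big_addn (_ : ((2 * M).+1 - M)%N = M.+1); last by lia.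
apply: le_trans (sum_inv_sqr_le M.+1).
apply: ler_sum => j _.
by rewrite PoszD addrK.
Qed.

Lemma absum_decay_weight : absum setT decay_weight.
Proof.
have [|//] := @absum_bound setT decay_weight (8 ^+ d).
move=> r ur _; have [M rM] := sub_box r.
have -> : \sum_(k <- r) `|decay_weight k| = \sum_(k <- r) decay_weight k.
  by apply: eq_bigr => k _; rewrite ger0_norm// decay_weight_ge0.
apply: (@le_trans _ _ (\sum_(k <- box M) decay_weight k)).
  have := @lee_fsum_nneg_subset R K [set` r] [set` box M] (fun k => (decay_weight k)%:E).
  rewrite -!fsbig_seq ?box_uniq// !sumEFin lee_fin; apply.
  - exact: finite_seq.
  - exact: finite_seq.
  - by move=> k; rewrite !inE => /rM.
  - by move=> k _; rewrite lee_fin decay_weight_ge0.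
rewrite /box big_map big_enum /=.
under eq_bigr => f _ do (rewrite /decay_weight; under eq_bigr => s _ do rewrite mxE).
rewrite -(@bigA_distr_bigA _ _ _ _ _ _ _ (fun (s : 'I_d) (j : 'I_(2 * M).+1) => (1 + ((j : nat)%:Z - M%:Z)%:~R ^+ 2 : R)^-1)).
rewrite -[X in _ <= _ ^+ X](card_ord d) -prodr_const.
apply: ler_prod => s _; rewrite sum_inv_sqr_sym_le andbT.
by apply: sumr_ge0 => j _; rewrite invr_ge0 addr_ge0// sqr_ge0.
Qed.

End Ksum.

(** * Fourier coefficients of smooth functions and of series *)

Section SmoothFourier.
Context {R : realType} {d : nat}.
Implicit Types (f g : 'rV[R]_d -> R) (k h : 'rV[int]_d).
Notation I := (@torus_int R d).
Local Notation N := ((2 * pi) `^ (- (d%:R / 2)) : R).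

Lemma fcosE f k : cper f -> fcos f k = N * I (fun x => f x * cos (phase k x)).
Proof.
move=> cf; rewrite -torus_intZ; last by solve_cper.
by congr I; apply/funext => x; rewrite mulrCA.
Qed.

Lemma fsinE f k : cper f -> fsin f k = - (N * I (fun x => f x * sin (phase k x))).
Proof.
move=> cf; rewrite -torus_intZ; last by solve_cper.
by congr (- I _); apply/funext => x; rewrite mulrCA.
Qed.

Lemma fourier_lin a b f g k : cper f -> cper g ->
  fcos (fun x => a * f x + b * g x) k = a * fcos f k + b * fcos g k /\
  fsin (fun x => a * f x + b * g x) k = a * fsin f k + b * fsin g k.
Proof.
move=> cf cg; split.
  rewrite -torus_int_lin; [|by solve_cper..].
  by congr I; apply/funext => x; ring.
rewrite !mulrN -opprD -torus_int_lin; [|by solve_cper..].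
by congr (- I _); apply/funext => x; ring.
Qed.

Lemma fourierZ a f k : cper f ->
  fcos (fun x => a * f x) k = a * fcos f k /\ fsin (fun x => a * f x) k = a * fsin f k.
Proof.
move=> cf; have := fourier_lin a 0 k cf cf; rewrite !mul0r !addr0.
by rewrite (_ : (fun x => a * f x + 0 * f x) = (fun x => a * f x))//; apply/funext => x; rewrite mul0r addr0.
Qed.

Lemma fourierB f g k : cper f -> cper g ->
  fcos (fun x => f x - g x) k = fcos f k - fcos g k /\
  fsin (fun x => f x - g x) k = fsin f k - fsin g k.
Proof.
move=> cf cg; have := fourier_lin 1 (-1) k cf cg; rewrite !mul1r !mulN1r.
by rewrite (_ : (fun x => 1 * f x + -1 * g x) = (fun x => f x - g x))//; apply/funext => x; rewrite mul1r mulN1r.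
Qed.

Lemma fourier_sum (T : Type) (r : seq T) (F : T -> 'rV[R]_d -> R) k : (forall i, cper (F i)) ->
  fcos (fun x => \sum_(i <- r) F i x) k = \sum_(i <- r) fcos (F i) k /\
  fsin (fun x => \sum_(i <- r) F i x) k = \sum_(i <- r) fsin (F i) k.
Proof.
move=> cF; split.
  rewrite /fcos -torus_int_sum => [|i _]; last by have := cF i => ?; solve_cper.
  by congr I; apply/funext => x; rewrite mulr_suml.
rewrite /fsin sumrN -torus_int_sum => [|i _]; last by have := cF i => ?; solve_cper.
by congr (- I _); apply/funext => x; rewrite mulr_suml.
Qed.

Lemma fourier_norm_le f M k : cper f -> (forall x, `|f x| <= M) ->
  `|fcos f k| <= M * (N * (2 * pi) ^+ d) /\ `|fsin f k| <= M * (N * (2 * pi) ^+ d).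
Proof.
move=> cf fM; have N0 : 0 < N by exact: mode_norm_gt0.
have M0 : 0 <= M by exact: le_trans (normr_ge0 _) (fM 0).
have H (t : 'rV[R]_d -> R) : (forall x, `|t x| <= 1) -> cper t ->
    `|I (fun x => f x * (N * t x))| <= M * (N * (2 * pi) ^+ d).
  move=> t1 ct; rewrite mulrA; apply: torus_int_norm_le; first by solve_cper.
  move=> x; rewrite !normrM (gtr0_norm N0); apply: ler_pM => //.
    by rewrite mulr_ge0// ltW.
  by rewrite -[leRHS]mulr1 ler_pM2l.
split; first by apply: H => [x|]; [exact: cos_max|solve_cper].
by rewrite normrN; apply: H => [x|]; [exact: sin_max|solve_cper].
Qed.

(** Partial derivatives of order up to n in any order, defined by recursion on
    n so that derivatives of members for n + 1 are members for n by
    definition. *)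
Fixpoint Cper (n : nat) f : Prop :=
  cper f /\ if n is m.+1 then
    forall s, (forall x, derivable f x (basis_vec s)) /\ Cper m (pd s f)
  else True.

Lemma Cper_cper n f : Cper n f -> cper f.
Proof. by case: n => [|n] []. Qed.

Lemma CperW n f : Cper n.+1 f -> Cper n f.
Proof.
elim: n f => [|n IH] f; first by move=> [cf _].
by move=> [cf H]; split => // s; have [df /IH] := H s.
Qed.

Lemma Cper_leq m n f : (m <= n)%N -> Cper n f -> Cper m f.
Proof.
move=> /subnKC <-; elim: (n - m)%N => [|j IH]; first by rewrite addn0.
by rewrite addnS => /CperW.
Qed.

Lemma pd_lin s a b f g : (forall x, derivable f x (basis_vec s)) ->
  (forall x, derivable g x (basis_vec s)) ->
  (forall x, derivable (fun x => a * f x + b * g x) x (basis_vec s)) /\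
  pd s (fun x => a * f x + b * g x) = (fun x => a * pd s f x + b * pd s g x).
Proof.
move=> df dg.
have dZ (c : R) (u : 'rV[R]_d -> R) : (forall x, derivable u x (basis_vec s)) ->
    forall x, derivable (fun x => c * u x) x (basis_vec s).
  by move=> du x; apply: (@derivableZ _ _ _ u).
split; first by move=> x; apply: (@derivableD _ _ _ (fun x => a * f x) (fun x => b * g x)); exact: dZ.
apply/funext => x; rewrite /pd.
rewrite (@deriveD _ _ _ (fun x => a * f x) (fun x => b * g x))//; [|exact: dZ..].
by congr (_ + _); exact: deriveZ.
Qed.

Lemma pdM s f g : (forall x, derivable f x (basis_vec s)) ->
  (forall x, derivable g x (basis_vec s)) ->
  (forall x, derivable (fun x => f x * g x) x (basis_vec s)) /\
  pd s (fun x => f x * g x) = (fun x => pd s f x * g x + f x * pd s g x).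
Proof.
move=> df dg; split; first by move=> x; exact: (@derivableM _ _ f g).
apply/funext => x; rewrite /pd (@deriveM _ _ f g)//.
by rewrite addrC mulrC; congr (_ + _); rewrite mulrC.
Qed.

Lemma Cper_lin n a b f g : Cper n f -> Cper n g -> Cper n (fun x => a * f x + b * g x).
Proof.
elim: n f g => [|n IH] f g; first by move=> [cf _] [cg _]; split => //; solve_cper.
move=> [cf Hf] [cg Hg]; split; first by solve_cper.
move=> s; have [df Cf] := Hf s; have [dg Cg] := Hg s.
have [dl El] := pd_lin a b df dg; split => //.
by rewrite El; exact: IH.
Qed.

Lemma CperD n f g : Cper n f -> Cper n g -> Cper n (fun x => f x + g x).
Proof.
move=> Cf Cg; have := Cper_lin 1 1 Cf Cg.
by congr Cper; apply/funext => x; rewrite !mul1r.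
Qed.

Lemma CperB n f g : Cper n f -> Cper n g -> Cper n (fun x => f x - g x).
Proof.
move=> Cf Cg; have := Cper_lin 1 (-1) Cf Cg.
by congr Cper; apply/funext => x; rewrite !mul1r mulN1r.
Qed.

Lemma CperM n f g : Cper n f -> Cper n g -> Cper n (fun x => f x * g x).
Proof.
elim: n f g => [|n IH] f g; first by move=> [cf _] [cg _]; split => //; solve_cper.
move=> Hf' Hg'; have [cf Hf] := Hf'; have [cg Hg] := Hg'; split; first by solve_cper.
move=> s; have [df Cf] := Hf s; have [dg Cg] := Hg s.
have [dl El] := pdM df dg; split => //.
by rewrite El; apply: CperD; apply: IH => //; apply: CperW.
Qed.

Lemma Cper_sum n (T : Type) (r : seq T) (F : T -> 'rV[R]_d -> R) :
  Cper n (fun=> 0) -> (forall i, Cper n (F i)) -> Cper n (fun x => \sum_(i <- r) F i x).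
Proof.
move=> C0 H; elim: r => [|i r IH].
  by move: C0; congr Cper; apply/funext => x; rewrite big_nil.
rewrite (_ : (fun x => _) = fun x => F i x + \sum_(i <- r) F i x); first exact: CperD.
by apply/funext => x; rewrite big_cons.
Qed.

(** Integration by parts against a mode; the boundary terms vanish by
    periodicity. *)
Lemma fourier_pd s f k : Cper 1 f ->
  fcos (pd s f) k = - ((k ord0 s)%:~R * fsin f k) /\
  fsin (pd s f) k = (k ord0 s)%:~R * fcos f k.
Proof.
move=> [cf /(_ s) [df [cpf _]]].
have H (t u : 'rV[R]_d -> R) c : cper t -> cper u ->
  (forall x, derivable t x (basis_vec s) /\ pd s t x = c * u x) ->
  I (fun x => pd s f x * t x) = - (c * I (fun x => f x * u x)).
  move=> ct cu dt; have [d1 E1] := pdM df (fun x => (dt x).1).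
  have Et : pd s t = (fun x => c * u x) by apply/funext => x; rewrite (dt x).2.
  have := @torus_int_pd R d s (fun x => f x * t x); rewrite E1 Et.
  move=> /(_ (cperM cf ct) d1) h.
  have : I (fun x => pd s f x * t x + f x * (c * u x)) = 0.
    apply: h; have : cper (fun x => pd s f x * t x + f x * (c * u x)) by solve_cper.
    by case.
  rewrite torus_intD; [|by solve_cper..].
  rewrite (_ : (fun x => f x * (c * u x)) = (fun x => c * (f x * u x))); last first.
    by apply/funext => x; ring.
  rewrite torus_intZ; last by solve_cper.
  by move=> h'; lra.
rewrite !fcosE// !fsinE//; split.
  rewrite (H _ (fun x => sin (phase k x)) (- (k ord0 s)%:~R)); last first.
  - by move=> x; exact: pd_cos_phase.
  - exact: cper_sin_phase.
  - exact: cper_cos_phase.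
  ring.
rewrite (H _ (fun x => cos (phase k x)) ((k ord0 s)%:~R)); last first.
- by move=> x; exact: pd_sin_phase.
- exact: cper_cos_phase.
- exact: cper_sin_phase.
ring.
Qed.

Lemma fourier_pd2 s f k : Cper 2 f ->
  fcos (pd s (pd s f)) k = - (k ord0 s)%:~R ^+ 2 * fcos f k /\
  fsin (pd s (pd s f)) k = - (k ord0 s)%:~R ^+ 2 * fsin f k.
Proof.
move=> C2; have C1 := CperW C2; have [_ /(_ s) [_ C1']] := C2.
have [-> ->] := fourier_pd s k C1'; have [-> ->] := fourier_pd s k C1.
by split; ring.
Qed.

(** On Fourier coefficients this operator multiplies by 1 + k_s^2, hence it is
    the tool that turns smoothness into decay. *)
Definition one_minus_pd2 s f : 'rV[R]_d -> R := fun x => f x - pd s (pd s f) x.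

(** Apply [one_minus_pd2] once in each of the d directions: the result is a
    bounded function whose coefficients are those of f divided by the decay
    weight. *)
Lemma fourier_decay f : Cper (2 * d) f -> exists C, 0 <= C /\ forall k,
  `|fcos f k| <= C * decay_weight k /\ `|fsin f k| <= C * decay_weight k.
Proof.
move=> Cf.
have H l : Cper (2 * size l) f -> forall n, Cper (2 * size l + n) f ->
  Cper n (foldr one_minus_pd2 f l) /\ forall k,
  fcos f k = (\prod_(s <- l) (1 + (k ord0 s)%:~R ^+ 2)^-1) * fcos (foldr one_minus_pd2 f l) k /\
  fsin f k = (\prod_(s <- l) (1 + (k ord0 s)%:~R ^+ 2)^-1) * fsin (foldr one_minus_pd2 f l) k.
  move=> _; elim: l => [|s l IH] n.
    by move=> Cn; split => // k; rewrite big_nil !mul1r.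
  (* Each direction consumes two derivatives; n counts those left over. *)
rewrite (_ : (2 * size (s :: l) + n = 2 * size l + n.+2)%N); last by rewrite /=; lia.
    move=> /IH[]; rewrite /=; set g := foldr _ _ _ => C2 E.
  have [_ /(_ s) [_ /= [_ /(_ s) [_ Cg]]]] := C2.
  split; first by apply: CperB => //; apply: CperW; exact: CperW.
  move=> k; have C2' : Cper 2 g by exact: (@Cper_leq 2 n.+2 g _ C2).
  have [e1 e2] := fourier_pd2 s k C2'.
  have [f1 f2] := @fourierB g (pd s (pd s g)) k C2.1 (Cper_cper Cg).
  have [-> ->] := E k; rewrite !big_cons f1 f2 e1 e2.
  have nz : 1 + (k ord0 s)%:~R ^+ 2 != 0 :> R by rewrite gt_eqF// ltr_pwDl ?sqr_ge0.
  split.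
    rewrite (_ : fcos g k - _ = (1 + (k ord0 s)%:~R ^+ 2) * fcos g k); last by ring.
    by rewrite [X in _ = X * _]mulrC -mulrA mulKf.
  rewrite (_ : fsin g k - _ = (1 + (k ord0 s)%:~R ^+ 2) * fsin g k); last by ring.
  by rewrite [X in _ = X * _]mulrC -mulrA mulKf.
have [||C0 E] := H (enum 'I_d) _ 0%N; rewrite ?size_enum_ord ?addn0//.
have [M [M0 HM]] := cper_bounded (Cper_cper C0).
exists (M * (N * (2 * pi) ^+ d)); split.
  by rewrite mulr_ge0// mulr_ge0 ?exprn_ge0 ?ltW ?mode_norm_gt0 ?twopi_gt0.
move=> k; have [-> ->] := E k; have [h1 h2] := fourier_norm_le k (Cper_cper C0) HM.
rewrite (_ : \prod_(s <- _) _ = decay_weight k); last first.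
  by rewrite /decay_weight big_enum.
rewrite !normrM (ger0_norm (decay_weight_ge0 k)) mulrC [_ * `|fsin _ _|]mulrC.
by rewrite !ler_wpM2r// decay_weight_ge0.
Qed.

Lemma fourier_absum f : Cper (2 * d) f -> absum setT (fcos f) /\ absum setT (fsin f).
Proof.
move=> /fourier_decay[C [C0 H]].
have w : absum setT (fun k => C * decay_weight k :> R) by exact: absumZ absum_decay_weight.
split; apply: le_absum w => k _; rewrite [leRHS]ger0_norm ?mulr_ge0 ?decay_weight_ge0//.
  exact: (H k).1.
exact: (H k).2.
Qed.

Lemma fcosN f k : fcos f (- k) = fcos f k.
Proof. by congr I; apply/funext => x; rewrite phaseN cosN. Qed.

Lemma fsinN f k : cper f -> fsin f (- k) = - fsin f k.
Proof.
move=> cf; rewrite !fsinE// opprK -mulrN -torus_intN; last by solve_cper.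
by congr (N * I _); apply/funext => x; rewrite phaseN sinN mulrN opprK.
Qed.

(** The real part of the k-th term of the Fourier series with coefficients a +
    i b. *)
Definition fourier_term (a b : 'rV[int]_d -> R) k (x : 'rV[R]_d) : R :=
  a k * (N * cos (phase k x)) - b k * (N * sin (phase k x)).

Definition fourier_series (a b : 'rV[int]_d -> R) (x : 'rV[R]_d) : R :=
  ksum setT (fun k => fourier_term a b k x).

Lemma cper_fourier_term a b k : cper (fourier_term a b k).
Proof. by rewrite /fourier_term; solve_cper. Qed.

(** A single real term carries the two frequencies h and - h, each with half of
    the weight. *)
Lemma fourier_term_coef a b h k :
  fcos (fourier_term a b h) k = a h * (2^-1 * ((k + h == 0)%:R + (k - h == 0)%:R)) /\
  fsin (fourier_term a b h) k = b h * (2^-1 * ((k - h == 0)%:R - (k + h == 0)%:R)).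
Proof.
have NE := @mode_normE R d.
have [cc ss cs sc] : [/\ I (fun x => cos (phase h x) * cos (phase k x)) = 2^-1 * ((k + h == 0)%:R + (k - h == 0)%:R) * (2 * pi) ^+ d,
   I (fun x => sin (phase h x) * sin (phase k x)) = 2^-1 * ((k - h == 0)%:R - (k + h == 0)%:R) * (2 * pi) ^+ d,
   I (fun x => cos (phase h x) * sin (phase k x)) = 0 &
   I (fun x => sin (phase h x) * cos (phase k x)) = 0].
  split.
  - rewrite (_ : (fun x => _) = (fun x => 2^-1 * cos (phase (k + h) x) + 2^-1 * cos (phase (k - h) x))).
      by rewrite torus_int_lin; [rewrite !torus_int_cos; ring|solve_cper..].
    by apply/funext => x; rewrite cos_sum_half phaseD phaseB.
  - rewrite (_ : (fun x => _) = (fun x => 2^-1 * cos (phase (k - h) x) + (- 2^-1) * cos (phase (k + h) x))).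
      by rewrite torus_int_lin; [rewrite !torus_int_cos; ring|solve_cper..].
    by apply/funext => x; rewrite sin_sin_half phaseB phaseD; ring.
  - rewrite (_ : (fun x => _) = (fun x => 2^-1 * sin (phase (k + h) x) + 2^-1 * sin (phase (k - h) x))).
      by rewrite torus_int_lin; [rewrite !torus_int_sin !mulr0 addr0|solve_cper..].
    by apply/funext => x; rewrite cos_sin_half phaseD phaseB.
  - rewrite (_ : (fun x => _) = (fun x => 2^-1 * sin (phase (k + h) x) + (- 2^-1) * sin (phase (k - h) x))).
      by rewrite torus_int_lin; [rewrite !torus_int_sin !mulr0 addr0|solve_cper..].
    by apply/funext => x; rewrite sin_cos_half phaseD phaseB; ring.
rewrite fcosE ?fsinE; [|exact: cper_fourier_term..].
rewrite /fourier_term; split.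
  rewrite (_ : (fun x => _) = (fun x => (a h * N) * (cos (phase h x) * cos (phase k x)) + (- (b h * N)) * (sin (phase h x) * cos (phase k x)))).
    rewrite torus_int_lin; [|by solve_cper..].
    rewrite cc sc mulr0 addr0.
    transitivity (a h * (2^-1 * ((k + h == 0)%:R + (k - h == 0)%:R)) * (N ^+ 2 * (2 * pi) ^+ d)).
      by move: N ((2 * pi) ^+ d) => n0 m0; ring.
    by rewrite NE mulr1.
  by apply/funext => x; ring.
rewrite (_ : (fun x => _) = (fun x => (a h * N) * (cos (phase h x) * sin (phase k x)) + (- (b h * N)) * (sin (phase h x) * sin (phase k x)))).
  rewrite torus_int_lin; [|by solve_cper..].
  rewrite cs ss mulr0 add0r.
  transitivity (b h * (2^-1 * ((k - h == 0)%:R - (k + h == 0)%:R)) * (N ^+ 2 * (2 * pi) ^+ d)).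
    by move: N ((2 * pi) ^+ d) => n0 m0; ring.
  by rewrite NE mulr1.
by apply/funext => x; ring.
Qed.

(** The second approximation, for families dominated by |a| + |b|, allows the
    same finite set of modes to be used for the series and for the sum of its
    coefficients. *)
Lemma fourier_term_approx a b (eps : R) : absum setT a -> absum setT b -> 0 < eps ->
  exists r : seq 'rV[int]_d, [/\ uniq r,
   (forall x, `|fourier_series a b x - \sum_(k <- r) fourier_term a b k x| <= eps) &
   forall u : 'rV[int]_d -> R, (forall k, `|u k| <= `|a k| + `|b k|) ->
     `|ksum setT u - \sum_(k <- r) u k| <= eps].
Proof.
move=> sa sb e0; have N0 : 0 < N by exact: mode_norm_gt0.
pose g k := (1 + N) * (`|a k| + `|b k|).
have g0 k : 0 <= g k by rewrite mulr_ge0 ?addr_ge0// ltW.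
have sg : absum setT g.
  by apply: absumZ; apply: absumD; exact: absum_norm.
have [r [ur _ H]] := ksum_tail sg e0.
exists r; split => //.
  move=> x; apply: H => k _; rewrite [leRHS]ger0_norm//.
  apply: (le_trans (ler_normB _ _)); rewrite !normrM (gtr0_norm N0) /g [leRHS]mulrDr.
  have h (c : R) : `|c| <= 1 -> N * `|c| <= 1 + N.
    by move=> c1; apply: (@le_trans _ _ N); [rewrite -[leRHS]mulr1 ler_pM2l|rewrite lerDr].
  by apply: lerD; rewrite mulrC ler_wpM2r// h//; [exact: cos_max|exact: sin_max].
move=> u Hu; apply: H => k _; rewrite [leRHS]ger0_norm// (le_trans (Hu k))//.
by rewrite /g mulrDl mul1r lerDl mulr_ge0 ?addr_ge0// ltW.
Qed.

Lemma cper_fourier_series a b : absum setT a -> absum setT b -> cper (fourier_series a b).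
Proof.
move=> sa sb; split; last first.
  move=> s x; apply: eq_ksum => k _; rewrite /fourier_term phase_shift.
  by have [-> ->] := trig_periodic_int (phase k x) (k ord0 s).
apply: continuous_distP => x e e0.
have e4 : 0 < e / 3 by rewrite divr_gt0.
have [r [_ H _]] := fourier_term_approx sa sb e4.
have cP : cper (fun x => \sum_(k <- r) fourier_term a b k x).
  by apply: cper_sum => k _; exact: cper_fourier_term.
have /cvgrPdist_lt/(_ _ e4) := cP.1 x; apply: filterS => y.
have h1 := H x; have h2 := H y.
rewrite ltr_norml ler_norml; move: h1 h2; rewrite !ler_norml.
move: (fourier_series a b x) (fourier_series a b y) (\sum_(k <- r) fourier_term a b k x)
  (\sum_(k <- r) fourier_term a b k y) => F1 F2 P1 P2 /=; lra.
Qed.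

Lemma small_eq0 (z C : R) : 0 <= C -> (forall eps, 0 < eps -> `|z| <= eps * C) -> z = 0.
Proof.
move=> C0 H; apply/eqP; rewrite -normr_eq0; apply/eqP/le_anti; rewrite normr_ge0 andbT.
apply/ler_addgt0Pr => e e0; rewrite add0r.
have C1 : 0 < C + 1 by rewrite ltr_wpDl.
apply: (le_trans (H (e / (C + 1)) _)); first by rewrite divr_gt0.
by rewrite mulrAC ler_pdivrMr// ler_pM2l// lerDl.
Qed.

(** By uniform convergence, the coefficient of the series is the sum of the
    coefficients of its terms. Only the terms of index k and - k contribute,
    half of the expected value each, and they agree because the coefficients
    come from a real function: a is even and b is odd. *)
Lemma fourier_series_coef a b k : absum setT a -> absum setT b ->
  (forall h, a (- h) = a h) -> (forall h, b (- h) = - b h) ->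
  fcos (fourier_series a b) k = a k /\ fsin (fourier_series a b) k = b k.
Proof.
move=> sa sb ev od; have N0 : 0 < N by exact: mode_norm_gt0.
have p0 : 0 < (2 * pi) ^+ d :> R by rewrite exprn_gt0// twopi_gt0.
have cF := cper_fourier_series sa sb.
pose ca h := a h * (2^-1 * ((k + h == 0)%:R + (k - h == 0)%:R)).
pose cb h := b h * (2^-1 * ((k - h == 0)%:R - (k + h == 0)%:R)).
have leA h : `|ca h| <= `|a h| + `|b h|.
  rewrite /ca normrM; apply: (@le_trans _ _ (`|a h| * 1)); last by rewrite mulr1 lerDl.
  rewrite ler_wpM2l//; case: (_ == _); case: (_ == _) => /=; rewrite ger0_norm; lra.
have leB h : `|cb h| <= `|a h| + `|b h|.
  rewrite /cb normrM; apply: (@le_trans _ _ (`|b h| * 1)); last by rewrite mulr1 lerDr.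
  by rewrite ler_wpM2l// ler_norml; case: (_ == _); case: (_ == _) => /=; lra.
(* The two indices coincide when k = 0. *)
pose r0 : seq 'rV[int]_d := undup [:: k; - k].
have z h : h \notin r0 -> (k + h == 0) = false /\ (k - h == 0) = false.
  rewrite mem_undup !inE negb_or => /andP[h1 h2]; split; apply/negbTE.
    by rewrite addrC addr_eq0.
  by rewrite subr_eq0 eq_sym.
have [|_ Ea] := @absum_finite R d setT ca r0 (undup_uniq _) (fun _ _ => Logic.I).
  by move=> h _ /z[z1 z2]; rewrite /ca z1 z2 addr0 !mulr0.
have [|_ Eb] := @absum_finite R d setT cb r0 (undup_uniq _) (fun _ _ => Logic.I).
  by move=> h _ /z[z1 z2]; rewrite /cb z1 z2 subr0 !mulr0.
have vanish : (k == - k) -> k = 0.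
  rewrite -addr_eq0 => /eqP kk; apply/rowP => s; have /rowP/(_ s) := kk.
  by rewrite !mxE; move: (k _ _) => w; lia.
have nz : k != - k -> (k + k == 0) = false by rewrite -addr_eq0 => /negbTE.
have Sa : ksum setT ca = a k.
  rewrite Ea /r0 /= inE; case: ifPn => [/vanish k0|kk].
    by rewrite big_seq1 /ca k0 oppr0 addr0 subr0 eqxx /=; lra.
  rewrite big_cons big_seq1 /ca ev subrr opprK nz// eqxx /=; lra.
have Sb : ksum setT cb = b k.
  rewrite Eb /r0 /= inE; case: ifPn => [/vanish k0|kk].
    have := od 0; rewrite big_seq1 /cb k0 oppr0 addr0 subr0 eqxx /=; lra.
  rewrite big_cons big_seq1 /cb od subrr opprK nz// eqxx /=; lra.
pose C := N * (2 * pi) ^+ d + 1.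
have C0 : 0 <= C by rewrite addr_ge0// mulr_ge0// ltW.
have main eps : 0 < eps -> `|fcos (fourier_series a b) k - a k| <= eps * C /\
   `|fsin (fourier_series a b) k - b k| <= eps * C.
  move=> e0; have [r [_ H1 H2]] := fourier_term_approx sa sb e0.
  have cP : cper (fun x => \sum_(h <- r) fourier_term a b h x).
    by apply: cper_sum => h _; exact: cper_fourier_term.
  have [s1 s2] := fourier_sum r k (cper_fourier_term a b).
  have [b1 b2] := fourierB k cF cP.
  have cD : cper (fun x => fourier_series a b x - \sum_(h <- r) fourier_term a b h x).
    by solve_cper.
  have [n1 n2] := fourier_norm_le k cD H1.
  have := H2 ca leA; have := H2 cb leB; rewrite Sa Sb.
  rewrite b1 s1 in n1; rewrite b2 s2 in n2.
  have -> : \sum_(h <- r) cb h = \sum_(h <- r) fsin (fourier_term a b h) k.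
    by apply: eq_bigr => h _; rewrite (fourier_term_coef a b h k).2.
  have -> : \sum_(h <- r) ca h = \sum_(h <- r) fcos (fourier_term a b h) k.
    by apply: eq_bigr => h _; rewrite (fourier_term_coef a b h k).1.
  move: n1 n2; rewrite /C; move: (N * _) => m.
  move: (\sum_(h <- r) fsin _ _) (\sum_(h <- r) fcos _ _) (fcos _ _) (fsin _ _) (a k) (b k).
  move=> u1 u2 u3 u4 u5 u6; rewrite !ler_norml; lra.
split; apply/eqP; rewrite -subr_eq0; apply/eqP; apply: (small_eq0 C0) => eps /main[] //.
Qed.

End SmoothFourier.

(** * Vector fields: Fourier coefficients, norms, Leray projection *)

Section Fields.
Import complex.
Local Open Scope complex_scope.
Context {R : realType} {d : nat}.
Implicit Types (v w : vfield R d) (k h : 'rV[int]_d).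
Local Notation N := ((2 * pi) `^ (- (d%:R / 2)) : R).

Definition vcomp v (r : 'I_d) : 'rV[R]_d -> R := fun x => v x ord0 r.

(** Smooth periodic fields, expressed componentwise so as to apply the scalar
    theory. *)
Definition smooth_per v := forall n r, Cper n (vcomp v r).

Lemma smooth_per_cper v r : smooth_per v -> cper (vcomp v r).
Proof. by move=> /(_ 0%N r) []. Qed.

Lemma smooth_per_pd v r s n : smooth_per v -> (forall x, derivable (vcomp v r) x (basis_vec s)) /\
  Cper n (pd s (vcomp v r)).
Proof. by move=> /(_ n.+1 r) [_ /(_ s)]. Qed.

Lemma smooth_per_derivable v s x : smooth_per v -> derivable v x (basis_vec s).
Proof.
move=> sv; apply/derivable_mxP => i j; rewrite (ord1 i).
by have [+ _] := smooth_per_pd j s 0 sv; exact.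
Qed.

Lemma vcomp_partial v s r : (forall x, derivable v x (basis_vec s)) ->
  vcomp (partial s v) r = pd s (vcomp v r).
Proof.
by move=> dv; apply/funext => x; rewrite /vcomp /partial derive_mx// mxE.
Qed.

Lemma smooth_per_partial v s : smooth_per v -> smooth_per (partial s v).
Proof.
move=> sv n r; rewrite vcomp_partial; last by move=> x; exact: smooth_per_derivable.
by have [] := smooth_per_pd r s n sv.
Qed.

Lemma smooth_field_per v : smooth_field v -> Defs.periodic v -> smooth_per v.
Proof.
move=> sv pv n; elim: n v sv pv => [|n IH] v sv pv r.
  have [cv _] := sv [::]; split => //; split => [x|s x]; last by rewrite /vcomp pv.
  apply: (@continuous_comp _ _ _ v (fun M : 'rV[R]_d => M ord0 r)); first exact: cv.
  exact: coord_continuous.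
have [cv dv] := sv [::]; split; first by have /Cper_cper := IH v sv pv r.
move=> s; have [dvs _] := dv s; split.
  by move=> x; have /derivable_mxP := dvs x; exact.
rewrite -vcomp_partial//; apply: IH.
  by move=> l; have := sv (rcons l s); rewrite /iter_partial foldr_rcons.
by move=> s' x; apply: derive_comp_period.
Qed.

Lemma vcomp_lin a b v w r : vcomp (a *: v + b *: w) r = (fun x => a * vcomp v r x + b * vcomp w r x).
Proof. by apply/funext => x; rewrite /vcomp !mxE. Qed.

Lemma vcompZ a v r : vcomp (a *: v) r = (fun x => a * vcomp v r x).
Proof. by apply/funext => x; rewrite /vcomp !mxE. Qed.

Lemma vcompN v r : vcomp (- v) r = (fun x => - vcomp v r x).
Proof. by apply/funext => x; rewrite /vcomp !mxE. Qed.

Lemma vcomp_advect v w r : smooth_per w ->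
  vcomp (advect v w) r = (fun x => \sum_(s < d) vcomp v s x * pd s (vcomp w r) x).
Proof.
move=> sw; apply/funext => x; rewrite /vcomp /advect summxE.
apply: eq_bigr => s _; rewrite mxE; congr (_ * _).
by rewrite -[LHS]/(vcomp (partial s w) r x) vcomp_partial// => y; exact: smooth_per_derivable.
Qed.

Lemma vcomp_laplacian v r : smooth_per v ->
  vcomp (laplacian v) r = (fun x => \sum_(s < d) pd s (pd s (vcomp v r)) x).
Proof.
move=> sv; apply/funext => x; rewrite /vcomp /laplacian summxE.
apply: eq_bigr => s _.
rewrite -[LHS]/(vcomp (partial s (partial s v)) r x) vcomp_partial; last first.
  by move=> y; apply: smooth_per_derivable; exact: smooth_per_partial.
by rewrite vcomp_partial// => y; exact: smooth_per_derivable.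
Qed.

Lemma Cper_cst n (a : R) : Cper n (fun _ : 'rV[R]_d => a).
Proof.
elim: n a => [|n IH] a; first by split => //; exact: cper_cst.
split => [|s]; first exact: cper_cst.
split; first by move=> x; exact: derivable_cst.
rewrite (_ : pd s _ = fun=> 0); first exact: IH.
by apply/funext => x; exact: derive_cst.
Qed.

Lemma smooth_per_advect v w : smooth_per v -> smooth_per w -> smooth_per (advect v w).
Proof.
move=> sv sw n r; rewrite vcomp_advect//; apply: Cper_sum; first exact: Cper_cst.
by move=> s; apply: CperM; [exact: sv|have [] := smooth_per_pd r s n sw].
Qed.

Definition ksqr k : R := \sum_(s < d) (k ord0 s)%:~R ^+ 2.

Lemma ksqr_ge0 k : 0 <= ksqr k.
Proof. by apply: sumr_ge0 => s _; exact: sqr_ge0. Qed.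

Lemma fourier_laplacian v r k : smooth_per v ->
  fcos (vcomp (laplacian v) r) k = - ksqr k * fcos (vcomp v r) k /\
  fsin (vcomp (laplacian v) r) k = - ksqr k * fsin (vcomp v r) k.
Proof.
move=> sv; rewrite vcomp_laplacian//.
have [|-> ->] := @fourier_sum R d _ (index_enum 'I_d) (fun s => pd s (pd s (vcomp v r))) k.
  by move=> s; have [_ [_ /(_ s) [_ [+ _]]]] := smooth_per_pd r s 1 sv.
rewrite /ksqr -sumrN !mulr_suml; split; apply: eq_bigr => s _.
  exact: (fourier_pd2 s k (sv 2%N r)).1.
exact: (fourier_pd2 s k (sv 2%N r)).2.
Qed.

(** Orthogonality of the coefficients to the wave vector, for the real and for
    the imaginary parts. *)
Lemma fourier_divfree v k : smooth_per v -> (forall x, divergence v x = 0) ->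
  \sum_(s < d) (k ord0 s)%:~R * fcos (vcomp v s) k = 0 /\
  \sum_(s < d) (k ord0 s)%:~R * fsin (vcomp v s) k = 0.
Proof.
move=> sv dv.
have E : (fun x => \sum_(s < d) pd s (vcomp v s) x) = fun=> 0.
  apply/funext => x; rewrite -[RHS](dv x); apply: eq_bigr => s _.
  by rewrite -vcomp_partial// => y; exact: smooth_per_derivable.
have c s : cper (pd s (vcomp v s)) by have [_ /Cper_cper] := smooth_per_pd s s 0 sv.
have [e1 e2] := fourier_sum (index_enum 'I_d) k c.
have [z1 z2] := @fourierZ R d 0 (fun=> 0) k (cper_cst 0).
have z0 : (fun x : 'rV[R]_d => 0 * (0 : R)) = fun=> 0 by apply/funext => x; rewrite mul0r.
rewrite z0 !mul0r in z1 z2.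
rewrite E z1 in e1; rewrite E z2 in e2.
split.
  by rewrite [RHS]e2; apply: eq_bigr => s _; rewrite (fourier_pd s k (sv 1%N s)).2.
apply: oppr_inj; rewrite oppr0 [RHS]e1 -sumrN.
by apply: eq_bigr => s _; rewrite (fourier_pd s k (sv 1%N s)).1.
Qed.

Lemma fourier_mean_zero v r : smooth_per v -> mean_zero v ->
  fcos (vcomp v r) 0 = 0 /\ fsin (vcomp v r) 0 = 0.
Proof.
move=> sv /(_ r) mz; have cv := smooth_per_cper r sv.
have p0 x : @phase R d 0 x = 0 by rewrite /phase big1// => s _; rewrite mxE mul0r.
rewrite fcosE ?fsinE//; split.
  rewrite (_ : (fun x => _) = vcomp v r); first by rewrite mz mulr0.
  by apply/funext => x; rewrite p0 cos0 mulr1.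
rewrite (_ : (fun x => _) = fun x => 0 * vcomp v r x).
  by rewrite torus_intZ// mul0r mulr0 oppr0.
by apply/funext => x; rewrite p0 sin0 mulr0 mul0r.
Qed.

Lemma fourier_coefE v k r : cper (vcomp v r) ->
  fourier_coef v k ord0 r = fcos (vcomp v r) k +i* fsin (vcomp v r) k.
Proof.
move=> cv; rewrite mxE /torus_cint; congr (_ +i* _).
  congr torus_int; apply/funext => x; rewrite /fourier_mode /vcomp /= -/(phase k x); ring.
rewrite /fsin -torus_intN; last by solve_cper.
congr torus_int; apply/funext => x; rewrite /fourier_mode /vcomp /= -/(phase k x); ring.
Qed.

Lemma Re_sum (I : Type) (r : seq I) (F : I -> R[i]) :
  Re (\sum_(i <- r) F i) = \sum_(i <- r) Re (F i).
Proof. by elim/big_rec2: _ => [//|i y x _ <-]; case: (F i); case: x. Qed.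

Lemma Im_sum (I : Type) (r : seq I) (F : I -> R[i]) :
  Im (\sum_(i <- r) F i) = \sum_(i <- r) Im (F i).
Proof. by elim/big_rec2: _ => [//|i y x _ <-]; case: (F i); case: x. Qed.

Lemma Re_cdot (a b : 'rV[R[i]]_d) :
  Re (cdot (cconj a) b) = \sum_(r < d) (Re (a ord0 r) * Re (b ord0 r) + Im (a ord0 r) * Im (b ord0 r)).
Proof.
rewrite /cdot Re_sum; apply: eq_bigr => r _; rewrite mxE.
by case: (a ord0 r) => a1 a2; case: (b ord0 r) => b1 b2 /=; ring.
Qed.

Definition field_cper v := forall r, cper (vcomp v r).

Definition hweight (p : R) k : R := knorm k `^ (2 * p).

Definition mode_ip v w k : R :=
  \sum_(r < d) (fcos (vcomp v r) k * fcos (vcomp w r) k + fsin (vcomp v r) k * fsin (vcomp w r) k).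

(** The real part of the inner product of index p; the imaginary part cancels
    between k and - k. *)
Definition rip (p : R) v w : R := ksum nonzero_modes (fun k => hweight p k * mode_ip v w k).

Lemma Re_cdot_coef v w k : field_cper v -> field_cper w ->
  Re (cdot (cconj (fourier_coef v k)) (fourier_coef w k)) = mode_ip v w k.
Proof. by move=> cv cw; rewrite Re_cdot; apply: eq_bigr => r _; rewrite !fourier_coefE. Qed.

Lemma Re_ip p v w : field_cper v -> field_cper w -> Re (ip p v w) = rip p v w.
Proof.
move=> cv cw; rewrite /ip /kcsum /=; apply: eq_ksum => k _.
by rewrite -Re_cdot_coef// -/(hweight p k); case: (cdot _ _) => a b /=; rewrite mul0r subr0.
Qed.

Lemma hnormE p v : field_cper v -> hnorm p v = Num.sqrt (rip p v v).
Proof. by move=> cv; rewrite /hnorm Re_ip. Qed.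

Lemma hweight_ge0 p k : 0 <= hweight p k.
Proof. exact: powR_ge0. Qed.

Lemma mode_ip_ge0 v k : 0 <= mode_ip v v k.
Proof. by apply: sumr_ge0 => r _; rewrite addr_ge0 -?expr2 ?sqr_ge0. Qed.

Lemma rip_ge0 p v : 0 <= rip p v v.
Proof. by apply: ksum_ge0 => k _; rewrite mulr_ge0 ?hweight_ge0 ?mode_ip_ge0. Qed.

Lemma hnorm_sqr p v : field_cper v -> hnorm p v ^+ 2 = rip p v v.
Proof. by move=> cv; rewrite hnormE// sqr_sqrtr// rip_ge0. Qed.

Definition finite_energy p v := absum nonzero_modes (fun k => hweight p k * mode_ip v v k).

Lemma sobolev_finiteE p v : field_cper v -> sobolev_finite p v <-> finite_energy p v.
Proof.
move=> cv; rewrite /sobolev_finite /finite_energy /absum.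
rewrite (@eq_esum _ _ _ _ (fun k => `|hweight p k * mode_ip v v k|%:E))// => k _.
by rewrite Re_cdot_coef// ger0_norm// mulr_ge0 ?hweight_ge0 ?mode_ip_ge0.
Qed.

(** One component of the real or imaginary part of the projected coefficient;
    the projection is a real matrix, so it acts on the two parts separately. *)
Definition leray_coef (a : 'I_d -> 'rV[int]_d -> R) r k : R :=
  a r k - (\sum_(s < d) (k ord0 s)%:~R * a s k) / ksqr k * (k ord0 r)%:~R.

Lemma intr_complex (z : int) : (z%:~R : R[i]) = (z%:~R)%:C.
Proof. by rewrite -(rmorph_int (real_complex R)). Qed.

Lemma leray_mode_coefE v k r : field_cper v ->
  leray_mode k (fourier_coef v k) ord0 r =
  leray_coef (fun s => fcos (vcomp v s)) r k +i* leray_coef (fun s => fsin (vcomp v s)) r k.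
Proof.
move=> cv; rewrite /leray_mode /leray_coef.
set kc : 'rV[R[i]]_d := map_mx _ _.
have kcE s : kc ord0 s = ((k ord0 s)%:~R)%:C by rewrite mxE intr_complex.
have -> : cdot kc kc = (ksqr k)%:C.
  rewrite /cdot /ksqr rmorph_sum; apply: eq_bigr => s _.
  by rewrite kcE -rmorphM expr2.
have -> : cdot kc (fourier_coef v k) =
    (\sum_(s < d) (k ord0 s)%:~R * fcos (vcomp v s) k) +i*
    (\sum_(s < d) (k ord0 s)%:~R * fsin (vcomp v s) k).
  apply/eqP; rewrite eq_complex /cdot Re_sum Im_sum /=; apply/andP; split; apply/eqP;
   by apply: eq_bigr => s _; rewrite fourier_coefE// kcE /=; ring.
rewrite mxE [(- _ : 'rV__) _ _]mxE [(_ *: _ : 'rV__) _ _]mxE kcE fourier_coefE// -fmorphV.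
by apply/eqP; rewrite eq_complex /=; apply/andP; split; apply/eqP; ring.
Qed.

Lemma vcomp_leray v r : field_cper v -> vcomp (leray v) r =
  fourier_series (leray_coef (fun s => fcos (vcomp v s)) r) (leray_coef (fun s => fsin (vcomp v s)) r).
Proof.
move=> cv; apply/funext => x; rewrite /vcomp /leray mxE /kcsum /=.
apply: eq_ksum => k _; rewrite leray_mode_coefE// /fourier_mode -/(phase k x) /= /fourier_term; ring.
Qed.

Lemma absum_sum (T : Type) (l : seq T) (D : set 'rV[int]_d) (F : T -> 'rV[int]_d -> R) :
  (forall i, absum D (F i)) -> absum D (fun k => \sum_(i <- l) F i k).
Proof.
move=> H; elim: l => [|i l IH].
  rewrite /absum esum1 ?ltry// => k _; by rewrite big_nil normr0.
rewrite (_ : (fun k => _) = (fun k => F i k + \sum_(j <- l) F j k)); first exact: absumD.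
by apply/funext => k; rewrite big_cons.
Qed.

(** The projection does not increase lengths, so each component is bounded by
    the sum of the absolute values of all components. *)
Lemma absum_leray_coef (a : 'I_d -> 'rV[int]_d -> R) r :
  (forall s, absum setT (a s)) -> absum setT (leray_coef a r).
Proof.
move=> sa.
have s' : absum setT (fun k => \sum_(s < d) `|a s k|).
  by apply: absum_sum => s; exact: absum_norm.
apply: absumD => //; apply: le_absum s' => k _.
rewrite normrN !normrM normfV (ger0_norm (ksqr_ge0 k)) [leRHS]ger0_norm; last exact: sumr_ge0.
have [k0|k0] := eqVneq (ksqr k) 0.
  by rewrite k0 invr0 mulr0 mul0r sumr_ge0.
have kp : 0 < ksqr k by rewrite lt_neqAle eq_sym k0 ksqr_ge0.
rewrite mulrAC ler_pdivrMr// mulr_suml.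
apply: (le_trans (ler_wpM2r _ (ler_norm_sum _ _ _))) => //.
rewrite mulr_suml; apply: ler_sum => s _; rewrite normrM mulrAC mulrC ler_wpM2l//.
have H t : `|(k ord0 t)%:~R : R| ^+ 2 <= ksqr k.
  rewrite real_normK ?num_real// /ksqr (bigD1 t)//= lerDl sumr_ge0// => i _.
  exact: sqr_ge0.
by have := H s; have := H r; move: `|_| `|_| => x y; nra.
Qed.

(** With e = 1 and e = - 1 this transfers evenness and oddness through the
    projection, as required for the coefficients of a real series. *)
Lemma leray_coefN (a : 'I_d -> 'rV[int]_d -> R) r k e :
  (forall s, a s (- k) = e * a s k) -> leray_coef a r (- k) = e * leray_coef a r k.
Proof.
move=> aN; rewrite /leray_coef aN.
have -> : ksqr (- k) = ksqr k by apply: eq_bigr => s _; rewrite mxE rmorphN sqrrN.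
have -> : \sum_(s < d) ((- k) ord0 s)%:~R * a s (- k) = - (e * \sum_(s < d) (k ord0 s)%:~R * a s k).
  by rewrite mulr_sumr -sumrN; apply: eq_bigr => s _; rewrite aN mxE rmorphN /=; ring.
rewrite mxE rmorphN /=; ring.
Qed.

Lemma fourier_leray v r k : smooth_per v ->
  [/\ cper (vcomp (leray v) r),
   fcos (vcomp (leray v) r) k = leray_coef (fun s => fcos (vcomp v s)) r k &
   fsin (vcomp (leray v) r) k = leray_coef (fun s => fsin (vcomp v s)) r k].
Proof.
move=> sv; have cv : field_cper v by move=> s; exact: smooth_per_cper.
rewrite vcomp_leray//.
have sa s : absum setT (fcos (vcomp v s)) by exact: (fourier_absum (sv _ s)).1.
have sb s : absum setT (fsin (vcomp v s)) by exact: (fourier_absum (sv _ s)).2.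
have Sa := absum_leray_coef r sa; have Sb := absum_leray_coef r sb.
split; first exact: cper_fourier_series.
  apply: (fourier_series_coef k Sa Sb _ _).1 => h.
    by rewrite (@leray_coefN _ _ _ 1) ?mul1r// => s; rewrite fcosN mul1r.
  by rewrite (@leray_coefN _ _ _ (-1)) ?mulN1r// => s; rewrite fsinN// mulN1r.
apply: (fourier_series_coef k Sa Sb _ _).2 => h.
  by rewrite (@leray_coefN _ _ _ 1) ?mul1r// => s; rewrite fcosN mul1r.
by rewrite (@leray_coefN _ _ _ (-1)) ?mulN1r// => s; rewrite fsinN// mulN1r.
Qed.

Lemma field_cper_bilP v w : smooth_per v -> smooth_per w -> field_cper (bilP v w).
Proof.
move=> sv sw r; have [c _ _] := fourier_leray r 0 (smooth_per_advect sv sw).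
by rewrite /bilP vcompN; apply: cperN.
Qed.

(** The projection removes a multiple of k from the coefficient of the
    advection term, and this multiple is orthogonal to the coefficient of a
    divergence-free field. *)
Lemma mode_ip_bilP u v w k : smooth_per u -> (forall x, divergence u x = 0) ->
  smooth_per v -> smooth_per w ->
  mode_ip u (bilP v w) k = - mode_ip u (advect v w) k.
Proof.
move=> su du sv sw; have sa := smooth_per_advect sv sw.
have [z1 z2] := fourier_divfree k su du.
set A := fun s => fcos (vcomp (advect v w) s).
set B := fun s => fsin (vcomp (advect v w) s).
pose cA := (\sum_(s < d) (k ord0 s)%:~R * A s k) / ksqr k.
pose cB := (\sum_(s < d) (k ord0 s)%:~R * B s k) / ksqr k.
transitivity (- mode_ip u (advect v w) k
   + (cA * \sum_(s < d) (k ord0 s)%:~R * fcos (vcomp u s) k +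
      cB * \sum_(s < d) (k ord0 s)%:~R * fsin (vcomp u s) k)); last first.
  by rewrite z1 z2 !mulr0 !addr0.
rewrite /mode_ip -sumrN !mulr_sumr -!big_split; apply: eq_bigr => r _ /=.
have [c e1 e2] := fourier_leray r k sa.
rewrite /bilP vcompN.
have [E1 E2] := fourierZ (-1) k c.
rewrite (_ : (fun x => - vcomp (leray (advect v w)) r x) = (fun x => -1 * vcomp (leray (advect v w)) r x)).
  by rewrite E1 E2 e1 e2 /leray_coef -/cA -/cB -/A -/B /A /B; ring.
by apply/funext => x; rewrite mulN1r.
Qed.

End Fields.

(** * The real inner products *)

Section Energy.
Context {R : realType} {d : nat}.
Implicit Types (u v w : vfield R d) (k h : 'rV[int]_d).

Lemma field_cper_lin a b v w : field_cper v -> field_cper w -> field_cper (a *: v + b *: w).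
Proof.
move=> cv cw r; rewrite vcomp_lin; have := cv r; have := cw r => c1 c2; solve_cper.
Qed.

Lemma mode_ipC v w k : mode_ip v w k = mode_ip w v k.
Proof. by apply: eq_bigr => r _; rewrite mulrC [fsin _ _ * _]mulrC. Qed.

Lemma mode_ip_linl a b u v w k : field_cper u -> field_cper v ->
  mode_ip (a *: u + b *: v) w k = a * mode_ip u w k + b * mode_ip v w k.
Proof.
move=> cu cv; rewrite /mode_ip !mulr_sumr -big_split; apply: eq_bigr => r _ /=.
have [e1 e2] := fourier_lin a b k (cu r) (cv r).
by rewrite vcomp_lin e1 e2; ring.
Qed.

Lemma mode_ip_norm v w k : `|mode_ip v w k| <= 2^-1 * (mode_ip v v k + mode_ip w w k).
Proof.
rewrite /mode_ip -big_split mulr_sumr; apply: (le_trans (ler_norm_sum _ _ _)).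
apply: ler_sum => r _ /=; move: (fcos _ _) (fcos _ _) (fsin _ _) (fsin _ _) => x y z t.
by rewrite ler_norml; apply/andP; split; have := sqr_ge0 (x - y); have := sqr_ge0 (x + y);
  have := sqr_ge0 (z - t); have := sqr_ge0 (z + t); nra.
Qed.

Lemma absum_ip p v w : finite_energy p v -> finite_energy p w ->
  absum nonzero_modes (fun k => hweight p k * mode_ip v w k).
Proof.
move=> fv fw.
have : absum nonzero_modes (fun k => 2^-1 * (hweight p k * mode_ip v v k + hweight p k * mode_ip w w k)).
  by apply: absumZ; apply: absumD.
apply: le_absum => k _; rewrite -mulrDr mulrCA [leRHS]ger0_norm; last first.
  by rewrite mulr_ge0 ?hweight_ge0// mulr_ge0// addr_ge0// mode_ip_ge0.
by rewrite normrM (ger0_norm (hweight_ge0 _ _)) ler_wpM2l ?hweight_ge0// mode_ip_norm.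
Qed.

Lemma ripC p v w : rip p v w = rip p w v.
Proof. by apply: eq_ksum => k _; rewrite mode_ipC. Qed.

Lemma finite_energy_lin p a b v w : field_cper v -> field_cper w ->
  finite_energy p v -> finite_energy p w -> finite_energy p (a *: v + b *: w).
Proof.
move=> cv cw fv fw.
have fvw := absum_ip fv fw.
have : absum nonzero_modes (fun k => a ^+ 2 * (hweight p k * mode_ip v v k) +
   ((a * b * 2) * (hweight p k * mode_ip v w k) + b ^+ 2 * (hweight p k * mode_ip w w k))).
  by apply: absumD; [exact: absumZ|apply: absumD; exact: absumZ].
apply: le_absum => k _; rewrite le_eqVlt; apply/orP; left; apply/eqP; congr (`| _ |).
rewrite mode_ip_linl// mode_ipC mode_ip_linl// [in X in _ + X]mode_ipC mode_ip_linl//.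
rewrite [mode_ip w v k]mode_ipC; ring.
Qed.

Lemma rip_linl p a b u v w : field_cper u -> field_cper v ->
  finite_energy p u -> finite_energy p v -> finite_energy p w ->
  rip p (a *: u + b *: v) w = a * rip p u w + b * rip p v w.
Proof.
move=> cu cv fu fv fw.
rewrite /rip -!ksumZ -ksumD; [|by apply: absumZ; exact: absum_ip..].
by apply: eq_ksum => k _; rewrite mode_ip_linl//; ring.
Qed.

Lemma rip_linr p a b u v w : field_cper u -> field_cper v ->
  finite_energy p u -> finite_energy p v -> finite_energy p w ->
  rip p w (a *: u + b *: v) = a * rip p w u + b * rip p w v.
Proof. by move=> *; rewrite ripC rip_linl// ![rip p _ w]ripC. Qed.

Lemma rip_quad p a b u v : field_cper u -> field_cper v ->
  finite_energy p u -> finite_energy p v ->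
  rip p (a *: u + b *: v) (a *: u + b *: v) =
  a ^+ 2 * rip p u u + 2 * (a * b) * rip p u v + b ^+ 2 * rip p v v.
Proof.
move=> cu cv fu fv; have fuv := finite_energy_lin a b cu cv fu fv.
rewrite rip_linl// !rip_linr// [rip p v u]ripC; ring.
Qed.

(** Discriminant of the nonnegative quadratic polynomial t |-> |u + t v|^2.
    When |v| = 0 the polynomial is affine, and the value chosen for t would
    make it equal to - 1 unless the inner product vanishes. *)
Lemma rip_CS p u v : field_cper u -> field_cper v ->
  finite_energy p u -> finite_energy p v ->
  `|rip p u v| <= Num.sqrt (rip p u u) * Num.sqrt (rip p v v).
Proof.
move=> cu cv fu fv.
have A0 := rip_ge0 p u; have C0 := rip_ge0 p v.
have Q t : 0 <= rip p u u + 2 * t * rip p u v + t ^+ 2 * rip p v v.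
  have := rip_ge0 p (1 *: u + t *: v); rewrite rip_quad//.
  by rewrite expr1n !mul1r.
rewrite -sqrtrM// -sqrtr_sqr; apply: ler_wsqrtr.
move: (rip p u u) (rip p v v) (rip p u v) A0 C0 Q => A C B A0 C0 Q.
have [C1|C1] := eqVneq C 0.
  have [->|B0] := eqVneq B 0; first by rewrite expr0n /= mulr_ge0.
  have := Q (- (A + 1) / (2 * B)); rewrite C1 mulr0 addr0.
  rewrite (_ : 2 * _ * B = - (A + 1)); last by field.
  lra.
have Cp : 0 < C by rewrite lt_neqAle eq_sym C1.
have := Q (- B / C).
rewrite (_ : _ + _ + _ = A - B ^+ 2 / C); last by field.
by rewrite subr_ge0 ler_pdivrMr.
Qed.

(** Derivative of |x(s)|^2 along a curve that is differentiable for the norm of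
    index p. With h = s - t and rho the error of the difference quotient,
    expand the square of x(t) + h (W + rho); the remainder is 2 <x(t), rho> + h
    |W + rho|^2 and is bounded by the function g below, which tends to zero. *)
Lemma rip_curve_derivative (p : R) (x : R -> vfield R d) (W : vfield R d) (D : set R) (t : R) :
  (forall s, D s -> field_cper (x s)) -> (forall s, D s -> finite_energy p (x s)) -> D t ->
  field_cper W -> finite_energy p W ->
  hnorm p ((s - t)^-1 *: (x s - x t) - W) @[s --> within D t^'] --> (0 : R) ->
  (s - t)^-1 * (rip p (x s) (x s) - rip p (x t) (x t)) @[s --> within D t^']
    --> 2 * rip p (x t) W.
Proof.
move=> cx fx Dt cW fW H.
have st : (s - t) @[s --> within D t^'] --> (0 : R).
  rewrite -(subrr t); apply: cvgB; last exact: cvg_cst.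
  apply: (@cvg_trans _ (s @[s --> t])); last exact: cvg_id.
  apply: cvg_fmap2; apply: (@cvg_trans _ t^'); first exact: cvg_within.
  exact: cvg_within.
pose r s := hnorm p ((s - t)^-1 *: (x s - x t) - W).
pose g s := 2 * Num.sqrt (rip p (x t) (x t)) * r s + `|s - t| * (2 * rip p W W + 2 * (r s * r s)).
have g0 : g s @[s --> within D t^'] --> (0 : R).
  rewrite (_ : 0 = 2 * Num.sqrt (rip p (x t) (x t)) * 0 + `|0 : R| * (2 * rip p W W + 2 * (0 * 0))); last first.
    by rewrite normr0 !mulr0 mul0r addr0.
  apply: cvgD; first by apply: cvgM; [exact: cvg_cst|exact: H].
  apply: cvgM; first exact: cvg_norm.
  apply: cvgD; first exact: cvg_cst.
  by apply: cvgM; [exact: cvg_cst|apply: cvgM; exact: H].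
apply/cvgrPdist_le => e e0.
move/cvgrPdist_le : g0 => /(_ e e0).
have Dn : \forall s \near within D t^', D s /\ s != t.
  rewrite near_withinE; apply: filterS (nbhs_dnbhs_neq t) => s st' Ds; by split.
apply: filterS2 Dn => s [Ds st']; rewrite sub0r normrN => ge.
apply: le_trans (le_trans (ler_norm _) ge).
have h0 : s - t != 0 by rewrite subr_eq0.
set h := s - t in h0 *.
set rho := h^-1 *: (x s - x t) - W.
have rhoE : rho = 1 *: (h^-1 *: x s + (- h^-1) *: x t) + (-1) *: W.
  by rewrite /rho scale1r scaleN1r scalerBr scaleNr.
have c1 := field_cper_lin h^-1 (- h^-1) (cx s Ds) (cx t Dt).
have f1 := finite_energy_lin h^-1 (- h^-1) (cx s Ds) (cx t Dt) (fx s Ds) (fx t Dt).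
have crho : field_cper rho by rewrite rhoE; exact: field_cper_lin.
have frho : finite_energy p rho by rewrite rhoE; exact: finite_energy_lin.
have cWr := field_cper_lin 1 1 cW crho.
have fWr := finite_energy_lin 1 1 cW crho fW frho.
have xsE : x s = 1 *: x t + h *: (1 *: W + 1 *: rho).
  rewrite !scale1r /rho [W + _]addrC subrK scalerA divff// scale1r addrC subrK//.
rewrite [in leLHS]xsE (rip_quad _ _ (cx t Dt) cWr (fx t Dt) fWr).
rewrite (rip_linr _ _ cW crho fW frho (fx t Dt)) (rip_quad _ _ cW crho fW frho).
have rE : rip p rho rho = r s * r s by rewrite -expr2 hnorm_sqr.
have CS := rip_CS (cx t Dt) crho (fx t Dt) frho.
have rs : Num.sqrt (rip p rho rho) = r s by rewrite /r hnormE.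
rewrite rs in CS.
have CS2 : `|rip p W rho| <= 2^-1 * (rip p W W + rip p rho rho).
  apply: (le_trans (rip_CS cW crho fW frho)).
  have := sqr_ge0 (Num.sqrt (rip p W W) - Num.sqrt (rip p rho rho)).
  have := sqr_sqrtr (rip_ge0 p W); have := sqr_sqrtr (rip_ge0 p rho).
  move: (Num.sqrt _) (Num.sqrt _) => a b; nra.
rewrite rE in CS2 *.
rewrite (_ : 2 * rip p (x t) W - _ = - (2 * rip p (x t) rho) - h * (rip p W W + 2 * rip p W rho + r s * r s)); last first.
  by field.
rewrite /g -/h; apply: (le_trans (ler_normB _ _)); rewrite normrN !normrM.
apply: lerD.
  by rewrite ger0_norm// -mulrA ler_pM2l// .
rewrite ler_wpM2l//.
have W0 := rip_ge0 p W; have r0 : 0 <= r s * r s by rewrite -expr2 sqr_ge0.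
by move: CS2; rewrite !ler_norml; lra.
Qed.

End Energy.

(** * Fourier inversion and multiplication by trigonometric polynomials *)

Section Inversion.
Context {R : realType} {d : nat} (d0 : (0 < d)%N).
Implicit Types (u v w : vfield R d) (k h : 'rV[int]_d) (f g : 'rV[R]_d -> R).
Local Notation N := ((2 * pi) `^ (- (d%:R / 2)) : R).

(** The function and its Fourier series are continuous with equal
    coefficients. *)
Lemma fourier_inversion f : Cper (2 * d) f -> forall x, f x = fourier_series (fcos f) (fsin f) x.
Proof.
move=> Cf x; have cf := Cper_cper Cf; have [sa sb] := fourier_absum Cf.
have cF := cper_fourier_series sa sb.
apply/eqP; rewrite -subr_eq0; apply/eqP.
apply: (@fourier_unique R d (fun x => f x - fourier_series (fcos f) (fsin f) x)) => // [|k|k].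
- exact: cperB.
- have [-> _] := fourierB k cf cF.
  by have [-> _] := fourier_series_coef k sa sb (fcosN f) (fun h => fsinN h cf); rewrite subrr.
- have [_ ->] := fourierB k cf cF.
  by have [_ ->] := fourier_series_coef k sa sb (fcosN f) (fun h => fsinN h cf); rewrite subrr.
Qed.

Definition spectrum_in (L : seq 'rV[int]_d) f :=
  forall k, k \notin L -> fcos f k = 0 /\ fsin f k = 0.

Lemma fourier_finite (L : seq 'rV[int]_d) f : uniq L -> Cper (2 * d) f -> spectrum_in L f ->
  forall x, f x = \sum_(h <- L) fourier_term (fcos f) (fsin f) h x.
Proof.
move=> uL Cf sL x; rewrite fourier_inversion//.
have H k : setT k -> k \notin L -> fourier_term (fcos f) (fsin f) k x = 0.
  by move=> _ kL; have [e1 e2] := sL k kL; rewrite /fourier_term e1 e2 !mul0r subrr.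
by have [_ E] := absum_finite uL (fun _ _ => Logic.I) H.
Qed.

Lemma parseval_finite (L : seq 'rV[int]_d) f : uniq L -> Cper (2 * d) f -> spectrum_in L f ->
  torus_int (fun x => f x ^+ 2) = \sum_(h <- L) (fcos f h ^+ 2 + fsin f h ^+ 2).
Proof.
move=> uL Cf sL; have cf := Cper_cper Cf.
rewrite (_ : (fun x => f x ^+ 2) = (fun x => \sum_(h <- L)
   (fcos f h * (f x * (N * cos (phase h x))) + (- fsin f h) * (f x * (N * sin (phase h x)))))).
  rewrite torus_int_sum => [|h _]; last by solve_cper.
  apply: eq_bigr => h _; rewrite torus_int_lin; [|by solve_cper..].
  by rewrite -/(fcos f h) mulNr -mulrN -/(fsin f h) !expr2.
apply/funext => x; rewrite expr2 {2}(fourier_finite uL Cf sL) mulr_sumr.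
by apply: eq_bigr => h _; rewrite /fourier_term; ring.
Qed.

Lemma spectrum_in_pd (L : seq 'rV[int]_d) f s : Cper 1 f -> spectrum_in L f -> spectrum_in L (pd s f).
Proof.
move=> Cf sL k kL; have [-> ->] := fourier_pd s k Cf; have [-> ->] := sL k kL.
by rewrite mulr0 oppr0.
Qed.

Definition coef_norm f k : R := `|fcos f k| + `|fsin f k|.

Lemma fourier_mul_mode f (a b : 'rV[int]_d -> R) h k : cper f ->
  fcos (fun x => f x * fourier_term a b h x) k = N / 2 *
    (a h * (fcos f (k + h) + fcos f (k - h)) + b h * (fsin f (k + h) - fsin f (k - h))) /\
  fsin (fun x => f x * fourier_term a b h x) k = N / 2 *
    (a h * (fsin f (k + h) + fsin f (k - h)) + b h * (fcos f (k - h) - fcos f (k + h))).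
Proof.
move=> cf.
have E (F : 'rV[R]_d -> R) (c1 c2 c3 c4 : R) :
   (forall x, F x = c1 * (f x * cos (phase (k + h) x)) + c2 * (f x * cos (phase (k - h) x)) +
     (c3 * (f x * sin (phase (k + h) x)) + c4 * (f x * sin (phase (k - h) x)))) ->
   torus_int F = c1 * torus_int (fun x => f x * cos (phase (k + h) x)) +
      c2 * torus_int (fun x => f x * cos (phase (k - h) x)) +
     (c3 * torus_int (fun x => f x * sin (phase (k + h) x)) +
      c4 * torus_int (fun x => f x * sin (phase (k - h) x))).
  move=> /funext ->; rewrite torus_intD; [|by solve_cper..].
  by rewrite !torus_int_lin; [|by solve_cper..].
have cf' : cper (fun x => f x * fourier_term a b h x).
  by apply: cperM => //; exact: cper_fourier_term.
rewrite !(fcosE _ cf') !(fsinE _ cf') !(fcosE _ cf) !(fsinE _ cf); split.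
  rewrite (E _ (a h * N / 2) (a h * N / 2) (- (b h * N / 2)) (b h * N / 2)).
    by field.
  move=> x; rewrite /fourier_term !phaseD !phaseN.
  by rewrite !cosD !sinD cosN sinN; field.
rewrite (E _ (b h * N / 2) (- (b h * N / 2)) (a h * N / 2) (a h * N / 2)).
  by field.
move=> x; rewrite /fourier_term !phaseD !phaseN.
by rewrite !cosD !sinD cosN sinN; field.
Qed.

(** Multiplication by a mode of frequency h moves every coefficient to the two
    neighbours at distance h. *)
Lemma coef_norm_mul_mode f (a b : 'rV[int]_d -> R) h k : cper f ->
  coef_norm (fun x => f x * fourier_term a b h x) k <=
   N * (`|a h| + `|b h|) * (coef_norm f (k + h) + coef_norm f (k - h)).
Proof.
move=> cf; have N0 : 0 < N by exact: mode_norm_gt0.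
rewrite /coef_norm; have [-> ->] := fourier_mul_mode a b h k cf.
rewrite !normrM (gtr0_norm N0) [`|2^-1|]gtr0_norm ?invr_gt0//.
rewrite -mulrDr -mulrA -mulrA ler_pM2l//.
have H (x1 x2 y1 y2 : R) : `|a h * (x1 + x2) + b h * (y1 - y2)| <=
    `|a h| * (`|x1| + `|x2|) + `|b h| * (`|y1| + `|y2|).
  apply: (le_trans (ler_normD _ _)); rewrite !normrM lerD// ler_wpM2l//.
    exact: ler_normD.
  exact: ler_normB.
have h1 := H (fcos f (k + h)) (fcos f (k - h)) (fsin f (k + h)) (fsin f (k - h)).
have h2 := H (fsin f (k + h)) (fsin f (k - h)) (fcos f (k - h)) (fcos f (k + h)).
have n1 := normr_ge0 (a h); have n2 := normr_ge0 (b h).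
have n3 := normr_ge0 (fcos f (k + h)); have n4 := normr_ge0 (fcos f (k - h)).
have n5 := normr_ge0 (fsin f (k + h)); have n6 := normr_ge0 (fsin f (k - h)).
rewrite mulrC ler_pdivrMr//.
apply: (le_trans (lerD h1 h2)).
move: n1 n2 n3 n4 n5 n6; move: `|a h| `|b h| `|fcos f (k + h)| `|fcos f (k - h)| `|fsin f (k + h)| `|fsin f (k - h)|.
move=> a1 b1 x y z t *.
have -> : (a1 + b1) * (x + z + (y + t)) * 2 = a1 * (x + y) + b1 * (z + t) +
   (a1 * (z + t) + b1 * (y + x)) + (a1 + b1) * (x + y + z + t) by ring.
by rewrite lerDl mulr_ge0 ?addr_ge0.
Qed.

Lemma coef_norm_ge0 f k : 0 <= coef_norm f k.
Proof. by rewrite addr_ge0. Qed.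

Lemma coef_norm_sum (T : Type) (r : seq T) (F : T -> 'rV[R]_d -> R) k :
  (forall i, cper (F i)) ->
  coef_norm (fun x => \sum_(i <- r) F i x) k <= \sum_(i <- r) coef_norm (F i) k.
Proof.
move=> cF; rewrite /coef_norm; have [-> ->] := fourier_sum r k cF.
by rewrite big_split lerD// ler_norm_sum.
Qed.

Lemma coef_norm_mul_finite (L : seq 'rV[int]_d) g : uniq L -> Cper (2 * d) g -> spectrum_in L g ->
  exists C, 0 <= C /\ forall f k, cper f ->
   coef_norm (fun x => f x * g x) k <= C * \sum_(h <- L ++ map (fun h => - h) L) coef_norm f (k + h).
Proof.
move=> uL Cg sL; have N0 : 0 < N by exact: mode_norm_gt0.
pose C := \sum_(h <- L) (N * (`|fcos g h| + `|fsin g h|)).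
have C0 : 0 <= C by apply: sumr_ge0 => h _; rewrite mulr_ge0 ?addr_ge0// ltW.
exists C; split => // f k cf.
rewrite (_ : (fun x => f x * g x) = (fun x => \sum_(h <- L) f x * fourier_term (fcos g) (fsin g) h x)); last first.
  by apply/funext => x; rewrite [in LHS](fourier_finite uL Cg sL) mulr_sumr.
apply: (le_trans (coef_norm_sum _ _ _)).
  by move=> h; apply: cperM => //; exact: cper_fourier_term.
rewrite big_cat big_map /= -big_split mulr_sumr /=.
rewrite !big_seq; apply: ler_sum => h hL.
apply: (le_trans (coef_norm_mul_mode _ _ _ _ cf)).
apply: ler_wpM2r; first by rewrite addr_ge0// coef_norm_ge0.
rewrite /C; have : uniq L by []. 
move=> /(bigD1_seq h hL) ->; rewrite lerDl sumr_ge0// => j _.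
by rewrite mulr_ge0 ?addr_ge0// ltW.
Qed.

End Inversion.

(** * Shifts of Sobolev weights *)

Section ShiftSums.
Context {R : realType} {d : nat}.
Notation K := 'rV[int]_d.
Implicit Types (k h : K).

Lemma ksum_sum (T : Type) (r : seq T) (D : set K) (F : T -> K -> R) :
  (forall i, absum D (F i)) ->
  ksum D (fun k => \sum_(i <- r) F i k) = \sum_(i <- r) ksum D (F i).
Proof.
move=> sF; elim: r => [|i r IH].
  rewrite big_nil -[RHS](mul0r (ksum D (fun=> 0))) -ksumZ.
  by apply: eq_ksum => k _; rewrite big_nil mul0r.
rewrite big_cons -IH -ksumD//; last exact: absum_sum.
by apply: eq_ksum => k _; rewrite big_cons.
Qed.

(** Shifting is a bijection of the lattice; the vanishing of g at 0 makes the
    omitted index 0 harmless. *)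
Lemma ksum_shift_le (g : K -> R) h : (forall k, 0 <= g k) -> g 0 = 0 ->
  absum nonzero_modes g ->
  absum nonzero_modes (fun k => g (k + h)) /\
  ksum nonzero_modes (fun k => g (k + h)) <= ksum nonzero_modes g.
Proof.
move=> g0 gz sg.
have H : (\esum_(k in nonzero_modes) (g (k + h))%:E <= \esum_(k in nonzero_modes) (g k)%:E)%E.
  rewrite esum_mkcond.
  have -> : (\esum_(k in nonzero_modes) (g k)%:E = \esum_(k in setT) (g k)%:E)%E.
    rewrite esum_mkcond; apply: eq_esum => k _; case: ifPn => //.
    by rewrite notin_setE /nonzero_modes /= => /negP; rewrite negbK => /eqP ->; rewrite gz.
  have bij : set_bij setT setT (fun k => k + h).
    split => // [k1 k2 _ _ /addIr //|k _]; by exists (k - h) => //; rewrite subrK.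
  rewrite (@reindex_esum R K K setT setT (fun k => k + h) (fun k => (g k)%:E) bij).
  by apply: le_esum => k _; case: ifP => // _; rewrite lee_fin.
have absE (u : K -> R) : (forall k, 0 <= u k) ->
    (\esum_(k in nonzero_modes) `|u k|%:E = \esum_(k in nonzero_modes) (u k)%:E)%E.
  by move=> u0; apply: eq_esum => k _; rewrite ger0_norm.
have s1 : absum nonzero_modes (fun k => g (k + h)).
  by rewrite /absum absE//; apply: le_lt_trans H _; rewrite -absE.
split => //.
rewrite !ksum_nneg//; apply: fine_le => //.
  by rewrite ge0_fin_numE ?esum_ge0// => [|k _]; [rewrite -absE|rewrite lee_fin].
by rewrite ge0_fin_numE ?esum_ge0// => [|k _]; [rewrite -absE|rewrite lee_fin].
Qed.

(** The constant is that of a plain induction; what matters is its independence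
    of the x i. *)
Lemma sqr_sum_le (T : Type) (r : seq T) (x : T -> R) :
  (\sum_(i <- r) x i) ^+ 2 <= 2 ^+ size r * \sum_(i <- r) x i ^+ 2.
Proof.
elim: r => [|i r IH]; first by rewrite !big_nil expr0n mulr0.
rewrite !big_cons /= [2 ^+ _.+1]exprS.
have Q0 : 0 <= \sum_(j <- r) x j ^+ 2 by apply: sumr_ge0 => j _; exact: sqr_ge0.
have p1 : 1 <= 2 ^+ size r :> R by rewrite exprn_ege1// ler1n.
move: (2 ^+ size r) (\sum_(j <- r) x j) (\sum_(j <- r) x j ^+ 2) (x i) p1 Q0 IH => P S Q y p1 Q0 IH.
have := sqr_ge0 (y - S); have := sqr_ge0 y => y2 y3.
have : 0 <= (P - 1) * y ^+ 2 by rewrite mulr_ge0// subr_ge0.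
nra.
Qed.

Lemma ksqr_shift k h : ksqr k <= 2 * ksqr (k + h) + 2 * ksqr h :> R.
Proof.
rewrite /ksqr !mulr_sumr -big_split; apply: ler_sum => s _ /=.
rewrite mxE rmorphD /=; move: (_%:~R) (_%:~R) => x y.
have := sqr_ge0 (y + 2 * x); nra.
Qed.

Lemma ksqr_ge1 k : k != 0 -> 1 <= ksqr k :> R.
Proof.
move=> k0.
have [s ks] : exists s, k ord0 s != 0.
  apply/existsP; apply: contraT; rewrite negb_exists => /forallP H.
  by case/eqP: k0; apply/rowP => s; rewrite mxE; apply/eqP; have := H s; rewrite negbK.
rewrite /ksqr (bigD1 s)//=; apply: (@le_trans _ _ ((k ord0 s)%:~R ^+ 2)).
  rewrite -rmorphXn /= -[leLHS]/(1%:~R) ler_int; move: (k _ _) ks => z.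
  by rewrite expr2; nia.
by rewrite lerDl sumr_ge0// => i _; exact: sqr_ge0.
Qed.

Lemma hweightE (p : R) k : hweight p k = ksqr k `^ p.
Proof.
rewrite /hweight powRrM /knorm -/(ksqr k) (powR_mulrn 2) ?sqrtr_ge0//.
by rewrite sqr_sqrtr// ksqr_ge0.
Qed.

(** From |k|^2 <= 2 |k + h|^2 + 2 |h|^2 and |k + h| >= 1. The nonnegativity of
    p makes the power monotone. *)
Lemma hweight_shift (p : R) k h : 0 <= p -> k + h != 0 ->
  hweight p k <= (2 + 2 * ksqr h) `^ p * hweight p (k + h).
Proof.
move=> p0 kh; rewrite !hweightE -powRM ?ksqr_ge0//; last first.
  by rewrite addr_ge0// mulr_ge0 ?ksqr_ge0.
apply: ge0_ler_powR => //; rewrite ?nnegrE ?ksqr_ge0//.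
  by rewrite mulr_ge0 ?ksqr_ge0// addr_ge0// mulr_ge0 ?ksqr_ge0.
apply: (le_trans (ksqr_shift k h)); have := ksqr_ge1 kh; have := @ksqr_ge0 R d h.
move: (ksqr _) (ksqr _) => x y; nra.
Qed.

End ShiftSums.

(** * Eigenfields of the Laplacian *)

Section Eigenfields.
Context {R : realType} {d : nat} (d0 : (0 < d)%N).
Implicit Types (u v w : vfield R d) (k h : 'rV[int]_d).

(** On coefficients the eigenvalue equation says (|k|^2 - kappa^2) v_k = 0, so
    v_k vanishes off the finitely many lattice points of the sphere of radius
    kappa. *)
Lemma eigen_spectrum (kappa : R) v : 0 <= kappa -> smooth_per v ->
  laplacian v = - kappa ^+ 2 *: v ->
  exists L, [/\ uniq L, (forall h, h \in L -> ksqr h = kappa ^+ 2) &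
    forall r, spectrum_in L (vcomp v r)].
Proof.
move=> kap0 sv lap.
pose M := Num.bound kappa.
have kM : kappa < M%:R by exact: archi_boundP.
exists [seq k <- box M | ksqr k == kappa ^+ 2]; split.
- by rewrite filter_uniq// box_uniq.
- by move=> h; rewrite mem_filter => /andP[/eqP].
move=> r k kL.
have kk : ksqr k != kappa ^+ 2 :> R.
  apply/eqP => kk; move: kL; rewrite mem_filter kk eqxx /= => /negP; apply.
  apply: mem_box => s.
  rewrite -(ler_int R) intr_norm.
  have : `|(k ord0 s)%:~R : R| <= kappa.
    rewrite -(ler_pXn2r (n := 2))// ?nnegrE// real_normK ?num_real// -kk /ksqr (bigD1 s)//=.
    by rewrite lerDl sumr_ge0// => i _; exact: sqr_ge0.
  by move=> h; rewrite (le_trans h)// -pmulrn ltW.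
have cv := smooth_per_cper r sv.
have [e1 e2] := fourier_laplacian r k sv.
have [z1 z2] := fourierZ (- kappa ^+ 2) k cv.
rewrite lap vcompZ z1 in e1; rewrite lap vcompZ z2 in e2.
have nz : ksqr k - kappa ^+ 2 != 0 :> R by rewrite subr_eq0.
split; apply: (mulfI nz); rewrite mulr0 mulrBl.
  by move: e1; lra.
by move: e2; lra.
Qed.

Lemma l2norm_sqr (L : seq 'rV[int]_d) v : uniq L -> smooth_per v ->
  (forall r, spectrum_in L (vcomp v r)) ->
  l2norm v ^+ 2 = \sum_(h <- L) mode_ip v v h.
Proof.
move=> uL sv sL.
have E : torus_int (fun x => \sum_(r < d) v x ord0 r ^+ 2) = \sum_(h <- L) mode_ip v v h.
  rewrite torus_int_sum => [|r _]; last by have := smooth_per_cper r sv => c; exact: cperX.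
  rewrite exchange_big; apply: eq_bigr => r _.
  rewrite -[LHS]/(torus_int (fun x => vcomp v r x ^+ 2)) (parseval_finite d0 uL (sv _ r) (sL r)).
  by apply: eq_bigr => h _; rewrite !expr2.
rewrite /l2norm sqr_sqrtr E// sumr_ge0// => h _; exact: mode_ip_ge0.
Qed.

Lemma rip_eigen (kappa p : R) v : 1 <= kappa -> smooth_per v ->
  laplacian v = - kappa ^+ 2 *: v ->
  finite_energy p v /\ rip p v v = kappa `^ (2 * p) * l2norm v ^+ 2.
Proof.
move=> k1 sv lap; have k0 : 0 <= kappa by rewrite (le_trans ler01).
have [L [uL Lk sL]] := eigen_spectrum k0 sv lap.
have nz h : h \in L -> nonzero_modes h.
  move=> /Lk; rewrite /nonzero_modes /=; apply: contra_eq_neq => ->.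
  rewrite /ksqr big1 => [|s _]; last by rewrite mxE expr0n.
  by rewrite eq_sym gt_eqF// exprn_gt0// (lt_le_trans ltr01).
have z k : nonzero_modes k -> k \notin L -> hweight p k * mode_ip v v k = 0.
  move=> _ kL; rewrite /mode_ip big1 ?mulr0// => r _.
  by have [-> ->] := sL r k kL; rewrite !mulr0 addr0.
have [f E] := absum_finite uL nz z; split => //.
rewrite /rip E (l2norm_sqr uL sv sL) mulr_sumr !big_seq; apply: eq_bigr => h /Lk hk.
by rewrite hweightE hk powRrM (powR_mulrn 2).
Qed.

(** The k-th coefficient of (v . grad) w is bounded by the coefficients of v at
    finitely many shifts k + h, with h in the spectrum of w or its opposite,
    because the derivatives of w are trigonometric polynomials. Square,
    multiply by the weight at k, compare it with the weight at k + h, and sum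
    over k. No derivative of v occurs, which is why the same index p stands on
    both sides. *)
Lemma advect_trig_bound (p : R) (L : seq 'rV[int]_d) w : 0 <= p -> uniq L -> smooth_per w ->
  (forall r, spectrum_in L (vcomp w r)) ->
  exists C, 0 <= C /\ forall v, smooth_per v -> mean_zero v -> finite_energy p v ->
    finite_energy p (advect v w) /\ rip p (advect v w) (advect v w) <= C * rip p v v.
Proof.
move=> p0 uL sw sL.
set L' := L ++ map (fun h => - h) L.
have [C [C0 HC]] : exists C, 0 <= C /\ forall s r f k, cper f ->
   coef_norm (fun x => f x * pd s (vcomp w r) x) k <= C * \sum_(h <- L') coef_norm f (k + h).
  have H (i : 'I_d * 'I_d) : exists c, 0 <= c /\ forall f k, cper f ->
     coef_norm (fun x => f x * pd i.1 (vcomp w i.2) x) k <= c * \sum_(h <- L') coef_norm f (k + h).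
    apply: (coef_norm_mul_finite d0 uL).
      by have [] := smooth_per_pd i.2 i.1 (2 * d) sw.
    by apply: spectrum_in_pd => //; exact: sw.
  have [c Hc] := boolp.choice H.
  exists (\sum_i c i); split; first by apply: sumr_ge0 => i _; exact: (Hc i).1.
  move=> s r f k cf; apply: (le_trans ((Hc (s, r)).2 f k cf)).
  apply: ler_wpM2r; first by apply: sumr_ge0 => h _; exact: coef_norm_ge0.
  by rewrite (bigD1 (s, r))//= lerDl sumr_ge0// => i _; exact: (Hc i).1.
(* The powers of two come from squaring the sums over s and over h, the factor
   2 from squaring [coef_norm], and d counts the components r. *)
pose C2 : R := d%:R * (C ^+ 2 * (2 ^+ d * (2 ^+ size L' * 2))).
have C20 : 0 <= C2 by rewrite !mulr_ge0// ?exprn_ge0.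
have B v k : smooth_per v ->
    mode_ip (advect v w) (advect v w) k <= C2 * \sum_(h <- L') mode_ip v v (k + h).
  move=> sv.
  have Br r : fcos (vcomp (advect v w) r) k * fcos (vcomp (advect v w) r) k +
      fsin (vcomp (advect v w) r) k * fsin (vcomp (advect v w) r) k <=
      C ^+ 2 * (2 ^+ d * (2 ^+ size L' * 2)) * \sum_(h <- L') mode_ip v v (k + h).
    rewrite vcomp_advect//.
    set F := fun x => _.
    apply: (@le_trans _ _ (coef_norm F k ^+ 2)).
      rewrite /coef_norm sqrrD !real_normK ?num_real// !expr2.
      have := mulr_ge0 (normr_ge0 (fcos F k)) (normr_ge0 (fsin F k)); lra.
    apply: (@le_trans _ _ ((C * \sum_(s < d) \sum_(h <- L') coef_norm (vcomp v s) (k + h)) ^+ 2)).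
      have CS : coef_norm F k <= C * \sum_(s < d) \sum_(h <- L') coef_norm (vcomp v s) (k + h).
        apply: (le_trans (coef_norm_sum _ _ _)).
          move=> s; have c1 := smooth_per_cper s sv.
          have [_ /Cper_cper c2] := smooth_per_pd r s 0 sw; solve_cper.
        rewrite mulr_sumr; apply: ler_sum => s _; apply: HC; exact: smooth_per_cper.
      by rewrite lerXn2r// nnegrE ?coef_norm_ge0// (le_trans _ CS)// coef_norm_ge0.
    rewrite exprMn [leRHS](_ : _ = C ^+ 2 * (2 ^+ d * (2 ^+ size L' * (2 * \sum_(h <- L') mode_ip v v (k + h))))); last by ring.
    apply: ler_wpM2l; first exact: sqr_ge0.
    apply: (le_trans (sqr_sum_le _ _)).
    rewrite [size _](_ : _ = d); last by rewrite -sum1_size sum_nat_const card_ord muln1.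
    apply: ler_wpM2l; first exact: exprn_ge0.
    apply: (@le_trans _ _ (\sum_(s < d) 2 ^+ size L' * \sum_(h <- L') coef_norm (vcomp v s) (k + h) ^+ 2)).
      by apply: ler_sum => s _; exact: sqr_sum_le.
    rewrite -mulr_sumr; apply: ler_wpM2l; first exact: exprn_ge0.
    rewrite exchange_big mulr_sumr; apply: ler_sum => h _ /=.
    rewrite /mode_ip mulr_sumr; apply: ler_sum => s _.
    rewrite /coef_norm; have := sqr_ge0 (`|fcos (vcomp v s) (k + h)| - `|fsin (vcomp v s) (k + h)|).
    rewrite sqrrB sqrrD !real_normK ?num_real// !expr2.
    by lra.
  apply: (le_trans (ler_sum _ (fun r _ => Br r))).
  by rewrite sumr_const card_ord -[leLHS]mulr_natl [leLHS]mulrA.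
pose c (h : 'rV[int]_d) : R := (2 + 2 * ksqr h) `^ p.
have c0 h : 0 <= c h by exact: powR_ge0.
exists (C2 * \sum_(h <- L') c h); split.
  by rewrite mulr_ge0// sumr_ge0.
move=> v sv mz fv.
pose g k := hweight p k * mode_ip v v k.
have g0 k : 0 <= g k by rewrite mulr_ge0 ?hweight_ge0 ?mode_ip_ge0.
(* The mean value of v must vanish, since a shift may move the index 0, which
   the norms ignore, to a nonzero k. *)
have mz0 : mode_ip v v 0 = 0.
  rewrite /mode_ip big1// => r _.
  by have [-> ->] := fourier_mean_zero r sv mz; rewrite !mulr0 addr0.
have gz : g 0 = 0 by rewrite /g mz0 mulr0.
have G h := ksum_shift_le h g0 gz fv.
have pt k : nonzero_modes k -> hweight p k * mode_ip (advect v w) (advect v w) k <=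
    C2 * \sum_(h <- L') c h * g (k + h).
  move=> k0; apply: (@le_trans _ _ (hweight p k * (C2 * \sum_(h <- L') mode_ip v v (k + h)))).
    by apply: ler_wpM2l; [exact: hweight_ge0|exact: B].
  rewrite mulrCA; apply: ler_wpM2l => //.
  rewrite mulr_sumr; apply: ler_sum => h _.
  have [->|kh] := eqVneq (k + h) 0; first by rewrite mz0 gz !mulr0.
  rewrite /g mulrA; apply: ler_wpM2r; first exact: mode_ip_ge0.
  exact: hweight_shift.
have sG h : absum nonzero_modes (fun k => c h * g (k + h)) by apply: absumZ; exact: (G h).1.
have sS : absum nonzero_modes (fun k => C2 * \sum_(h <- L') c h * g (k + h)).
  by apply: absumZ; exact: absum_sum.
have fa : finite_energy p (advect v w).
  apply: le_absum sS => k k0; rewrite ger0_norm; last first.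
    by rewrite mulr_ge0 ?hweight_ge0 ?mode_ip_ge0.
  by rewrite (le_trans (pt k k0))// ler_norm.
split => //.
apply: (@le_trans _ _ (ksum nonzero_modes (fun k => C2 * \sum_(h <- L') c h * g (k + h)))).
  exact: le_ksum.
rewrite ksumZ -[leRHS]mulrA; apply: ler_wpM2l => //.
rewrite ksum_sum// mulr_suml; apply: ler_sum => h _.
by rewrite ksumZ; apply: ler_wpM2l => //; exact: (G h).2.
Qed.

End Eigenfields.

(** * Smooth divergence-free fields *)

Section Hinf.
Context {R : realType} {d : nat}.
Implicit Types (u v w : vfield R d) (k h : 'rV[int]_d).

Lemma in_Hinf_smooth_per v : in_Hinf v -> smooth_per v.
Proof. by move=> [sv /(_ 0) [_ pv _ _ _]]; exact: smooth_field_per. Qed.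

Lemma in_Hinf_cper v : in_Hinf v -> field_cper v.
Proof. by move=> /in_Hinf_smooth_per sv r; exact: smooth_per_cper. Qed.

Lemma in_Hinf_divfree v : in_Hinf v -> forall x, divergence v x = 0.
Proof. by move=> [_ /(_ 0) []]. Qed.

Lemma in_Hinf_mean_zero v : in_Hinf v -> mean_zero v.
Proof. by move=> [_ /(_ 0) []]. Qed.

Lemma in_Hinf_energy v p : in_Hinf v -> finite_energy p v.
Proof.
by move=> Hv; apply/(sobolev_finiteE p (in_Hinf_cper Hv)); case: Hv => _ /(_ p) [].
Qed.

Lemma partial_lin s a b v w : (forall x, derivable v x (basis_vec s)) ->
  (forall x, derivable w x (basis_vec s)) ->
  (forall x, derivable (a *: v + b *: w) x (basis_vec s)) /\
  partial s (a *: v + b *: w) = a *: partial s v + b *: partial s w.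
Proof.
move=> dv dw; split; first by move=> x; apply: derivableD; exact: derivableZ.
apply/funext => x; rewrite /partial deriveD; [|exact: derivableZ..].
by rewrite !deriveZ.
Qed.

Lemma C1_field_lin a b v w : C1_field v -> C1_field w -> C1_field (a *: v + b *: w).
Proof.
have cl (f g : vfield R d) : continuous f -> continuous g -> continuous (a *: f + b *: g).
  have cZ (c : R) (u : vfield R d) : continuous u -> continuous (fun y => c *: u y).
    by move=> cu y; apply: (@continuous_comp _ _ _ u (fun M => c *: M)); [exact: cu|exact: scaler_continuous].
  by move=> cf cg x; apply: (@continuousD _ _ _ (fun y => a *: f y) (fun y => b *: g y)); exact: cZ.
move=> [cv dv] [cw dw]; split; first exact: cl.
move=> s; have [d1 c1] := dv s; have [d2 c2] := dw s.
have [d3 ->] := partial_lin a b d1 d2; split; [exact: d3|exact: cl].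
Qed.

Lemma smooth_field_lin a b v w : smooth_field v -> smooth_field w -> smooth_field (a *: v + b *: w).
Proof.
move=> sv sw l.
have -> : iter_partial l (a *: v + b *: w) = a *: iter_partial l v + b *: iter_partial l w.
  elim: l => //= s l IH; rewrite IH.
  have [_ /(_ s) [d1 _]] := sv l; have [_ /(_ s) [d2 _]] := sw l.
  by have [_ ->] := partial_lin a b d1 d2.
exact: C1_field_lin.
Qed.

Lemma in_Hinf_lin a b v w : in_Hinf v -> in_Hinf w -> in_Hinf (a *: v + b *: w).
Proof.
move=> Hv Hw; have [sv Iv] := Hv; have [sw Iw] := Hw.
split; first exact: smooth_field_lin.
move=> p; have [c1 p1 dv1 m1 f1] := Iv p; have [c2 p2 dv2 m2 f2] := Iw p.
have cv := in_Hinf_cper Hv; have cw := in_Hinf_cper Hw.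
split.
- exact: C1_field_lin.
- by move=> s x; rewrite !fctE p1 p2.
- move=> x; transitivity (a * divergence v x + b * divergence w x); last first.
    by rewrite dv1 dv2 !mulr0 addr0.
  rewrite /divergence !mulr_sumr -big_split; apply: eq_bigr => s _ /=.
  have [_ ->] := partial_lin a b (c1.2 s).1 (c2.2 s).1.
  by rewrite !mxE.
- move=> r; transitivity (a * torus_int (vcomp v r) + b * torus_int (vcomp w r)).
    by rewrite -torus_int_lin// -vcomp_lin.
  by rewrite [torus_int _]m1 [torus_int (vcomp w r)]m2 !mulr0 addr0.
- apply/(sobolev_finiteE p (field_cper_lin a b cv cw)).
  by apply: finite_energy_lin => //; exact: in_Hinf_energy.
Qed.

Lemma in_HinfZ a v : in_Hinf v -> in_Hinf (a *: v).
Proof. by move=> Hv; have := in_Hinf_lin a 0 Hv Hv; rewrite scale0r addr0. Qed.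

Lemma in_HinfB v w : in_Hinf v -> in_Hinf w -> in_Hinf (v - w).
Proof. by move=> Hv Hw; have := in_Hinf_lin 1 (-1) Hv Hw; rewrite scale1r scaleN1r. Qed.

Lemma partialD_smooth s v w : smooth_per v -> smooth_per w ->
  partial s (v + w) = partial s v + partial s w.
Proof.
move=> sv sw; have dv y : derivable v y (basis_vec s) by exact: smooth_per_derivable.
have dw y : derivable w y (basis_vec s) by exact: smooth_per_derivable.
by have [_] := partial_lin 1 1 dv dw; rewrite !scale1r.
Qed.

Lemma partialZ_smooth s a v : smooth_per v -> partial s (a *: v) = a *: partial s v.
Proof.
move=> sv; have dv y : derivable v y (basis_vec s) by exact: smooth_per_derivable.
by have [_] := partial_lin a 0 dv dv; rewrite !scale0r !addr0.
Qed.

Lemma advectDl u v w : advect (u + v) w = advect u w + advect v w.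
Proof.
apply/funext => x; rewrite -[RHS]/(advect u w x + advect v w x) /advect -big_split.
by apply: eq_bigr => s _ /=; rewrite mxE scalerDl.
Qed.

Lemma advectZl a u w : advect (a *: u) w = a *: advect u w.
Proof.
apply/funext => x; rewrite -[RHS]/(a *: advect u w x) /advect scaler_sumr.
by apply: eq_bigr => s _ /=; rewrite mxE scalerA.
Qed.

Lemma advectDr u v w : smooth_per v -> smooth_per w -> advect u (v + w) = advect u v + advect u w.
Proof.
move=> sv sw; apply/funext => x; rewrite -[RHS]/(advect u v x + advect u w x) /advect -big_split.
by apply: eq_bigr => s _ /=; rewrite partialD_smooth// -scalerDr.
Qed.

Lemma advectZr a u v : smooth_per v -> advect u (a *: v) = a *: advect u v.
Proof.
move=> sv; apply/funext => x; rewrite -[RHS]/(a *: advect u v x) /advect scaler_sumr.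
by apply: eq_bigr => s _ /=; rewrite partialZ_smooth// !scalerA mulrC.
Qed.

Lemma laplacianZ a v : smooth_per v -> laplacian (a *: v) = a *: laplacian v.
Proof.
move=> sv; apply/funext => x; rewrite -[RHS]/(a *: laplacian v x) /laplacian scaler_sumr.
by apply: eq_bigr => s _; rewrite !partialZ_smooth//; exact: smooth_per_partial.
Qed.

Lemma laplacianD v w : smooth_per v -> smooth_per w -> laplacian (v + w) = laplacian v + laplacian w.
Proof.
move=> sv sw; apply/funext => x; rewrite -[RHS]/(laplacian v x + laplacian w x) /laplacian -big_split.
by apply: eq_bigr => s _ /=; rewrite !partialD_smooth//; exact: smooth_per_partial.
Qed.

Lemma smooth_per_lin a b v w : smooth_per v -> smooth_per w -> smooth_per (a *: v + b *: w).
Proof. by move=> sv sw n r; rewrite vcomp_lin; apply: Cper_lin; [exact: sv|exact: sw]. Qed.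

Lemma smooth_perZ a v : smooth_per v -> smooth_per (a *: v).
Proof. by move=> sv; have := smooth_per_lin a 0 sv sv; rewrite scale0r addr0. Qed.

Lemma field_cperB v w : field_cper v -> field_cper w -> field_cper (v - w).
Proof. by move=> cv cw; have := field_cper_lin 1 (-1) cv cw; rewrite scale1r scaleN1r. Qed.

Lemma field_cperD v w : field_cper v -> field_cper w -> field_cper (v + w).
Proof. by move=> cv cw; have := field_cper_lin 1 1 cv cw; rewrite !scale1r. Qed.

Lemma field_cperZ a v : field_cper v -> field_cper (a *: v).
Proof. by move=> cv; have := field_cper_lin a 0 cv cv; rewrite scale0r addr0. Qed.

Lemma smooth_field_cper v : smooth_per v -> field_cper v.
Proof. by move=> sv r; exact: smooth_per_cper. Qed.

Lemma mode_ipDr u v w k : field_cper v -> field_cper w ->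
  mode_ip u (v + w) k = mode_ip u v k + mode_ip u w k.
Proof.
move=> cv cw; have := mode_ip_linl 1 1 u k cv cw; rewrite !scale1r !mul1r mode_ipC => ->.
by rewrite ![mode_ip _ u _]mode_ipC.
Qed.

Lemma mode_ipBr u v w k : field_cper v -> field_cper w ->
  mode_ip u (v - w) k = mode_ip u v k - mode_ip u w k.
Proof.
move=> cv cw; have := mode_ip_linl 1 (-1) u k cv cw; rewrite scale1r scaleN1r mul1r mulN1r mode_ipC => ->.
by rewrite ![mode_ip _ u _]mode_ipC.
Qed.

Lemma mode_ipZr a u v k : field_cper v -> mode_ip u (a *: v) k = a * mode_ip u v k.
Proof.
move=> cv; have := mode_ip_linl a 0 u k cv cv; rewrite scale0r addr0 mul0r addr0 mode_ipC => ->.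
by rewrite mode_ipC.
Qed.

Lemma mode_ip_laplacian v w k : smooth_per w -> mode_ip v (laplacian w) k = - (ksqr k * mode_ip v w k).
Proof.
move=> sw; rewrite /mode_ip mulr_sumr -sumrN; apply: eq_bigr => r _.
by have [-> ->] := fourier_laplacian r k sw; ring.
Qed.

Lemma field_cper_laplacian v : smooth_per v -> field_cper (laplacian v).
Proof.
move=> sv r; rewrite vcomp_laplacian//; apply: cper_sum => s _.
by have [_ [_ /(_ s) [_ [+ _]]]] := smooth_per_pd r s 1 sv.
Qed.

(** On coefficients the Laplacian is multiplication by - |k|^2, which amounts
    to raising p by 1. *)
Lemma absum_laplacian p v : smooth_per v -> finite_energy (p + 1) v ->
  absum nonzero_modes (fun k => hweight p k * mode_ip v (laplacian v) k).
Proof.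
move=> sv; apply: le_absum => k k0; rewrite mode_ip_laplacian// mulrN normrN mulrA.
rewrite le_eqVlt; apply/orP; left; apply/eqP; congr (`| _ * _ |).
by rewrite !hweightE powRD ?powRr1 ?ksqr_ge0//; apply/implyP => _; rewrite gt_eqF// (lt_le_trans ltr01)// ksqr_ge1.
Qed.

End Hinf.

Section LerayScaling.
Context {R : realType} {d : nat}.
Implicit Types (v w : vfield R d).
Local Opaque leray advect.

(** The series that defines the projection is homogeneous term by term. *)
Lemma lerayZ (a : R) v : smooth_per v -> leray (a *: v) = a *: leray v.
Proof.
move=> sv; have sav := smooth_perZ a sv.
have cv := smooth_field_cper sv; have cav := smooth_field_cper sav.
apply/funext => x; apply/rowP => r.
transitivity (a * vcomp (leray v) r x); last by rewrite [RHS]mxE /vcomp; congr (_ * leray _ x _ r); exact: ord1.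
transitivity (vcomp (leray (a *: v)) r x); first by rewrite /vcomp; congr (leray _ x _ r); exact: ord1.
have e1 := congr1 (fun f => f x) (vcomp_leray r cav).
have e2 := congr1 (fun f => a * f x) (vcomp_leray r cv).
apply: etrans e1 _; apply: etrans _ (esym e2).
rewrite /fourier_series -ksumZ; apply: eq_ksum => k _.
have E (F G : 'I_d -> 'rV[int]_d -> R) : (forall s, F s k = a * G s k) ->
    leray_coef F r k = a * leray_coef G r k.
  move=> FG; rewrite /leray_coef FG (eq_bigr (fun s => a * ((k ord0 s)%:~R * G s k))).
    by rewrite -mulr_sumr; ring.
  by move=> s _; rewrite FG mulrCA.
rewrite /fourier_term (E (fun s => fcos (vcomp (a *: v) s)) (fun s => fcos (vcomp v s))); last first.
  by move=> s; rewrite vcompZ (fourierZ a k (cv s)).1.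
rewrite (E (fun s => fsin (vcomp (a *: v) s)) (fun s => fsin (vcomp v s))); last first.
  by move=> s; rewrite vcompZ (fourierZ a k (cv s)).2.
ring.
Qed.

Lemma bilPZ (a b : R) v w : smooth_per v -> smooth_per w ->
  bilP (a *: v) (b *: w) = (a * b) *: bilP v w.
Proof.
move=> sv sw; rewrite /bilP advectZl advectZr// scalerA lerayZ; last exact: smooth_per_advect.
by rewrite scalerN.
Qed.

End LerayScaling.

(** * Energy estimate for the difference of two solutions *)

Section DifferenceTerms.
Context {R : realType} {d : nat} (d0 : (0 < d)%N).
Implicit Types (u v w y z : vfield R d) (k h : 'rV[int]_d).
Local Opaque leray bilP advect laplacian mode_ip.

Lemma split_arith (X1 X2 X3 Y1 Y2 Y3 Y4 Z : R) : X1 = - Y1 -> X2 = - Y2 -> X3 = - Y3 ->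
  Y1 = Y2 + Y4 -> Y4 = Z + Y3 -> X1 = X2 - Z + X3.
Proof. by move=> -> -> -> -> ->; ring. Qed.

(** Here v and c are fields given in advance and q is a difference of
    solutions. The part of P(y, z + c) that advects c is separated into a term
    in which q advects c, which is freed from the projection in order to be
    estimated through the spectrum of c, and into P(v, c), which cancels for
    Beltrami pairs. *)
Lemma mode_ip_bilP_split w y z q c v k : in_Hinf w -> smooth_per y -> smooth_per z ->
  smooth_per q -> smooth_per c -> smooth_per v -> y = q + v ->
  mode_ip w (bilP y (z + c)) k = mode_ip w (bilP y z) k - mode_ip w (advect q c) k + mode_ip w (bilP v c) k.
Proof.
move=> Hw sy sz sq sc sv yE; have sw := in_Hinf_smooth_per Hw; have dw := in_Hinf_divfree Hw.
have szc : smooth_per (z + c) by have := smooth_per_lin 1 1 sz sc; rewrite !scale1r.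
have cA (a b : vfield R d) : smooth_per a -> smooth_per b -> field_cper (advect a b).
  by move=> sa sb; apply: smooth_field_cper; exact: smooth_per_advect.
have e1 := mode_ip_bilP k sw dw sy szc.
have e2 := mode_ip_bilP k sw dw sy sz.
have e3 := mode_ip_bilP k sw dw sv sc.
have e4 : mode_ip w (advect y (z + c)) k = mode_ip w (advect y z) k + mode_ip w (advect y c) k.
  by rewrite (advectDr y sz sc); exact: (mode_ipDr w k (cA _ _ sy sz) (cA _ _ sy sc)).
have e5 : mode_ip w (advect y c) k = mode_ip w (advect q c) k + mode_ip w (advect v c) k.
  by rewrite yE advectDl; exact: (mode_ipDr w k (cA _ _ sq sc) (cA _ _ sv sc)).
exact: (split_arith e1 e2 e3 e4 e5).
Qed.

Lemma rip_young p v w : finite_energy p v -> finite_energy p w ->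
  `|rip p v w| <= 2^-1 * (rip p v v + rip p w w).
Proof.
move=> fv fw; rewrite /rip -ksumD// -ksumZ; apply: norm_ksum_le.
  by apply: absumZ; apply: absumD.
move=> k _; rewrite normrM (ger0_norm (hweight_ge0 _ _)) -mulrDr mulrCA.
by apply: ler_wpM2l; [exact: hweight_ge0|exact: mode_ip_norm].
Qed.

(** Sum of the mode identity with the Sobolev weights. The dissipative term is
    nonpositive, the advection terms are split by the inequality of Young, and
    the sum of the flow term Q is recovered as a difference of summable
    families. *)
Lemma rip_component (n nu e1 e2 : R) (w W Q E1 E2 : vfield R d) :
  0 <= nu -> in_Hinf w -> in_Hinf W ->
  finite_energy n E1 -> finite_energy n E2 ->
  (forall k, mode_ip w W k = nu * mode_ip w (laplacian w) k + mode_ip w Q k +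
     e1 * mode_ip w E1 k + e2 * mode_ip w E2 k) ->
  `|e1| <= 1 -> `|e2| <= 1 ->
  rip n w W <= rip n w Q + 2^-1 * (2 * rip n w w + rip n E1 E1 + rip n E2 E2).
Proof.
move=> nu0 Hw HW f1 f2 EW e11 e21.
have fw := in_Hinf_energy n Hw; have sw := in_Hinf_smooth_per Hw.
have aW := absum_ip fw (in_Hinf_energy n HW).
have aL := absum_laplacian sw (in_Hinf_energy (n + 1) Hw).
have a1 := absum_ip fw f1; have a2 := absum_ip fw f2.
have aR : absum nonzero_modes (fun k => nu * (hweight n k * mode_ip w (laplacian w) k) +
     (e1 * (hweight n k * mode_ip w E1 k) + e2 * (hweight n k * mode_ip w E2 k))).
  by apply: absumD; [exact: absumZ|apply: absumD; exact: absumZ].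
have EQ : rip n w Q = rip n w W - (nu * ksum nonzero_modes (fun k => hweight n k * mode_ip w (laplacian w) k) +
   (e1 * rip n w E1 + e2 * rip n w E2)).
  rewrite /rip -!ksumZ -ksumD; [|exact: absumZ..].
  rewrite -ksumD; [|exact: absumZ|by apply: absumD; exact: absumZ].
  by rewrite -ksumB//; apply: eq_ksum => k _; rewrite EW; ring.
have L0 : ksum nonzero_modes (fun k => hweight n k * mode_ip w (laplacian w) k) <= 0.
  rewrite -oppr_ge0 -ksumN; apply: ksum_ge0 => k _.
  rewrite mode_ip_laplacian// mulrN opprK; apply: mulr_ge0; first exact: hweight_ge0.
  by apply: mulr_ge0; [exact: ksqr_ge0|exact: mode_ip_ge0].
have nuL : nu * ksum nonzero_modes (fun k => hweight n k * mode_ip w (laplacian w) k) <= 0.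
  by rewrite mulr_ge0_le0.
have h1 : e1 * rip n w E1 <= 2^-1 * (rip n w w + rip n E1 E1).
  apply: (le_trans (ler_norm _)); rewrite normrM.
  by apply: le_trans (rip_young fw f1); rewrite ler_piMl.
have h2 : e2 * rip n w E2 <= 2^-1 * (rip n w w + rip n E2 E2).
  apply: (le_trans (ler_norm _)); rewrite normrM.
  by apply: le_trans (rip_young fw f2); rewrite ler_piMl.
move: EQ; lra.
Qed.

(** The decay rate kappa^2 nu of the explicit field equals its dissipation, so
    the dissipative part of the equation for the difference is nu times the
    Laplacian of the difference. *)
Lemma laplacian_difference (w y v : vfield R d) (nu kappa a : R) k : smooth_per y -> smooth_per v ->
  laplacian v = - kappa ^+ 2 *: v ->
  mode_ip w (nu *: laplacian y - (- (kappa ^+ 2 * nu) * a) *: v) k =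
  nu * mode_ip w (laplacian (y - a *: v)) k.
Proof.
move=> sy sv lap.
have sav := smooth_perZ a sv.
have -> : laplacian (y - a *: v) = laplacian y - (a * - kappa ^+ 2) *: v.
  have sN : smooth_per (- (a *: v)) by rewrite -scaleNr; exact: smooth_perZ.
  by rewrite laplacianD// -scaleNr laplacianZ// lap scalerA mulNr scaleNr.
have cl := field_cper_laplacian sy; have cv := smooth_field_cper sv.
have e1 := mode_ipBr w k (field_cperZ nu cl) (field_cperZ (- (kappa ^+ 2 * nu) * a) cv).
have e2 := mode_ipBr w k cl (field_cperZ (a * - kappa ^+ 2) cv).
apply: (etrans e1); rewrite e2.
rewrite (mode_ipZr nu w k cl) (mode_ipZr (- (kappa ^+ 2 * nu) * a) w k cv) (mode_ipZr (a * - kappa ^+ 2) w k cv).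
move: (mode_ip _ _ _) (mode_ip _ _ _) => X Y; ring.

Qed.

End DifferenceTerms.

Section EnergyInequality.
Context {R : realType} {d : nat} (d0 : (0 < d)%N).
Implicit Types (u v w y z : vfield R d) (k h : 'rV[int]_d).

Lemma Re_le_norm (a : R[i]) (b : R) : `|a| <= (b%:C)%C -> complex.Re a <= b.
Proof.
case: a => x y; rewrite normc_def lecE /= => /andP[_]; apply: le_trans.
by apply: (le_trans (ler_norm x)); rewrite -sqrtr_sqr ler_wsqrtr// lerDl sqr_ge0.
Qed.

Lemma pair_norm_sqr p v w : field_cper v -> field_cper w ->
  pair_norm p (v, w) ^+ 2 = rip p v v + rip p w w.
Proof.
by move=> cv cw; rewrite sqr_sqrtr /= ?hnorm_sqr// addr_ge0// rip_ge0.
Qed.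

Lemma eq_sym_le (x y : R) : y = x -> x <= y.
Proof. by move=> ->. Qed.

Lemma Re_add (a b : R[i]) : complex.Re (a + b) = complex.Re a + complex.Re b.
Proof. by case: a b => [? ?] [? ?]. Qed.

Lemma Re_pair_ip n (v w : vpair R d) :
  complex.Re (pair_ip n v w) = complex.Re (ip n v.1 w.1) + complex.Re (ip n v.2 w.2).
Proof. exact: Re_add. Qed.

Local Opaque leray bilP advect laplacian mode_ip rip ip.

(** The real part of the estimate that characterises G_n, for the pair (y, z)
    acting on the pair (w1, w2). *)
Lemma Ghat_rip (Ghat : R -> R) n y z w1 w2 : is_Ghat (d := d) Ghat -> above_critical (d := d) n ->
  in_Hinf y -> in_Hinf z -> in_Hinf w1 -> in_Hinf w2 ->
  rip n w1 (bilP y w1 - bilP z w2) + rip n w2 (bilP y w2 - bilP z w1) <=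
  Ghat n * pair_norm n (y, z) * (rip n w1 w1 + rip n w2 w2).
Proof.
move=> hG hn Hy Hz H1 H2.
have [_ /(_ (y, z) (w1, w2))] := hG n hn.
have cH v : in_Hinf v -> field_cper v := @in_Hinf_cper _ _ v.
have sH v : in_Hinf v -> smooth_per v := @in_Hinf_smooth_per _ _ v.
have cP v w : in_Hinf v -> in_Hinf w -> field_cper (bilP v w).
  by move=> /sH sv /sH sw; exact: field_cper_bilP.
have IH v p : in_Hinf v -> in_H p v by move=> [_].
move=> /(_ (conj (IH _ _ Hy) (IH _ _ Hz)) (conj (IH _ _ H1) (IH _ _ H2))) /Re_le_norm.
rewrite (pair_norm_sqr n (cH _ H1) (cH _ H2)); apply: le_trans.
have c1 : field_cper (bilP y w1 - bilP z w2) by apply: field_cperB; exact: cP.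
have c2 : field_cper (bilP y w2 - bilP z w1) by apply: field_cperB; exact: cP.
have e1 := Re_ip n c1 (cH _ H1).
have e2 := Re_ip n c2 (cH _ H2).
have e0 : complex.Re (pair_ip n (pairP (y, z) (w1, w2)) (w1, w2)) =
  complex.Re (ip n (bilP y w1 - bilP z w2) w1) + complex.Re (ip n (bilP y w2 - bilP z w1) w2).
  exact: (Re_pair_ip n (pairP (y, z) (w1, w2)) (w1, w2)).
apply: eq_sym_le; apply: (etrans e0).
exact: (congr2 +%R (etrans e1 (ripC n _ w1)) (etrans e2 (ripC n _ w2))).
Qed.

Lemma eigen_advect_bound (kappa p : R) v : 0 <= kappa -> 0 <= p -> in_Hinf v ->
  laplacian v = - kappa ^+ 2 *: v ->
  exists C, 0 <= C /\ forall w, in_Hinf w ->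
    finite_energy p (advect w v) /\ rip p (advect w v) (advect w v) <= C * rip p w w.
Proof.
move=> k0 p0 Hv lv; have sv := in_Hinf_smooth_per Hv.
have [L [uL _ sL]] := eigen_spectrum k0 sv lv.
have [C [C0 HC]] := advect_trig_bound d0 p0 uL sv sL.
exists C; split=> // w Hw; apply: HC; [exact: in_Hinf_smooth_per|exact: in_Hinf_mean_zero|exact: in_Hinf_energy].
Qed.

Lemma component_arith (X X' L B1 B2 q1 q2 e1 e2 z1 z2 Q a b x1 x2 : R) :
  X = X' + B1 - B2 -> B1 = q1 - e1 + z1 -> B2 = q2 - e2 + z2 -> z1 = z2 ->
  X' = L -> Q = q1 - q2 -> e1 = a * x1 -> e2 = b * x2 ->
  X = L + Q + (- a) * x1 + b * x2.
Proof. by move=> -> -> -> -> -> -> -> ->; ring. Qed.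

(** One equation of the system for the difference, tested against w at the wave
    vector k. It is applied to the first equation with q1 = r1 and q2 = r2, and
    to the second one with the roles of r1 and r2 exchanged; in both cases the
    last hypothesis expresses the cancellation of the nonlinear terms of the
    explicit solution. *)
Lemma component_modes w Y V y y' z z' q1 q2 r1 r2 v1 v2 C1 C2 (nu kappa s a b : R) k :
  in_Hinf w -> smooth_per Y -> smooth_per V -> smooth_per q1 -> smooth_per q2 ->
  smooth_per r1 -> smooth_per r2 -> smooth_per v1 -> smooth_per v2 ->
  smooth_per C1 -> smooth_per C2 ->
  laplacian V = - kappa ^+ 2 *: V ->
  y = q1 + v1 -> z = q2 + v2 -> y' = r1 + a *: C1 -> z' = r2 + b *: C2 ->
  bilP v1 (a *: C1) = bilP v2 (b *: C2) ->
  mode_ip w (nu *: laplacian Y + bilP y y' - bilP z z' - (- (kappa ^+ 2 * nu) * s) *: V) k =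
  nu * mode_ip w (laplacian (Y - s *: V)) k + mode_ip w (bilP y r1 - bilP z r2) k +
  (- a) * mode_ip w (advect q1 C1) k + b * mode_ip w (advect q2 C2) k.
Proof.
move=> Hw sY sV sq1 sq2 sr1 sr2 sv1 sv2 sC1 sC2 lV yE zE y'E z'E BE.
have sD f g : smooth_per f -> smooth_per g -> smooth_per (f + g).
  by move=> sf sg; have := smooth_per_lin 1 1 sf sg; rewrite !scale1r.
have saC1 := smooth_perZ a sC1; have sbC2 := smooth_perZ b sC2.
have sy : smooth_per y by rewrite yE; exact: sD.
have sz : smooth_per z by rewrite zE; exact: sD.
have sy' : smooth_per y' by rewrite y'E; exact: sD.
have sz' : smooth_per z' by rewrite z'E; exact: sD.
have c1 := field_cper_bilP sy sy'; have c2 := field_cper_bilP sz sz'.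
have cL := field_cperZ nu (field_cper_laplacian sY).
have cV := field_cperZ (- (kappa ^+ 2 * nu) * s) (smooth_field_cper sV).
have s1 := mode_ip_bilP_split k Hw sy sr1 sq1 saC1 sv1 yE.
have s2 := mode_ip_bilP_split k Hw sz sr2 sq2 sbC2 sv2 zE.
have l1 := laplacian_difference w nu s k sY sV lV.
have Q := mode_ipBr w k (field_cper_bilP sy sr1) (field_cper_bilP sz sr2).
have A1 := mode_ipZr a w k (smooth_field_cper (smooth_per_advect sq1 sC1)).
have A2 := mode_ipZr b w k (smooth_field_cper (smooth_per_advect sq2 sC2)).
rewrite -(advectZr a q1 sC1) in A1; rewrite -(advectZr b q2 sC2) in A2.
rewrite -y'E in s1; rewrite -z'E in s2.
have BE' : mode_ip w (bilP v1 (a *: C1)) k = mode_ip w (bilP v2 (b *: C2)) k by rewrite BE.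
have -> : nu *: laplacian Y + bilP y y' - bilP z z' - (- (kappa ^+ 2 * nu) * s) *: V =
  (nu *: laplacian Y - (- (kappa ^+ 2 * nu) * s) *: V + bilP y y') - bilP z z'.
  by move: (nu *: _) (bilP y y') (bilP z z') (_ *: V) => f1 f2 f3 f4; rewrite addrAC [f1 + f2 - f4]addrAC.
have D1 := mode_ipBr w k (field_cperD (field_cperB cL cV) c1) c2.
have D2 := mode_ipDr w k (field_cperB cL cV) c1.
have D : mode_ip w (nu *: laplacian Y - (- (kappa ^+ 2 * nu) * s) *: V + bilP y y' - bilP z z') k =
    mode_ip w (nu *: laplacian Y - (- (kappa ^+ 2 * nu) * s) *: V) k +
    mode_ip w (bilP y y') k - mode_ip w (bilP z z') k := etrans D1 (congr1 (fun t => t - _) D2).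
exact: (component_arith D s1 s2 BE' l1 Q A1 A2).
Qed.

Lemma bilP_Z0 (a : R) v : smooth_per v -> bilP v v = 0 -> bilP (a *: v) (a *: v) = 0.
Proof. by move=> sv v0; rewrite bilPZ// v0 scaler0. Qed.

Lemma bilP_ZC (a b : R) v w : smooth_per v -> smooth_per w -> bilP v w = bilP w v ->
  bilP (a *: v) (b *: w) = bilP (b *: w) (a *: v).
Proof.
move=> sv sw e; apply: (etrans (bilPZ a b sv sw)); rewrite e mulrC.
exact: esym (bilPZ b a sw sv).
Qed.

Lemma energy_arith (Cv Cc r1 r2 A1 A2 B1 B2 W1 W2 Q1 Q2 G : R) :
  W1 <= Q1 + 2^-1 * (2 * r1 + A1 + A2) -> W2 <= Q2 + 2^-1 * (2 * r2 + B1 + B2) ->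
  Q1 + Q2 <= G * (r1 + r2) ->
  A1 <= Cv * r1 -> A2 <= Cc * r2 -> B1 <= Cc * r1 -> B2 <= Cv * r2 ->
  W1 + W2 <= (G + (1 + 2^-1 * (Cv + Cc))) * (r1 + r2).
Proof. lra. Qed.

Lemma energy_const_ge0 (a b : R) : 0 <= a -> 0 <= b -> 0 <= 1 + 2^-1 * (a + b).
Proof. by move=> a0 b0; rewrite addr_ge0// mulr_ge0// addr_ge0. Qed.

(** The numbers a and b are the values of the two exponentials at a given time.
    They lie in [0, 1], so one constant C serves all times; it comes from the
    terms in which the difference advects v0 or c0, whereas the terms advected
    by u itself are controlled by G_n. *)
Lemma energy_inequality (nu eta kappa lambda n : R) (Ghat : R -> R) v0 c0 :
  0 <= nu -> 0 <= eta -> 0 <= kappa -> 0 <= lambda ->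
  is_Ghat (d := d) Ghat -> above_critical (d := d) n ->
  in_Hinf v0 -> in_Hinf c0 -> bilP v0 v0 = 0 -> bilP c0 c0 = 0 -> bilP v0 c0 = bilP c0 v0 ->
  laplacian v0 = - kappa ^+ 2 *: v0 -> laplacian c0 = - lambda ^+ 2 *: c0 ->
  exists C : R, 0 <= C /\ forall (u : vpair R d) (a b : R), in_Hinf u.1 -> in_Hinf u.2 ->
    0 <= a <= 1 -> 0 <= b <= 1 ->
    let W1 := (mhd_rhs nu eta u).1 - (- (kappa ^+ 2 * nu) * a) *: v0 in
    let W2 := (mhd_rhs nu eta u).2 - (- (lambda ^+ 2 * eta) * b) *: c0 in
    let w1 := u.1 - a *: v0 in let w2 := u.2 - b *: c0 in
    in_Hinf W1 -> in_Hinf W2 ->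
    rip n w1 W1 + rip n w2 W2 <=
      (Ghat n * pair_norm n u + C) * (rip n w1 w1 + rip n w2 w2).
Proof.
move=> nu0 eta0 k0 l0 hG hn Hv Hc bv bc bvc lv lc.
have n0 : 0 <= n.
  by apply: ltW; apply: le_lt_trans hn; rewrite addr_ge0// divr_ge0.
have [Cv [Cv0 hCv]] := eigen_advect_bound k0 n0 Hv lv.
have [Cc [Cc0 hCc]] := eigen_advect_bound l0 n0 Hc lc.
have sv := in_Hinf_smooth_per Hv; have sc := in_Hinf_smooth_per Hc.
have CC := energy_const_ge0 Cv0 Cc0.
exists (1 + 2^-1 * (Cv + Cc)); split; first exact: CC.
move=> [y z] a b Hy Hz /andP[a0 a1] /andP[b0 b1] W1 W2 w1 w2 HW1 HW2.
have H1 : in_Hinf w1 := in_HinfB Hy (in_HinfZ a Hv).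
have H2 : in_Hinf w2 := in_HinfB Hz (in_HinfZ b Hc).
have sy := in_Hinf_smooth_per Hy; have sz := in_Hinf_smooth_per Hz.
have s1 := in_Hinf_smooth_per H1; have s2 := in_Hinf_smooth_per H2.
have sav := smooth_perZ a sv; have sbc := smooth_perZ b sc.
have yE : y = w1 + a *: v0 by rewrite subrK.
have zE : z = w2 + b *: c0 by rewrite subrK.
have bva := bilP_Z0 a sv bv; have bca := bilP_Z0 b sc bc.
have bmix := bilP_ZC a b sv sc bvc.
have M1 k := component_modes nu a k H1 sy sv s1 s2 s1 s2 sav sbc sv sc lv yE zE yE zE (etrans bva (esym bca)).
have M2 k := component_modes eta b k H2 sz sc s1 s2 s2 s1 sav sbc sc sv lc yE zE zE yE bmix.
have [f1v r1v] := hCv _ H1; have [f2v r2v] := hCv _ H2.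
have [f1c r1c] := hCc _ H1; have [f2c r2c] := hCc _ H2.
have na (x : R) : 0 <= x -> x <= 1 -> `|- x| <= 1 by move=> x0 x1; rewrite normrN ger0_norm.
have pa (x : R) : 0 <= x -> x <= 1 -> `|x| <= 1 by move=> x0 x1; rewrite ger0_norm.
have I1 := rip_component nu0 H1 HW1 f1v f2c M1 (na a a0 a1) (pa b b0 b1).
have I2 := rip_component eta0 H2 HW2 f1c f2v M2 (na b b0 b1) (pa a a0 a1).
have I3 := Ghat_rip hG hn Hy Hz H1 H2.
exact: (energy_arith I1 I2 I3 r1v r2c r1c r2v).
Qed.

End EnergyInequality.

(** * Difference quotients within a set and the lemma of Gronwall *)

Section RealCurves.
Context {R : realType}.
Implicit Types (f g : R -> R) (D : set R).

Lemma cvg_puncturedP f D (t l : R) : f @ within D t^' --> l <->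
  forall eps, 0 < eps -> exists2 del, 0 < del &
    forall s, D s -> s != t -> `|t - s| < del -> `|l - f s| <= eps.
Proof.
split=> [/cvgrPdist_le H eps e0|H].
  have /nbhs_ballP[del /= del0 Hd] := H _ e0.
  by exists del => // s Ds st ts; apply: Hd.
apply/cvgrPdist_le => eps e0; have [del del0 Hd] := H _ e0.
apply/nbhs_ballP; exists del => //= s ts st Ds; exact: Hd.
Qed.

Lemma quotient_continuous f D (t l : R) :
  (s - t)^-1 * (f s - f t) @[s --> within D t^'] --> l ->
  f s @[s --> within D (nbhs t)] --> f t.
Proof.
move=> /cvg_puncturedP /(_ 1 ltr01) [del del0 Hd].
apply/cvgrPdist_le => eps e0; apply/nbhs_ballP.
have L0 : 0 < `|l| + 1 by rewrite ltr_wpDl.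
exists (Num.min del (eps / (`|l| + 1))) => /=; first by rewrite lt_min del0 divr_gt0.
move=> s; rewrite /ball /= lt_min => /andP[ts1 ts2] Ds.
have [->|st] := eqVneq s t; first by rewrite subrr normr0 ltW.
have {}Hd := Hd s Ds st ts1.
have st0 : s - t != 0 by rewrite subr_eq0.
have -> : f t - f s = (t - s) * ((s - t)^-1 * (f s - f t)) by field.
rewrite normrM; apply: (@le_trans _ _ (eps / (`|l| + 1) * (`|l| + 1))); last first.
  by rewrite divfK// gt_eqF.
apply: ler_pM => //; first exact: ltW.
have := ler_distD l ((s - t)^-1 * (f s - f t)) 0; rewrite !subr0 => /le_trans; apply.
by rewrite addrC lerD2l distrC.
Qed.

(** At an interior point of D the restricted quotient is an ordinary one. *)
Lemma quotient_derive f D (t l r : R) : 0 < r -> (forall s, `|t - s| < r -> D s) ->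
  (s - t)^-1 * (f s - f t) @[s --> within D t^'] --> l ->
  is_derive t (1 : R) f l.
Proof.
move=> r0 Dr /cvg_puncturedP H.
have C : h^-1 *: ((f \o shift t) (h *: (1 : R)) - f t) @[h --> 0^'] --> l.
  apply/cvgrPdist_le => eps e0; have [del del0 Hd] := H _ e0.
  apply/nbhs_ballP; exists (Num.min r del) => /=; first by rewrite lt_min r0.
  move=> h; rewrite /ball /= sub0r normrN lt_min => /andP[hr hd] h0.
  have := Hd (h + t); rewrite addrK opprD addrCA subrr addr0 normrN.
  move=> /(_ _ _ hd); rewrite /shift /= /GRing.scale /= mulr1; apply.
    by apply: Dr; rewrite opprD addrCA subrr addr0 normrN.
  by rewrite -subr_eq0 addrK.
apply: DeriveDef; first by apply/cvg_ex; exists l.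
exact: cvg_lim C.
Qed.

Lemma is_derive_expR_scale (a t : R) :
  is_derive t (1 : R) (fun t => expR (a * t)) (a * expR (a * t)).
Proof.
have d1 : is_derive t (1 : R) (fun t => a * t) a.
  have := is_deriveZ a (@is_derive_id R R t 1).
  by move/is_derive_eq; apply; rewrite /GRing.scale /= mulr1.
have := @is_derive1_comp _ (@expR R) (fun t => a * t) t _ _ (is_derive_expR (a * t)) d1.
by move/is_derive_eq; apply; rewrite mulrC.
Qed.

(** The product of f with the integrating factor e^(- K t) is nonincreasing. At
    the end points of the interval only the continuity that follows from the
    one-sided quotients is used. *)
Lemma gronwall (f f' : R -> R) (K b : R) : 0 <= b ->
  (forall t, 0 <= t <= b ->
    (s - t)^-1 * (f s - f t) @[s --> within `[0, b] t^'] --> f' t) ->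
  (forall t, 0 <= t <= b -> f' t <= K * f t) -> f 0 <= 0 -> f b <= 0.
Proof.
move=> b0 Hq Hf f0.
pose g t := expR (- K * t) * f t.
have de t : is_derive t (1 : R) (fun t => expR (- K * t)) (- K * expR (- K * t)).
  exact: is_derive_expR_scale.
have fd t : t \in `]0, b[ -> is_derive t (1 : R) f (f' t).
  rewrite in_itv /= => /andP[t0 tb].
  apply: (@quotient_derive f `[0, b] t (f' t) (Num.min t (b - t))); last by apply: Hq; rewrite !ltW.
    by rewrite lt_min t0 subr_gt0.
  move=> s; rewrite lt_min /= in_itv /= => /andP[]; rewrite !ltr_norml.
  by move=> /andP[? ?] /andP[? ?]; apply/andP; split; lra.
have gd t : t \in `]0, b[ -> is_derive t (1 : R) g (expR (- K * t) * (f' t - K * f t)).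
  move=> /fd df; have := is_deriveM (de t) df.
  by move/is_derive_eq; apply; rewrite /GRing.scale /=; ring.
have cg : {within `[0, b], continuous g}.
  apply/subspace_continuousP => t; rewrite /= in_itv /= => tb.
  apply: cvgM; last exact: quotient_continuous (Hq t tb).
  apply: cvg_within_filter.
  have : {for t, continuous (fun t => expR (- K * t))}.
    by apply: differentiable_continuous; apply/derivable1_diffP; exact: ex_derive.
  by [].
have : g b <= g 0.
  apply: (@ler0_derive1_le_cc _ g 0 b) => //; try by rewrite in_itv /= ?lexx ?b0.
  - by move=> t tb; have [] := gd t tb.
  - move=> t tb; rewrite derive1E; have -> := @derive_val _ _ _ _ _ _ _ (gd t tb).
    rewrite pmulr_rle0 ?expR_gt0// subr_le0; apply: Hf.
    by move: tb; rewrite in_itv /= => /andP[? ?]; rewrite !ltW.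
rewrite /g mulr0 expR0 mul1r => h; have := le_trans h f0.
by rewrite pmulr_rle0 ?expR_gt0.
Qed.

Lemma is_derive_quotient f (t l : R) D : is_derive t (1 : R) f l ->
  (s - t)^-1 * (f s - f t) @[s --> within D t^'] --> l.
Proof.
move=> [df fl]; apply/cvg_puncturedP => eps e0.
have := df; rewrite /derivable => /cvg_ex [l' Cl].
have {}Cl : h^-1 *: ((f \o shift t) (h *: (1 : R)) - f t) @[h --> 0^'] --> l.
  by rewrite -fl.
move/cvgrPdist_le : Cl => /(_ _ e0) /nbhs_ballP[del /= del0 Hd].
exists del => // s Ds st ts.
have := Hd (s - t); rewrite /ball /= sub0r normrN distrC => /(_ ts).
rewrite subr_eq0 => /(_ st).
by rewrite /shift /= /GRing.scale /= mulr1 subrK.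
Qed.

End RealCurves.

(** * Differentiable curves of vector fields *)

Section NormCurves.
Context {R : realType} {d : nat}.
Implicit Types (u v w : vfield R d) (p t : R) (D : set R) (x y : R -> vfield R d).

Lemma hnormZ p (a : R) v : field_cper v -> hnorm p (a *: v) = `|a| * hnorm p v.
Proof.
move=> cv; rewrite !hnormE//; last exact: field_cperZ.
have -> : rip p (a *: v) (a *: v) = a ^+ 2 * rip p v v.
  rewrite /rip -ksumZ; apply: eq_ksum => k _.
  rewrite (mode_ipZr a _ k cv) (mode_ipC (a *: v)) (mode_ipZr a _ k cv).
  by move: (mode_ip _ _ _) (hweight _ _) => m h; ring.
by rewrite sqrtrM ?sqr_ge0// sqrtr_sqr.
Qed.

Lemma hnormB_le p u v : field_cper u -> field_cper v -> finite_energy p u -> finite_energy p v ->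
  hnorm p (u - v) <= hnorm p u + hnorm p v.
Proof.
move=> cu cv fu fv.
have e : rip p (u - v) (u - v) = rip p u u - 2 * rip p u v + rip p v v.
  have := rip_quad 1 (-1) cu cv fu fv.
  rewrite scale1r scaleN1r => ->; ring.
rewrite !hnormE//; last exact: field_cperB.
rewrite -(ger0_norm (addr_ge0 (sqrtr_ge0 (rip p u u)) (sqrtr_ge0 (rip p v v)))).
rewrite -sqrtr_sqr ler_wsqrtr// e sqrrD !sqr_sqrtr ?rip_ge0//.
have := rip_CS cu cv fu fv; have := ler_norm (- rip p u v); rewrite normrN.
lra.
Qed.

Lemma hnorm_pair1 p (v : vpair R d) : hnorm p v.1 <= pair_norm p v.
Proof.
rewrite /pair_norm -{1}(ger0_norm (sqrtr_ge0 _ : 0 <= hnorm p v.1)) -sqrtr_sqr ler_wsqrtr//.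
by rewrite lerDl sqr_ge0.
Qed.

Lemma hnorm_pair2 p (v : vpair R d) : hnorm p v.2 <= pair_norm p v.
Proof.
rewrite /pair_norm -{1}(ger0_norm (sqrtr_ge0 _ : 0 <= hnorm p v.2)) -sqrtr_sqr ler_wsqrtr//.
by rewrite lerDr sqr_ge0.
Qed.

(** Differentiability of one component of a curve of pairs, for all the norms
    simultaneously, as in [has_deriv]. *)
Definition norm_deriv (D : set R) (x : R -> vfield R d) t w : Prop :=
  in_Hinf w /\ forall p : R, hnorm p ((s - t)^-1 *: (x s - x t) - w) @[s --> within D t^'] --> (0 : R).

Lemma squeeze0 (D : set R) t (f g : R -> R) : (forall s, D s -> s != t -> 0 <= f s <= g s) ->
  g @ within D t^' --> (0 : R) -> f @ within D t^' --> (0 : R).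
Proof.
move=> fg /cvg_puncturedP H; apply/cvg_puncturedP => eps e0.
have [del del0 Hd] := H _ e0; exists del => // s Ds st ts.
have {}Hd := Hd s Ds st ts; have /andP[f0 fgs] := fg s Ds st.
rewrite sub0r normrN ger0_norm//; apply: (le_trans fgs); apply: (le_trans (ler_norm _)).
by move: Hd; rewrite sub0r normrN.
Qed.

Lemma has_deriv_fst T (u : R -> vpair R d) t (w : vpair R d) : has_deriv T u t w -> norm_deriv (time_dom T) (fun s => (u s).1) t w.1.
Proof.
move=> [[H1 _] H]; split=> // p; apply: squeeze0 (H p) => s _ _.
by rewrite sqrtr_ge0 (hnorm_pair1 p ((s - t)^-1 *: (u s - u t) - w)).
Qed.

Lemma has_deriv_snd T (u : R -> vpair R d) t (w : vpair R d) : has_deriv T u t w -> norm_deriv (time_dom T) (fun s => (u s).2) t w.2.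
Proof.
move=> [[_ H1] H]; split=> // p; apply: squeeze0 (H p) => s _ _.
by rewrite sqrtr_ge0 (hnorm_pair2 p ((s - t)^-1 *: (u s - u t) - w)).
Qed.

Lemma norm_derivW D D' x t w : D' `<=` D -> norm_deriv D x t w -> norm_deriv D' x t w.
Proof.
move=> DD [Hw H]; split=> // p; apply/cvg_puncturedP => eps e0.
have /cvg_puncturedP /(_ _ e0) [del del0 Hd] := H p.
by exists del => // s /DD; exact: Hd.
Qed.

Lemma subB_swap (V : zmodType) (a b c e : V) : a - b - (c - e) = a - c - (b - e).
Proof. by rewrite !opprB [e - c]addrC addrACA [- b + e]addrC. Qed.

Lemma norm_derivB D x y t v w : (forall s, D s -> in_Hinf (x s)) ->
  (forall s, D s -> in_Hinf (y s)) -> D t ->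
  norm_deriv D x t v -> norm_deriv D y t w -> norm_deriv D (fun s => x s - y s) t (v - w).
Proof.
move=> Hx Hy Dt [Hv cv] [Hw cw]; split; first exact: in_HinfB.
move=> p; apply: squeeze0 (_ : hnorm p ((s - t)^-1 *: (x s - x t) - v) +
  hnorm p ((s - t)^-1 *: (y s - y t) - w) @[s --> within D t^'] --> (0 : R)); last first.
  by rewrite -[X in _ --> X]addr0; apply: cvgD; [exact: cv|exact: cw].
move=> s Ds _; rewrite sqrtr_ge0 /=.
have -> : (s - t)^-1 *: (x s - y s - (x t - y t)) - (v - w) =
    ((s - t)^-1 *: (x s - x t) - v) - ((s - t)^-1 *: (y s - y t) - w).
  by rewrite (subB_swap (x s)) scalerBr subB_swap.
have HA : in_Hinf ((s - t)^-1 *: (x s - x t) - v).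
  by apply: in_HinfB => //; apply: in_HinfZ; apply: in_HinfB; exact: Hx.
have HB : in_Hinf ((s - t)^-1 *: (y s - y t) - w).
  by apply: in_HinfB => //; apply: in_HinfZ; apply: in_HinfB; exact: Hy.
by apply: hnormB_le; [exact: in_Hinf_cper|exact: in_Hinf_cper|exact: in_Hinf_energy|exact: in_Hinf_energy].
Qed.

Lemma norm_deriv_expR D (a : R) v t : in_Hinf v ->
  norm_deriv D (fun s => expR (a * s) *: v) t ((a * expR (a * t)) *: v).
Proof.
move=> Hv; split=> [|p]; first exact: in_HinfZ.
have cv := in_Hinf_cper Hv.
have /cvg_puncturedP H := is_derive_quotient D (is_derive_expR_scale a t).
apply/cvg_puncturedP => eps e0.
have h0 : 0 < hnorm p v + 1 by rewrite ltr_wpDl// sqrtr_ge0.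
have [del del0 Hd] := H _ (divr_gt0 e0 h0); exists del => // s Ds st ts.
rewrite -scalerBl scalerA -scalerBl hnormZ// sub0r normrN ger0_norm ?mulr_ge0 ?sqrtr_ge0//.
rewrite distrC; apply: (@le_trans _ _ (eps / (hnorm p v + 1) * (hnorm p v + 1))); last first.
  by rewrite divfK// gt_eqF.
by apply: ler_pM => //; [exact: sqrtr_ge0|exact: Hd|rewrite lerDl].
Qed.

Lemma norm_deriv_rip D x t w p : (forall s, D s -> in_Hinf (x s)) -> D t -> norm_deriv D x t w ->
  (s - t)^-1 * (rip p (x s) (x s) - rip p (x t) (x t)) @[s --> within D t^'] --> 2 * rip p (x t) w.
Proof.
move=> Hx Dt [Hw Hd]; apply: rip_curve_derivative => //.
- by move=> s /Hx /in_Hinf_cper.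
- by move=> s /Hx /(in_Hinf_energy p).
- exact: in_Hinf_cper.
- exact: in_Hinf_energy.
Qed.

(** The norm sees all nonzero wave vectors, the mean value takes care of 0, and
    the trigonometric system is complete. *)
Lemma rip_eq0 p v : (0 < d)%N -> in_Hinf v -> rip p v v <= 0 -> v = 0.
Proof.
move=> d0 Hv r0; have cv := in_Hinf_cper Hv; have sv := in_Hinf_smooth_per Hv.
have z k : k != 0 -> mode_ip v v k = 0.
  move=> k0; pose g h := if h == k then hweight p h * mode_ip v v h else 0.
  have [ag eg] : absum nonzero_modes g /\ ksum nonzero_modes g = \sum_(h <- [:: k]) g h.
    apply: absum_finite => //; first by move=> h; rewrite inE => /eqP ->.
    by move=> h _; rewrite inE /g; case: eqP.
  have := le_ksum ag (in_Hinf_energy p Hv); rewrite eg big_seq1 => H.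
  have gk : g k = hweight p k * mode_ip v v k by rewrite /g eqxx.
  have h1 : hweight p k * mode_ip v v k <= 0.
    rewrite -gk; apply: le_trans r0; apply: H => h _; rewrite /g; case: eqP => [_|_]; rewrite ?lexx//.
    by rewrite mulr_ge0 ?hweight_ge0 ?mode_ip_ge0.
  have w0 : 0 < hweight p k by rewrite hweightE powR_gt0// (lt_le_trans ltr01)// ksqr_ge1.
  by apply/eqP; rewrite eq_le mode_ip_ge0 andbT; move: h1; rewrite pmulr_rle0.
have zz k r : fcos (vcomp v r) k = 0 /\ fsin (vcomp v r) k = 0.
  have [->|k0] := eqVneq k 0; first by apply: fourier_mean_zero => //; exact: in_Hinf_mean_zero.
  have /eqP := z k k0; rewrite /mode_ip psumr_eq0; last first.
    by move=> s _; rewrite addr_ge0// -expr2 sqr_ge0.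
  move/allP => /(_ r (mem_index_enum _)) /implyP /(_ isT).
  by rewrite paddr_eq0 -?expr2 ?sqr_ge0// !sqrf_eq0 => /andP[/eqP -> /eqP ->].
apply/funext => x; apply/rowP => r; rewrite [RHS]mxE.
have := fourier_unique d0 (cv r) (fun k => (zz k r).1) (fun k => (zz k r).2) x.
by rewrite /vcomp => <-; congr (v x _ r); exact: ord1.
Qed.

End NormCurves.

(** * Uniqueness of the solution *)

Section Uniqueness.
Context {R : realType} {d : nat} (d0 : (0 < d)%N).
Implicit Types (u v w y z : vfield R d).
Local Opaque leray bilP advect laplacian mode_ip rip ip hnorm.

(** A differentiable curve has a continuous norm, which is bounded on a compact
    interval. *)
Lemma rip_pair_bounded p (b : R) (u : R -> vpair R d) : 0 <= b ->
  (forall s, 0 <= s <= b -> in_Hinf (u s).1 /\ in_Hinf (u s).2) ->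
  (forall t, 0 <= t <= b -> exists w, norm_deriv `[0, b] (fun s => (u s).1) t w) ->
  (forall t, 0 <= t <= b -> exists w, norm_deriv `[0, b] (fun s => (u s).2) t w) ->
  exists M : R, forall t, 0 <= t <= b -> pair_norm p (u t) <= M.
Proof.
move=> b0 Hu D1 D2.
pose E t := rip p (u t).1 (u t).1 + rip p (u t).2 (u t).2.
have cE : {within `[0, b], continuous E}.
  apply/subspace_continuousP => t; rewrite /= in_itv /= => tb.
  have tI : `[0, b]%classic t by rewrite /= in_itv.
  have [w1 H1] := D1 t tb; have [w2 H2] := D2 t tb.
  have h1 s : `[0, b]%classic s -> in_Hinf (u s).1 by rewrite /= in_itv /= => /Hu [].
  have h2 s : `[0, b]%classic s -> in_Hinf (u s).2 by rewrite /= in_itv /= => /Hu [].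
  have q1 := quotient_continuous (norm_deriv_rip (p := p) h1 tI H1).
  have q2 := quotient_continuous (norm_deriv_rip (p := p) h2 tI H2).
  exact: cvgD q1 q2.
have [c _ Hc] := EVT_max b0 cE.
exists (Num.sqrt (E c)) => t tb; have [H1 H2] := Hu t tb.
have -> : pair_norm p (u t) = Num.sqrt (E t).
  rewrite /pair_norm (hnorm_sqr p (in_Hinf_cper H1)) (hnorm_sqr p (in_Hinf_cper H2)).
  by [].
by rewrite ler_wsqrtr// Hc// in_itv.
Qed.

Lemma growth_arith (G N M C a1 a2 r1 r2 : R) : 0 <= G -> N <= M -> 0 <= r1 -> 0 <= r2 ->
  a1 + a2 <= (G * N + C) * (r1 + r2) -> 2 * a1 + 2 * a2 <= 2 * (G * M + C) * (r1 + r2).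
Proof.
move=> G0 NM r10 r20 H; rewrite -mulrDr -mulrA ler_pM2l//; apply: (le_trans H).
by rewrite ler_wpM2r ?addr_ge0// lerD2r ler_wpM2l.
Qed.

Lemma rip00 p v : in_Hinf v -> rip p (0 : vfield R d) 0 = 0.
Proof.
move=> Hv; have cv := in_Hinf_cper Hv; have fv := in_Hinf_energy p Hv.
by have := rip_quad 0 0 cv cv fv fv; rewrite scale0r addr0 expr0n /= !(mul0r, mulr0, addr0).
Qed.

Lemma itv_sub_time_dom T (b : R) : time_dom T b -> `[0, b]%classic `<=` time_dom T.
Proof.
move=> [b0 bT] s; rewrite /= in_itv /= => /andP[s0 sb]; split; first exact: s0.
by apply: le_lt_trans bT; rewrite lee_fin.
Qed.

Lemma expR_decay_bounds (a t : R) : 0 <= a -> 0 <= t -> 0 <= expR (- a * t) <= 1.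
Proof. by move=> a0 t0; rewrite expR_ge0 -expR0 ler_expR mulNr oppr_le0 mulr_ge0. Qed.

(** The lemma of Gronwall for the squared norm of the pair (x1, x2). *)
Lemma rip_curves_vanish p (b K : R) (x1 x2 W1 W2 : R -> vfield R d) : 0 <= b ->
  (forall s, `[0, b]%classic s -> in_Hinf (x1 s)) ->
  (forall s, `[0, b]%classic s -> in_Hinf (x2 s)) ->
  (forall s, 0 <= s <= b -> norm_deriv `[0, b] x1 s (W1 s)) ->
  (forall s, 0 <= s <= b -> norm_deriv `[0, b] x2 s (W2 s)) ->
  (forall t, 0 <= t <= b -> 2 * rip p (x1 t) (W1 t) + 2 * rip p (x2 t) (W2 t) <=
     K * (rip p (x1 t) (x1 t) + rip p (x2 t) (x2 t))) ->
  x1 0 = 0 -> x2 0 = 0 -> x1 b = 0 /\ x2 b = 0.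
Proof.
move=> b0 h1 h2 D1 D2 G z1 z2.
have Inn s : 0 <= s <= b -> `[0, b]%classic s by rewrite /= in_itv.
have bb : `[0, b]%classic b by apply: Inn; rewrite b0 lexx.
have phib : rip p (x1 b) (x1 b) + rip p (x2 b) (x2 b) <= 0.
  apply: (@gronwall _ (fun t => rip p (x1 t) (x1 t) + rip p (x2 t) (x2 t)) _ K b b0 _ G).
  - move=> t tb; have q1 := norm_deriv_rip (p := p) h1 (Inn _ tb) (D1 _ tb).
    have q2 := norm_deriv_rip (p := p) h2 (Inn _ tb) (D2 _ tb).
    rewrite (_ : (fun s => _ * _) =
      (fun s => (s - t)^-1 * (rip p (x1 s) (x1 s) - rip p (x1 t) (x1 t)) +
                (s - t)^-1 * (rip p (x2 s) (x2 s) - rip p (x2 t) (x2 t)))); last first.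
      by apply/funext => s; ring.
    exact: cvgD q1 q2.
  - by rewrite z1 z2 (rip00 p (h1 _ bb)) addr0.
have r10 := rip_ge0 p (x1 b); have r20 := rip_ge0 p (x2 b).
split; [apply: (rip_eq0 d0 (h1 _ bb) (p := p))|apply: (rip_eq0 d0 (h2 _ bb) (p := p))].
  by rewrite -(lerD2r (rip p (x2 b) (x2 b))) add0r (le_trans phib).
by rewrite -(lerD2l (rip p (x1 b) (x1 b))) addr0 (le_trans phib).
Qed.

Lemma explicit_of_difference (u : vpair R d) v w : u.1 - v = 0 /\ u.2 - w = 0 -> u = (v, w).
Proof. by case: u => a b /= [/eqP]; rewrite subr_eq0 => /eqP -> /eqP; rewrite subr_eq0 => /eqP ->. Qed.

(** On [0, b] the norm of index n of u is bounded, so [energy_inequality] holds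
    there with a constant independent of time and the difference from the
    explicit solution vanishes at b. The index n > d/2 + 1 is the one at which
    G_n is available. *)
Lemma mhd_unique (nu eta kappa lambda n : R) (Ghat : R -> R) v0 c0 :
  0 <= nu -> 0 <= eta -> 0 <= kappa -> 0 <= lambda ->
  is_Ghat (d := d) Ghat -> above_critical (d := d) n ->
  in_Hinf v0 -> in_Hinf c0 -> bilP v0 v0 = 0 -> bilP c0 c0 = 0 -> bilP v0 c0 = bilP c0 v0 ->
  laplacian v0 = - kappa ^+ 2 *: v0 -> laplacian c0 = - lambda ^+ 2 *: c0 ->
  forall T (u : R -> vpair R d), mhd_cauchy_solution nu eta (v0, c0) T u ->
  forall b, time_dom T b ->
    u b = (expR (- (kappa ^+ 2 * nu) * b) *: v0, expR (- (lambda ^+ 2 * eta) * b) *: c0).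
Proof.
move=> nu0 eta0 k0 l0 hG hn Hv Hc bv bc bvc lv lc T u [[T0 [Du [Du0 Du1]] ud] u0] b Db.
have [b0 bT] := Db.
have [C [C0 hE]] := energy_inequality d0 nu0 eta0 k0 l0 hG hn Hv Hc bv bc bvc lv lc.
have sub : `[0, b]%classic `<=` time_dom T.
  exact: itv_sub_time_dom Db.
have dom s : 0 <= s <= b -> time_dom T s by move=> sb; apply: sub; rewrite /= in_itv.
have Hu s : 0 <= s <= b -> in_Hinf (u s).1 /\ in_Hinf (u s).2.
  by move=> /dom ts; have [+ _] := Du1 0%N s ts; rewrite Du0//; case.
have d1 s : 0 <= s <= b -> norm_deriv `[0, b] (fun s => (u s).1) s (mhd_rhs nu eta (u s)).1.
  by move=> /dom ts; apply: norm_derivW sub _; exact: has_deriv_fst (ud s ts).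
have d2 s : 0 <= s <= b -> norm_deriv `[0, b] (fun s => (u s).2) s (mhd_rhs nu eta (u s)).2.
  by move=> /dom ts; apply: norm_derivW sub _; exact: has_deriv_snd (ud s ts).
have [M HM] : exists M : R, forall t, 0 <= t <= b -> pair_norm n (u t) <= M.
  exact: (rip_pair_bounded n b0 Hu (fun t tb => ex_intro _ _ (d1 t tb)) (fun t tb => ex_intro _ _ (d2 t tb))).
pose A s := expR (- (kappa ^+ 2 * nu) * s); pose B s := expR (- (lambda ^+ 2 * eta) * s).
pose x1 s := (u s).1 - A s *: v0; pose x2 s := (u s).2 - B s *: c0.
pose W1 s := (mhd_rhs nu eta (u s)).1 - (- (kappa ^+ 2 * nu) * A s) *: v0.
pose W2 s := (mhd_rhs nu eta (u s)).2 - (- (lambda ^+ 2 * eta) * B s) *: c0.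
have inI s : `[0, b]%classic s -> 0 <= s <= b by rewrite /= in_itv.
have Inn s : 0 <= s <= b -> `[0, b]%classic s by rewrite /= in_itv.
have hu1 s (sb : `[0, b]%classic s) : in_Hinf (u s).1 := (Hu s (inI s sb)).1.
have hu2 s (sb : `[0, b]%classic s) : in_Hinf (u s).2 := (Hu s (inI s sb)).2.
have hx1 s (sb : `[0, b]%classic s) : in_Hinf (x1 s) := in_HinfB (hu1 s sb) (in_HinfZ (A s) Hv).
have hx2 s (sb : `[0, b]%classic s) : in_Hinf (x2 s) := in_HinfB (hu2 s sb) (in_HinfZ (B s) Hc).
have D1 s (sb : 0 <= s <= b) : norm_deriv `[0, b] x1 s (W1 s) :=
  norm_derivB hu1 (fun r _ => in_HinfZ (A r) Hv) (Inn s sb) (d1 s sb) (norm_deriv_expR _ _ _ Hv).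
have D2 s (sb : 0 <= s <= b) : norm_deriv `[0, b] x2 s (W2 s) :=
  norm_derivB hu2 (fun r _ => in_HinfZ (B r) Hc) (Inn s sb) (d2 s sb) (norm_deriv_expR _ _ _ Hc).
have G1 t : 0 <= t <= b -> 2 * rip n (x1 t) (W1 t) + 2 * rip n (x2 t) (W2 t) <=
    2 * (Ghat n * M + C) * (rip n (x1 t) (x1 t) + rip n (x2 t) (x2 t)).
  move=> tb; have [t0 _] := andP tb; have [h1 h2] := Hu t tb.
  have [HW1 _] := D1 t tb; have [HW2 _] := D2 t tb.
  have E := hE (u t) _ _ h1 h2 (expR_decay_bounds (mulr_ge0 (sqr_ge0 kappa) nu0) t0)
    (expR_decay_bounds (mulr_ge0 (sqr_ge0 lambda) eta0) t0) HW1 HW2.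
  exact: (growth_arith (ltW (hG n hn).1) (HM t tb) (rip_ge0 n (x1 t)) (rip_ge0 n (x2 t)) E).
have z10 : x1 0 = 0 by rewrite /x1 /A u0 mulr0 expR0 scale1r subrr.
have z20 : x2 0 = 0 by rewrite /x2 /B u0 mulr0 expR0 scale1r subrr.
have [e1 e2] := rip_curves_vanish b0 hx1 hx2 D1 D2 G1 z10 z20.
exact: (explicit_of_difference (conj e1 e2)).
Qed.

End Uniqueness.

(** * Limits and integrals of exponentials *)

Section ExponentialIntegrals.
Context {R : realType}.
Notation mu := (@lebesgue_measure R).

Lemma expR_scale_cvg0 (a : R) : 0 < a -> expR (- (a * t)) @[t --> +oo] --> (0 : R).
Proof.
move=> a0; apply/cvgrPdist_le => eps e0.
near=> t; rewrite sub0r normrN ger0_norm ?expR_ge0//.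
have t0 : 0 < t by near: t; exact: nbhs_pinfty_gt.
have te : (a * eps)^-1 < t by near: t; apply: nbhs_pinfty_gt; exact: num_real.
rewrite expRN; apply: (@le_trans _ _ (a * t)^-1).
  rewrite lef_pV2 ?posrE ?expR_gt0 ?mulr_gt0//.
  by apply: le_trans (expR_ge1Dx _); rewrite lerDr.
rewrite -[eps]invrK lef_pV2 ?posrE ?invr_gt0 ?mulr_gt0//.
have -> : eps^-1 = a * (a * eps)^-1 by field; rewrite !gt_eqF.
by rewrite ler_pM2l// ltW.
Unshelve. all: by end_near.
Qed.

Lemma integral_expR (a : R) : 0 < a ->
  (\int[mu]_(t in `[0%R, +oo[) (expR (- (a * t)))%:E = (a^-1)%:E)%E.
Proof.
move=> a0.
pose F t := - a^-1 * expR (- a * t).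
have dF t : is_derive t (1 : R) F (expR (- (a * t))).
  have := is_deriveZ (- a^-1) (is_derive_expR_scale (- a) t).
  move/is_derive_eq; apply; rewrite /GRing.scale /= mulrA mulNr mulrN opprK mulVf ?gt_eqF// mul1r.
  by rewrite mulNr.
have cexp : continuous (fun t : R => expR (- (a * t))).
  move=> t; apply: differentiable_continuous; apply/derivable1_diffP.
  have [+ _] := is_derive_expR_scale (- a) t.
  by rewrite (_ : (fun t : R => expR (- a * t)) = (fun t => expR (- (a * t))))//; apply/funext => s; rewrite mulNr.
rewrite (@ge0_continuous_FTC2y _ _ F 0 0).
- by rewrite /F mulr0 expR0 mulr1 sub0e -EFinN opprK.
- by move=> t _; exact: expR_ge0.
- exact: continuous_subspaceT.
- rewrite /F -[X in _ --> X](mulr0 (- a^-1)); apply: cvgM; first exact: cvg_cst.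
  by under eq_fun do rewrite mulNr; exact: expR_scale_cvg0.
- by move=> t _; have [] := dF t.
- apply: cvg_at_right_filter; apply: differentiable_continuous; apply/derivable1_diffP.
  by have [] := dF 0.
- by move=> t _; rewrite derive1E; have [_ ->] := dF t.
Qed.

Lemma measurable_expR_scale (a : R) : measurable_fun setT (fun t : R => expR (- (a * t))).
Proof. by apply: measurableT_comp => //; apply: measurableT_comp => //; exact: measurable_funM. Qed.

(** Two exponentials, because the two components of the solution decay at
    different rates. *)
Lemma le_integral_exp (f : R -> R) (A B a b : R) : 0 < a -> 0 < b -> 0 <= A -> 0 <= B ->
  measurable_fun setT f -> (forall t, 0 <= t -> 0 <= f t) ->
  (forall t, 0 <= t -> f t <= A * expR (- (a * t)) + B * expR (- (b * t))) ->
  (\int[mu]_(t in `[0%R, +oo[) (f t)%:E <= (A / a + B / b)%:E)%E.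
Proof.
move=> a0 b0 A0 B0 mf f0 fle.
have dm (c : R) D : measurable_fun D (fun t : R => expR (- (c * t))).
  by apply: measurable_funTS; exact: measurable_expR_scale.
have I (c C : R) : 0 < c -> 0 <= C ->
    (\int[mu]_(t in `[0%R, +oo[) (C * expR (- (c * t)))%:E = (C / c)%:E)%E.
  move=> c0 C0; under eq_integral do rewrite EFinM.
  rewrite ge0_integralZl//=.
  - by rewrite integral_expR// -EFinM.
  - by apply/measurable_EFinP; exact: dm.
apply: (@le_trans _ _ (\int[mu]_(t in `[0%R, +oo[) (A * expR (- (a * t)) + B * expR (- (b * t)))%:E)%E).
  apply: ge0_le_integral => //.
  - by move=> t; rewrite /= in_itv /= andbT => /f0; rewrite lee_fin.
  - by apply/measurable_EFinP; apply: measurable_funTS.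
  - by apply/measurable_EFinP; apply: measurable_funD; apply: measurable_funM; try exact: measurable_cst; exact: dm.
  - by move=> t; rewrite /= in_itv /= andbT => /fle; rewrite lee_fin.
under eq_integral do rewrite EFinD.
rewrite ge0_integralD//=.
- by rewrite !I// -EFinD.
- by move=> t _; rewrite lee_fin mulr_ge0// expR_ge0.
- by apply/measurable_EFinP; apply: measurable_funM; [exact: measurable_cst|exact: dm].
- by move=> t _; rewrite lee_fin mulr_ge0// expR_ge0.
- by apply/measurable_EFinP; apply: measurable_funM; [exact: measurable_cst|exact: dm].
Qed.

End ExponentialIntegrals.

(** * Elementary inequalities *)

Section RealBounds.
Context {R : realType}.

Lemma sqrt_sqr_le_add (x y : R) : 0 <= x -> 0 <= y -> Num.sqrt (x ^+ 2 + y ^+ 2) <= x + y.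
Proof.
move=> x0 y0; rewrite -[leRHS](ger0_norm (addr_ge0 x0 y0)) -sqrtr_sqr ler_wsqrtr//.
by rewrite sqrrD -addrA [_ *+ 2 + _]addrC addrA lerDl mulrn_wge0// mulr_ge0.
Qed.

Lemma cauchy_schwarz2 (x y z t : R) :
  x * z + y * t <= Num.sqrt (x ^+ 2 + y ^+ 2) * Num.sqrt (z ^+ 2 + t ^+ 2).
Proof.
apply: (le_trans (ler_norm _)).
rewrite -sqrtrM ?addr_ge0 ?sqr_ge0// -sqrtr_sqr ler_wsqrtr//.
rewrite -subr_ge0 (_ : _ - _ = (x * t - y * z) ^+ 2) ?sqr_ge0//; ring.
Qed.

Lemma le_min_rate (a b c e t : R) : 0 <= t -> 0 <= a -> 0 <= b -> 0 < c -> 0 < e ->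
  expR (- (a * c * t)) <= expR (- (Num.min a b * Num.min c e * t)).
Proof.
move=> t0 a0 b0 c0 e0; rewrite ler_expR lerN2 ler_wpM2r//.
by apply: ler_pM; rewrite ?le_min ?a0 ?b0 ?(ltW c0) ?(ltW e0)// ge_min lexx.
Qed.

Lemma weighted_sum_le (x y m k l v w : R) : x <= m -> y <= m -> 0 <= m ->
  0 <= k -> 0 <= l -> 0 <= v -> 0 <= w ->
  x * k * v + y * l * w <= m * Num.sqrt (k ^+ 2 + l ^+ 2) * Num.sqrt (v ^+ 2 + w ^+ 2).
Proof.
move=> xm ym m0 k0 l0 v0 w0; rewrite -!mulrA; apply: (@le_trans _ _ (m * (k * v + l * w))).
  by rewrite mulrDr; apply: lerD; apply: ler_wpM2r; rewrite ?mulr_ge0.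
by rewrite ler_wpM2l// cauchy_schwarz2.
Qed.

Lemma rate_gt0 (x y : R) : 1 <= x -> 0 < y -> 0 < x ^+ 2 * y.
Proof. by move=> x1 y0; rewrite mulr_gt0// exprn_gt0// (lt_le_trans ltr01). Qed.

Lemma powR_sub2 (x p : R) : 0 < x -> x `^ (p - 2) = x `^ p / x ^+ 2.
Proof.
move=> x0; rewrite powRD; last by apply/implyP => _; rewrite gt_eqF.
by rewrite powRN powR_mulrn// ltW.
Qed.

Lemma powR_rate (x y p z : R) : 1 <= x -> 0 < y ->
  x `^ (p - 2) / y * z = x `^ p * z / (x ^+ 2 * y).
Proof.
move=> x1 y0; have x0 : 0 < x by apply: lt_le_trans x1.
by rewrite powR_sub2//; field; rewrite !gt_eqF.
Qed.

Lemma powR_double (x p : R) : x `^ (2 * p) = (x `^ p) ^+ 2.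
Proof. by rewrite [2 * p]mulrC -powR_mulrn ?powR_ge0// powRrM. Qed.

End RealBounds.

(** * The explicit solution *)

Section ExplicitSolution.
Context {R : realType} {d : nat} (d0 : (0 < d)%N).
Implicit Types (v w : vfield R d) (u : R -> vpair R d).
Local Opaque leray bilP advect laplacian mode_ip rip ip hnorm.

Definition decay_pair (a b : R) v w : R -> vpair R d :=
  fun t => (expR (- a * t) *: v, expR (- b * t) *: w).

Lemma pair_norm_le p (x : vpair R d) : pair_norm p x <= hnorm p x.1 + hnorm p x.2.
Proof. by apply: sqrt_sqr_le_add; exact: sqrtr_ge0. Qed.

Lemma has_deriv_pair T u t (w : vpair R d) : norm_deriv (time_dom T) (fun s => (u s).1) t w.1 ->
  norm_deriv (time_dom T) (fun s => (u s).2) t w.2 -> has_deriv T u t w.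
Proof.
move=> [H1 c1] [H2 c2]; split; first by split.
move=> p; apply: squeeze0 (_ : hnorm p ((s - t)^-1 *: ((u s).1 - (u t).1) - w.1) +
  hnorm p ((s - t)^-1 *: ((u s).2 - (u t).2) - w.2) @[s --> within (time_dom T) t^'] --> (0 : R)).
  by move=> s _ _; rewrite sqrtr_ge0; exact: (pair_norm_le p ((s - t)^-1 *: (u s - u t) - w)).
by rewrite -[X in _ --> X]addr0; apply: cvgD; [exact: c1|exact: c2].
Qed.

Lemma decay_pair_deriv T (a b : R) v w t : in_Hinf v -> in_Hinf w ->
  has_deriv T (decay_pair a b v w) t (decay_pair a b (- a *: v) (- b *: w) t).
Proof.
move=> Hv Hw; apply: has_deriv_pair => /=.
  rewrite scalerA mulrC; exact: norm_deriv_expR.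
rewrite scalerA mulrC; exact: norm_deriv_expR.
Qed.

Lemma decay_pair_in_Hinf (a b : R) v w t : in_Hinf v -> in_Hinf w ->
  pair_in_Hinf (decay_pair a b v w t).
Proof. by move=> Hv Hw; split; exact: in_HinfZ. Qed.

(** Differentiating in time multiplies v by - a and w by - b, so all the
    derivatives are pairs of the same form. *)
Lemma decay_pair_smooth T (a b : R) v w : in_Hinf v -> in_Hinf w ->
  smooth_curve T (decay_pair a b v w).
Proof.
move=> Hv Hw; exists (fun j => decay_pair a b ((- a) ^+ j *: v) ((- b) ^+ j *: w)); split.
  by move=> t _; rewrite !expr0 !scale1r.
move=> j t _; have Hv' := in_HinfZ ((- a) ^+ j) Hv; have Hw' := in_HinfZ ((- b) ^+ j) Hw.
split; first exact: decay_pair_in_Hinf.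
by rewrite !exprS -!scalerA; exact: decay_pair_deriv.
Qed.

(** The nonlinear terms cancel: those of the first equation vanish separately,
    those of the second one are equal. *)
Lemma decay_pair_rhs (nu eta kappa lambda : R) v0 c0 t :
  smooth_per v0 -> smooth_per c0 -> bilP v0 v0 = 0 -> bilP c0 c0 = 0 ->
  bilP v0 c0 = bilP c0 v0 ->
  laplacian v0 = - kappa ^+ 2 *: v0 -> laplacian c0 = - lambda ^+ 2 *: c0 ->
  let a := kappa ^+ 2 * nu in let b := lambda ^+ 2 * eta in
  mhd_rhs nu eta (decay_pair a b v0 c0 t) = decay_pair a b (- a *: v0) (- b *: c0) t.
Proof.
move=> sv sc bv bc bvc lv lc a b.
rewrite /mhd_rhs /decay_pair /=; set x := expR _; set y := expR _.
have e1 := bilP_Z0 x sv bv; have e2 := bilP_Z0 y sc bc.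
have e3 := bilP_ZC x y sv sc bvc.
have l1 : laplacian (x *: v0) = x *: laplacian v0 := laplacianZ x sv.
have l2 : laplacian (y *: c0) = y *: laplacian c0 := laplacianZ y sc.
congr (_, _).
  by rewrite e1 e2 addr0 subr0 l1 lv !scalerA; congr (_ *: _); rewrite /a; ring.
by rewrite e3 addrK l2 lc !scalerA; congr (_ *: _); rewrite /b; ring.
Qed.

Lemma decay_pair_norm (a b kappa lambda p : R) v w t : 1 <= kappa -> 1 <= lambda ->
  in_Hinf v -> in_Hinf w ->
  laplacian v = - kappa ^+ 2 *: v -> laplacian w = - lambda ^+ 2 *: w ->
  pair_norm p (decay_pair a b v w t) =
  Num.sqrt ((expR (- a * t) * kappa `^ p * l2norm v) ^+ 2 +
            (expR (- b * t) * lambda `^ p * l2norm w) ^+ 2).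
Proof.
move=> k1 l1 Hv Hw lv lw.
have sv := in_Hinf_smooth_per Hv; have sw := in_Hinf_smooth_per Hw.
have cv := in_Hinf_cper Hv; have cw := in_Hinf_cper Hw.
have [_ rv] := rip_eigen d0 p k1 sv lv; have [_ rw] := rip_eigen d0 p l1 sw lw.
rewrite /pair_norm /decay_pair /= (hnormZ p _ cv) (hnormZ p _ cw) !exprMn.
rewrite (hnorm_sqr p cv) (hnorm_sqr p cw) rv rw !powR_double.
by rewrite -!normrX !ger0_norm ?exprn_ge0 ?expR_ge0// !mulrA.
Qed.

End ExplicitSolution.

Lemma above_critical_half {R : realType} (d : nat) : above_critical (d := d) (d%:R / 2 + 2 : R).
Proof. by rewrite /above_critical ltrD2l ltr1n. Qed.

(** * Decay and its consequences *)

Section Decay.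
Context {R : realType} {d : nat}.
Implicit Types (u : R -> vpair R d).

(** A bound C_p e^(- mu t) on every norm gives the other properties: it tends
    to zero, and its powers are exponentials as well, hence integrable. The
    index d/2 + 2 serves wherever some n > d/2 + 1 is asked for. *)
Lemma exponential_decay_decaying (nu eta : R) (Ghat : R -> R) u : 0 < nu -> 0 < eta ->
  is_Ghat (d := d) Ghat -> mhd_solution nu eta +oo%E u ->
  (forall p, measurable_fun setT (fun t => pair_norm p (u t))) ->
  (forall p, exists C : R, 0 <= C /\ forall t, 0 <= t ->
     pair_norm p (u t) <= C * expR (- (Num.min nu eta * t))) ->
  decaying nu eta Ghat u.
Proof.
move=> nu0 eta0 hG su mu bu.
have m0 : 0 < Num.min nu eta by rewrite lt_min nu0.
have n0 p t : 0 <= pair_norm p (u t) by exact: sqrtr_ge0.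
have hn := above_critical_half (R := R) d.
have lim p : pair_norm p (u t) @[t --> +oo] --> (0 : R).
  have [C [C0 H]] := bu p.
  apply: (@squeeze_cvgr _ _ _ _ (fun=> 0) (fun t => C * expR (- (Num.min nu eta * t)))).
  - near=> t; rewrite n0 H//; near: t; exact: nbhs_pinfty_ge.
  - exact: cvg_cst.
  - rewrite -[X in _ --> X](mulr0 C); apply: cvgM; [exact: cvg_cst|exact: expR_scale_cvg0].
have int p gamma : 0 < gamma -> (power_integral p gamma u < +oo)%E.
  move=> g0; have [C [C0 H]] := bu p.
  (* A single exponential dominates the integrand; the second one has coefficient
     0 and the arbitrary rate 1. *)
  apply: (@le_lt_trans _ _ ((C `^ gamma) / (Num.min nu eta * gamma) + 0 / 1)%:E); last exact: ltry.
  apply: le_integral_exp => //.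
  - by rewrite mulr_gt0.
  - exact: powR_ge0.
  - exact: measurableT_comp (measurable_powR gamma) (mu p).
  - by move=> t _; exact: powR_ge0.
  - move=> t t0; rewrite mul0r addr0.
    rewrite [in leRHS](_ : _ * gamma * t = (Num.min nu eta * t) * gamma); last by ring.
    rewrite -mulNr expRM -powRM ?expR_ge0//.
    have E0 : 0 <= C * expR (- (Num.min nu eta * t)) by rewrite mulr_ge0 ?expR_ge0.
    by apply: (ge0_ler_powR (ltW g0)); rewrite ?nnegrE//; exact: H.
split=> //.
- pose n : R := d%:R / 2 + 2; have [G0 _] := hG n hn.
  have e0 : 0 < Num.min nu eta / Ghat n by rewrite divr_gt0.
  have /cvgrPdist_lt /(_ _ e0) H := lim n.
  have [t [t0 Ht]] : exists t : R, 0 <= t /\ `|0 - pair_norm n (u t)| < Num.min nu eta / Ghat n.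
    apply: (@filter_ex _ (nbhs +oo)); apply: filterI H.
    exact: nbhs_pinfty_ge.
  by exists n, t; split => //; move: Ht; rewrite sub0r normrN ger0_norm.
- by exists (d%:R / 2 + 2); split.
- by exists (d%:R / 2 + 2), 1; split => //; exact: int.
- by have [C [C0 H]] := bu (d%:R / 2 + 2); exists (d%:R / 2 + 2), C.
Unshelve. all: by end_near.
Qed.

End Decay.

(** * Norms of the explicit solution and maximality *)

Section Bounds.
Context {R : realType} {d : nat} (d0 : (0 < d)%N).
Implicit Types (v w : vfield R d).

(** Each component has norm e^(- a t) kappa^p |v|, respectively e^(- b t)
    lambda^p |w|. The first inequality is sqrt (x^2 + y^2) <= x + y for
    nonnegative numbers; the second one replaces both rates by a common lower
    bound and applies the inequality of Cauchy and Schwarz in the plane. *)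
Lemma decay_pair_bounds (nu eta kappa lambda p t : R) v w : 0 < nu -> 0 < eta ->
  1 <= kappa -> 1 <= lambda -> in_Hinf v -> in_Hinf w ->
  laplacian v = - kappa ^+ 2 *: v -> laplacian w = - lambda ^+ 2 *: w -> 0 <= t ->
  let a := kappa ^+ 2 * nu in let b := lambda ^+ 2 * eta in
  [/\ pair_norm p (decay_pair a b v w t) =
       Num.sqrt (expR (- (2 * kappa ^+ 2 * nu * t)) * kappa `^ (2 * p) * l2norm v ^+ 2 +
                 expR (- (2 * lambda ^+ 2 * eta * t)) * lambda `^ (2 * p) * l2norm w ^+ 2),
      pair_norm p (decay_pair a b v w t) <=
       expR (- (a * t)) * kappa `^ p * l2norm v + expR (- (b * t)) * lambda `^ p * l2norm w &
      expR (- (a * t)) * kappa `^ p * l2norm v + expR (- (b * t)) * lambda `^ p * l2norm w <=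
      expR (- (Num.min (kappa ^+ 2) (lambda ^+ 2) * Num.min nu eta * t)) *
         Num.sqrt (kappa `^ (2 * p) + lambda `^ (2 * p)) * pair_l2norm (v, w)].
Proof.
move=> nu0 eta0 k1 l1 Hv Hw lv lw t0 a b.
have N := decay_pair_norm d0 a b p t k1 l1 Hv Hw lv lw.
rewrite !mulNr in N.
have sq (x y : R) : expR (- (2 * x * y * t)) = expR (- (x * y * t)) ^+ 2.
  by rewrite -expRM_natl; congr expR; ring.
have nv : 0 <= l2norm v by exact: sqrtr_ge0.
have nw : 0 <= l2norm w by exact: sqrtr_ge0.
have A0 (x y z q : R) : 0 <= z -> 0 <= expR x * y `^ q * z.
  by move=> z0; rewrite !mulr_ge0 ?expR_ge0 ?powR_ge0.
split.
- by rewrite N !sq !powR_double !exprMn.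
- by rewrite N; apply: sqrt_sqr_le_add; exact: A0.
- have r1 := le_min_rate t0 (sqr_ge0 kappa) (sqr_ge0 lambda) nu0 eta0.
  have r2 := le_min_rate t0 (sqr_ge0 lambda) (sqr_ge0 kappa) eta0 nu0.
  rewrite minC [Num.min eta nu]minC in r2.
  by rewrite !powR_double; apply: weighted_sum_le => //; exact: powR_ge0.
Qed.

(** Since kappa and lambda are at least 1, the rate of [decay_pair_bounds] is
    at least the minimum of nu and eta. *)
Lemma decay_pair_exponential (nu eta kappa lambda p : R) v w : 0 < nu -> 0 < eta ->
  1 <= kappa -> 1 <= lambda -> in_Hinf v -> in_Hinf w ->
  laplacian v = - kappa ^+ 2 *: v -> laplacian w = - lambda ^+ 2 *: w ->
  exists C : R, 0 <= C /\ forall t, 0 <= t ->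
    pair_norm p (decay_pair (kappa ^+ 2 * nu) (lambda ^+ 2 * eta) v w t) <=
    C * expR (- (Num.min nu eta * t)).
Proof.
move=> nu0 eta0 k1 l1 Hv Hw lv lw.
exists (Num.sqrt (kappa `^ (2 * p) + lambda `^ (2 * p)) * pair_l2norm (v, w)).
have C0 : 0 <= Num.sqrt (kappa `^ (2 * p) + lambda `^ (2 * p)) * pair_l2norm (v, w).
  by rewrite mulr_ge0 ?sqrtr_ge0.
split=> // t t0.
have [_ b1 b2] := decay_pair_bounds p nu0 eta0 k1 l1 Hv Hw lv lw t0.
apply: (le_trans b1); apply: (le_trans b2).
rewrite -mulrA [leRHS]mulrC ler_wpM2r// ler_expR lerN2 ler_wpM2r//.
rewrite ler_peMl; first by [].
  by rewrite ltW// lt_min nu0.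
by rewrite le_min !exprn_ege1.
Qed.

Lemma measurable_decay_pair_norm (a b kappa lambda p : R) v w : 1 <= kappa -> 1 <= lambda ->
  in_Hinf v -> in_Hinf w ->
  laplacian v = - kappa ^+ 2 *: v -> laplacian w = - lambda ^+ 2 *: w ->
  measurable_fun setT (fun t => pair_norm p (decay_pair a b v w t)).
Proof.
move=> k1 l1 Hv Hw lv lw.
under eq_fun do rewrite (decay_pair_norm d0 a b p _ k1 l1 Hv Hw lv lw) !mulNr.
apply: (measurableT_comp (continuous_measurable_fun (@sqrt_continuous R))).
have m (c e f : R) : measurable_fun setT (fun t : R => (expR (- (c * t)) * e * f) ^+ 2).
  apply: measurable_funX; apply: measurable_funM; last exact: measurable_cst.
  by apply: measurable_funM; [exact: measurable_expR_scale|exact: measurable_cst].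
by apply: measurable_funD; exact: m.
Qed.

Lemma decay_pair_integral (nu eta kappa lambda p : R) v w : 0 < nu -> 0 < eta ->
  1 <= kappa -> 1 <= lambda -> in_Hinf v -> in_Hinf w ->
  laplacian v = - kappa ^+ 2 *: v -> laplacian w = - lambda ^+ 2 *: w ->
  (\int[lebesgue_measure]_(t in `[0%R, +oo[) (pair_norm p (decay_pair (kappa ^+ 2 * nu) (lambda ^+ 2 * eta) v w t))%:E <=
   (kappa `^ (p - 2) / nu * l2norm v + lambda `^ (p - 2) / eta * l2norm w)%:E)%E.
Proof.
move=> nu0 eta0 k1 l1 Hv Hw lv lw; rewrite (powR_rate p (l2norm v) k1 nu0) (powR_rate p (l2norm w) l1 eta0).
apply: le_integral_exp.
- exact: rate_gt0.
- exact: rate_gt0.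
- by rewrite mulr_ge0 ?powR_ge0 ?sqrtr_ge0.
- by rewrite mulr_ge0 ?powR_ge0 ?sqrtr_ge0.
- exact: measurable_decay_pair_norm k1 l1 Hv Hw lv lw.
- by move=> t _; exact: sqrtr_ge0.
- move=> t t0; have [_ e2 _] := decay_pair_bounds p nu0 eta0 k1 l1 Hv Hw lv lw t0.
  apply: (le_trans e2); rewrite le_eqVlt; apply/orP; left; apply/eqP.
  move: (l2norm _) (l2norm _) => n1 n2; ring.
Qed.

Lemma decay_pair_solution (nu eta kappa lambda : R) v0 c0 :
  in_Hinf v0 -> in_Hinf c0 -> bilP v0 v0 = 0 -> bilP c0 c0 = 0 -> bilP v0 c0 = bilP c0 v0 ->
  laplacian v0 = - kappa ^+ 2 *: v0 -> laplacian c0 = - lambda ^+ 2 *: c0 ->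
  mhd_cauchy_solution nu eta (v0, c0) +oo%E (decay_pair (kappa ^+ 2 * nu) (lambda ^+ 2 * eta) v0 c0).
Proof.
move=> Hv Hc bv bc bvc lv lc.
have sv := in_Hinf_smooth_per Hv; have sc := in_Hinf_smooth_per Hc.
split; last by rewrite /decay_pair !mulr0 expR0 !scale1r.
split; [exact: ltry|exact: decay_pair_smooth|].
move=> t _; rewrite (decay_pair_rhs nu eta t sv sc bv bc bvc lv lc).
exact: decay_pair_deriv.
Qed.

(** A maximal solution with a finite time of existence would be extended by u,
    with which it agrees. *)
Lemma global_unique_maximal (nu eta : R) (u0 : vpair R d) u :
  mhd_cauchy_solution nu eta u0 +oo%E u ->
  (forall T (u' : R -> vpair R d), mhd_cauchy_solution nu eta u0 T u' ->
     forall t, time_dom T t -> u' t = u t) ->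
  the_maximal_solution nu eta u0 +oo%E u.
Proof.
move=> su uniq_u; split.
  split; first exact: su.
  by move=> T' u' T'oo; have := leey T'; rewrite leNgt T'oo.
move=> T' u' [cu' mu'].
have uT := uniq_u T' u' cu'.
have [T'E|T'oo] := eqVneq T' +oo%E; first by rewrite T'E in uT *.
exfalso; apply: (mu' +oo%E u _ su); first by rewrite ltey.
by move=> t /uT ->.
Qed.

End Bounds.

Theorem proposition6p12 (R : realType) (d : nat) (hd : (2 <= d)%N)
  (nu eta : R) (hnu : 0 < nu) (heta : 0 < eta)
  (Ghat : R -> R) (hGhat : is_Ghat (d := d) Ghat)
  (v0 c0 : vfield R d) (hB : gen_beltrami_pair (v0, c0))
  (kappa lambda : R) (hkappa : 1 <= kappa) (hlambda : 1 <= lambda)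
  (hv0 : laplacian v0 = - kappa ^+ 2 *: v0)
  (hc0 : laplacian c0 = - lambda ^+ 2 *: c0) :
  let mu := Num.min nu eta in
  exists u : R -> vpair R d,
    (* (i) *)
    the_maximal_solution nu eta (v0, c0) +oo%E u /\
    (forall t : R, 0 <= t ->
       u t = (expR (- (kappa ^+ 2 * nu * t)) *: v0,
              expR (- (lambda ^+ 2 * eta * t)) *: c0)) /\
    (* (ii) *)
    (forall p t : R, 0 <= t ->
       pair_norm p (u t) =
         Num.sqrt (expR (- (2 * kappa ^+ 2 * nu * t)) * kappa `^ (2 * p)
                     * l2norm v0 ^+ 2 +
                   expR (- (2 * lambda ^+ 2 * eta * t)) * lambda `^ (2 * p)
                     * l2norm c0 ^+ 2) /\
       Num.sqrt (expR (- (2 * kappa ^+ 2 * nu * t)) * kappa `^ (2 * p)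
                   * l2norm v0 ^+ 2 +
                 expR (- (2 * lambda ^+ 2 * eta * t)) * lambda `^ (2 * p)
                   * l2norm c0 ^+ 2) <=
         expR (- (kappa ^+ 2 * nu * t)) * kappa `^ p * l2norm v0 +
         expR (- (lambda ^+ 2 * eta * t)) * lambda `^ p * l2norm c0 /\
       expR (- (kappa ^+ 2 * nu * t)) * kappa `^ p * l2norm v0 +
         expR (- (lambda ^+ 2 * eta * t)) * lambda `^ p * l2norm c0 <=
         expR (- (Num.min (kappa ^+ 2) (lambda ^+ 2) * mu * t)) *
         Num.sqrt (kappa `^ (2 * p) + lambda `^ (2 * p)) *
         pair_l2norm (v0, c0)) /\
    decaying nu eta Ghat u /\
    in_Einf nu eta Ghat (v0, c0) /\
    (* (iii) *)
    (forall p : R,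
       (\int[lebesgue_measure]_(t in `[0%R, +oo[) (pair_norm p (u t))%:E <=
        (kappa `^ (p - 2) / nu * l2norm v0 +
         lambda `^ (p - 2) / eta * l2norm c0)%:E)%E).
Proof.
move=> mu.
have d0 : (0 < d)%N := ltn_trans (ltn0Sn 0) hd.
have [[Hv _ bv] [Hc _ bc] adv] := hB.
have bvc : bilP v0 c0 = bilP c0 v0 := congr1 (fun f => - leray f) adv.
have k0 : 0 <= kappa := le_trans ler01 hkappa.
have l0 : 0 <= lambda := le_trans ler01 hlambda.
pose u := decay_pair (kappa ^+ 2 * nu) (lambda ^+ 2 * eta) v0 c0.
have su : mhd_cauchy_solution nu eta (v0, c0) +oo%E u := decay_pair_solution nu eta Hv Hc bv bc bvc hv0 hc0.
have max_u : the_maximal_solution nu eta (v0, c0) +oo%E u.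
  apply: (global_unique_maximal su) => T u'.
  exact: (mhd_unique d0 (ltW hnu) (ltW heta) k0 l0 hGhat (above_critical_half d) Hv Hc bv bc bvc hv0 hc0).
have dec : decaying nu eta Ghat u.
  apply: (exponential_decay_decaying hnu heta hGhat su.1).
    by move=> p; exact: (measurable_decay_pair_norm d0 _ _ p hkappa hlambda Hv Hc hv0 hc0).
  by move=> p; exact: (decay_pair_exponential d0 p hnu heta hkappa hlambda Hv Hc hv0 hc0).
exists u; split; [exact: max_u|split; [|split; [|split; [exact: dec|split]]]].
- by move=> t _; rewrite /u /decay_pair !mulNr.
- move=> p t t0; have [e1 e2 e3] := decay_pair_bounds d0 p hnu heta hkappa hlambda Hv Hc hv0 hc0 t0.
  split; first exact: e1.
  split; last exact: e3.
  by rewrite -e1.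
- split; first exact: (conj Hv Hc).
  by exists u; split; [exact: max_u|exact: dec].
- by move=> p; exact: (decay_pair_integral d0 p hnu heta hkappa hlambda Hv Hc hv0 hc0).
Qed.
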